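(* For Schulze elections in the nonunique-winner model, each of the following problems is W[2]-hard when parameterized on the bound $k$ given in the input: (1) constructive control by adding voters, (2) constructive control by deleting voters, and (3) constructive control by adding candidates.
   Context: An election consists of a finite candidate set $C$ and a collection of voters, each casting a tie-free linear order over the candidates. WMG: for distinct $c,d$, edge weight $D(c,d)$ = (number preferring $c$ to $d$) minus (number preferring $d$ to $c$); path strength = minimum edge weight. Schulze: $c$ is a winner iff for every other $d$, some simple path from $c$ to $d$ has strength at least that of every simple path from $d$ to $c$. Constructive control by adding voters: given $C$, disjoint voter collections $V,W$, $p\in C$, integer $k\ge0$: is there $Q\subseteq W$, $\|Q\|\le k$, with $p$ a winner of $(C,V\cup Q)$? Constructive control by deleting voters: given $C$, $V$, $p$, $k$: can deleting at most $k$ voters make $p$ a winner? Constructive control by adding candidates: given disjoint $C,D$, voters with votes over $C\cup D$, $p\in C$, $k$: is there $E\subseteq D$, $\|E\|\le k$, with $p$ a winner of the election with candidates $C\cup E$? W[2]-hardness is with respect to (many-one) fpt-reductions: a map $R$ from parameterized problem $(Q,j)$ to $(Q',j')$ with $x\in Q\iff R(x)\in Q'$, computable in time $f(j(x))p(|x|)$ for computable $f$ and polynomial $p$, and $j'(R(x))\le g(j(x))$ for computable $g$. *)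

(* Defs.v *)
From mathcomp Require Import all_boot all_order all_algebra.
From Stdlib Require Import ClassicalEpsilon BinNums.
Set Implicit Arguments. Unset Strict Implicit. Unset Printing Implicit Defensive.
Import Order.TTheory GRing.Theory Num.Theory.

Fixpoint pos_bits (p : positive) : seq bool :=
  match p with
  | xH => [:: true]
  | xO p => false :: pos_bits p
  | xI p => true :: pos_bits p
  end.

Definition bin (n : nat) : seq bool :=
  match bin_of_nat n with N0 => [::] | Npos p => pos_bits p end.

Inductive code := CNat of nat | CList of seq code.

Definition tok0 := [:: false; false].
Definition tok1 := [:: true; true].
Definition tsep := [:: false; true].
Definition topen := [:: true; false].

Definition enc_nat (n : nat) : seq bool :=
  flatten (map (fun b : bool => if b then tok1 else tok0) (bin n.+1)) ++ tsep.

Fixpoint enc (c : code) : seq bool :=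
  match c with
  | CNat n => enc_nat n
  | CList l => topen ++ flatten (map enc l) ++ tsep
  end.

(* decoding (classically defined; enc is injective) *)
Definition decode_spec (x : seq bool) (o : option code) : Prop :=
  match o with Some c => enc c = x | None => forall c, enc c <> x end.

Definition decode (x : seq bool) : option code :=
  epsilon (inhabits None) (decode_spec x).

Definition param_last (x : seq bool) : nat :=
  match decode x with
  | Some (CList l) => if last (CNat 0) l is CNat k then k else 0
  | _ => 0
  end.

Definition nats (s : seq nat) : code := CList (map CNat s).
Definition votes_code (V : seq (seq nat)) : code := CList (map nats V).

Inductive move := MLeft | MRight | MStay.

Record TM := mkTM {
  tm_Q : finType;
  tm_start : tm_Q;
  (* None = halt *)
  tm_delta : tm_Q -> option bool -> option (tm_Q * option bool * move)
}.

(* configuration: state, left part of tape (reversed), scanned symbol,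
   right part of tape; None is the blank symbol *)
Definition config (M : TM) :=
  (tm_Q M * seq (option bool) * option bool * seq (option bool))%type.

Definition init_config (M : TM) (x : seq bool) : config M :=
  match x with
  | [::] => (tm_start M, [::], None, [::])
  | b :: x' => (tm_start M, [::], Some b, map Some x')
  end.

Definition step (M : TM) (c : config M) : option (config M) :=
  let: (q, L, a, R) := c in
  match @tm_delta M q a with
  | None => None
  | Some (q', a', MStay) => Some (q', L, a', R)
  | Some (q', a', MLeft) => Some (q', behead L, head None L, a' :: R)
  | Some (q', a', MRight) => Some (q', a' :: L, head None R, behead R)
  end.

Fixpoint exec (M : TM) (n : nat) (c : config M) : option (config M) :=
  match n with
  | 0 => Some c
  | n'.+1 => match step c with Some c' => exec n' c' | None => None end
  end.

Fixpoint out_bits (s : seq (option bool)) : seq bool :=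
  match s with Some b :: s' => b :: out_bits s' | _ => [::] end.

Definition output (M : TM) (c : config M) : seq bool :=
  let: (_, _, a, R) := c in out_bits (a :: R).

Definition halts_with (M : TM) (x : seq bool) (t : nat) (y : seq bool) : Prop :=
  exists c, exec t (init_config M x) = Some c /\ step c = None /\ output c = y.

Definition computable (f : nat -> nat) : Prop :=
  exists M : TM, forall n, exists t, halts_with M (bin n) t (bin (f n)).

Definition poly_eval (cs : seq nat) (n : nat) : nat :=
  \sum_(i < size cs) nth 0 cs i * n ^ i.

Record pproblem := PProblem {
  lang : seq bool -> Prop;
  param : seq bool -> nat
}.

Definition fpt_reduction (P P' : pproblem) (R : seq bool -> seq bool) : Prop :=
  [/\ (forall x, lang P x <-> lang P' (R x)),
      (exists (f : nat -> nat) (cs : seq nat) (M : TM),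
         computable f /\
         forall x, exists t, t <= f (param P x) * poly_eval cs (size x)
                             /\ halts_with M x t (R x))
    & (exists g : nat -> nat, computable g /\
         forall x, param P' (R x) <= g (param P x))].

Definition fpt_reducible (P P' : pproblem) : Prop :=
  exists R, fpt_reduction P P' R.

Inductive form := FVar of nat | FNeg of form | FAnd of seq form | FOr of seq form.

Fixpoint eval (a : nat -> bool) (f : form) : bool :=
  match f with
  | FVar i => a i
  | FNeg g => ~~ eval a g
  | FAnd l => all (eval a) l
  | FOr l => has (eval a) l
  end.

Fixpoint vars (f : form) : seq nat :=
  match f with
  | FVar i => [:: i]
  | FNeg g => vars g
  | FAnd l => flatten (map vars l)
  | FOr l => flatten (map vars l)
  end.

Definition is_lit (f : form) : bool :=
  match f with FVar _ => true | FNeg (FVar _) => true | _ => false end.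

(* (Gamma_{t,d}, Delta_{t,d}) of Flum--Grohe *)
Fixpoint GammaDelta (t d : nat) : (form -> bool) * (form -> bool) :=
  match t with
  | 0 => ((fun f => if f is FAnd l then (0 < size l <= d) && all is_lit l else false),
          (fun f => if f is FOr l then (0 < size l <= d) && all is_lit l else false))
  | t'.+1 =>
      let GD := GammaDelta t' d in
      ((fun f => if f is FAnd l then all GD.2 l else false),
       (fun f => if f is FOr l then all GD.1 l else false))
  end.

Definition Gamma (t d : nat) : form -> bool := (GammaDelta t d).1.

Definition sat_weight (alpha : form) (k : nat) : Prop :=
  exists S : seq nat, [/\ uniq S, size S = k, {subset S <= vars alpha}
                        & eval (fun i => i \in S) alpha].

Fixpoint code_form (f : form) : code :=
  match f with
  | FVar i => CList [:: CNat 0; CNat i]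
  | FNeg g => CList [:: CNat 1; code_form g]
  | FAnd l => CList (CNat 2 :: map code_form l)
  | FOr l => CList (CNat 3 :: map code_form l)
  end.

Definition WSat (G : form -> bool) : pproblem :=
  PProblem (fun x => exists alpha k,
               [/\ x = enc (CList [:: code_form alpha; CNat k]), G alpha
                 & sat_weight alpha k])
           param_last.

Definition W2 (P : pproblem) : Prop :=
  exists d, 1 <= d /\ fpt_reducible P (WSat (Gamma 2 d)).

Definition W2_hard (P : pproblem) : Prop :=
  forall P', W2 P' -> fpt_reducible P' P.

(* candidates are natural numbers; a vote is a list of all candidates,
   most preferred first *)
Definition valid_votes (C : seq nat) (V : seq (seq nat)) : bool :=
  all (fun v => perm_eq v C) V.

Definition prefers (v : seq nat) (c d : nat) : bool := index c v < index d v.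

Definition WMG (V : seq (seq nat)) (c d : nat) : int :=
  (count (fun v => prefers v c d) V)%:Z - (count (fun v => prefers v d c) V)%:Z.

Definition is_path (C : seq nat) (c d : nat) (s : seq nat) : bool :=
  [&& s != [::], last c s == d, uniq (c :: s) & all (fun x => x \in C) (c :: s)].

Definition strength (V : seq (seq nat)) (c : nat) (s : seq nat) : int :=
  let ws := pairmap (WMG V) c s in foldl Order.min (head (Posz 0) ws) (behead ws).

Definition schulze_winner (C : seq nat) (V : seq (seq nat)) (c : nat) : Prop :=
  c \in C /\
  forall d, d \in C -> d != c ->
    exists s, is_path C c d s /\
      forall s', is_path C d c s' -> (strength V d s' <= strength V c s)%R.

Definition CCAV : pproblem :=
  PProblem (fun x => exists (C : seq nat) (V W : seq (seq nat)) (p k : nat),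
    [/\ x = enc (CList [:: nats C; votes_code V; votes_code W; CNat p; CNat k]),
        [&& uniq C, valid_votes C V, valid_votes C W & p \in C]
      & exists m : bitseq, size (mask m W) <= k /\
                           schulze_winner C (V ++ mask m W) p])
    param_last.

Definition CCDV : pproblem :=
  PProblem (fun x => exists (C : seq nat) (V : seq (seq nat)) (p k : nat),
    [/\ x = enc (CList [:: nats C; votes_code V; CNat p; CNat k]),
        [&& uniq C, valid_votes C V & p \in C]
      & exists m : bitseq, size V - size (mask m V) <= k /\
                           schulze_winner C (mask m V) p])
    param_last.

Definition CCAC : pproblem :=
  PProblem (fun x => exists (C D : seq nat) (V : seq (seq nat)) (p k : nat),
    [/\ x = enc (CList [:: nats C; nats D; votes_code V; CNat p; CNat k]),
        [&& uniq (C ++ D), valid_votes (C ++ D) V & p \in C]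
      & exists m : bitseq, size (mask m D) <= k /\
          let CE := C ++ mask m D in
          schulze_winner CE (map (filter (fun c => c \in CE)) V) p])
    param_last.

(* Main.v *)
Require Import Defs.
From mathcomp Require Import all_boot all_order all_algebra.
From mathcomp Require Import zify.
From Stdlib Require Import FunctionalExtensionality ClassicalEpsilon.
Set Implicit Arguments. Unset Strict Implicit. Unset Printing Implicit Defensive.
Import Order.TTheory GRing.Theory Num.Theory.

(* All three problems inherit their hardness from hitting set. A weight-k assignment is
   a choice, for each tuple of at most 2d ranks among 0, ..., k + 1, of the variables
   that have these ranks; choices that are pairwise compatible come from one assignment,
   and any term of d literals can be checked on a single tuple. Hence an instance of
   weighted Gamma_{2,d}-satisfiability becomes an instance of hitting set whose budget
   (k + 2)^(2d) depends only on k and d.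

   For adding candidates, p beats the objects, an object beats the sets that it hits,
   and each set beats p, so p wins iff it has a path through an added object to every
   set. For adding voters, the vote of an object ranks p above exactly the sets that it
   hits; the strongest path back to p runs through a candidate z that beats only p, and
   p reaches all others strongly enough only if exactly k votes are added and each set
   is hit. For deleting voters, every vote of an object comes with its reverse, and
   deleting the reverse acts like adding the vote.

   That an arbitrary fpt-reduction can be followed by these maps rests on a small stack
   language that compiles to Turing machines with quadratic overhead and in which Turing
   machines can be simulated. *)

(** [W2] ranges over all [d] and over terms of mixed polarity, whereas hitting set is monotone: only
    the presence of something can be rewarded. The obstacle is therefore the negative literal. Once
    the chosen variables are listed in increasing order between two sentinels, a variable is false
    iff it lies strictly between two consecutive entries, so every literal is certified by at most
    two ranks; this is the origin of [2d]. The budget equals the number of rank tuples and each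
    tuple has a set of its own, so exactly one object is taken per tuple. Only then does the absence
    of an object become a monotone condition, namely the presence of another object with the same
    ranks, and compatibility can be expressed by sets.

    On the Schulze side, an upper bound on the strength of a path never needs more than its last
    edge.

    The given fpt-reduction is known only through a machine with time bound [f k] times a
    polynomial, where [f] is an arbitrary computable function; the new time bound uses a power of
    two above [f k], whose binary numeral is easy to write. *)

Notation symbol := (option bool).

(** * Turing machines on a two-way infinite tape *)

Definition dir (m : move) : int :=
  match m with MLeft => - 1 | MRight => 1 | MStay => 0 end%R.

Definition set_cell (T : int -> symbol) (z : int) (a : symbol) : int -> symbol :=
  fun y => if y == z then a else T y.

Definition aconf (M : TM) := (tm_Q M * (int -> symbol) * int)%type.

Definition astep (M : TM) (c : aconf M) : option (aconf M) :=
  let: (q, T, z) := c in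
  if tm_delta q (T z) is Some (q', a, m) then
    Some (q', set_cell T z a, (z + dir m)%R) else None.

Fixpoint aexec (M : TM) (n : nat) (c : aconf M) : option (aconf M) :=
  if n is n'.+1 then if astep c is Some c' then aexec n' c' else None else Some c.

Definition HT (M : TM) (T : int -> symbol) (z : int) (n : nat)
    (T' : int -> symbol) (z' : int) : Prop :=
  exists q, aexec n (tm_start M, T, z) = Some (q, T', z') /\
            tm_delta q (T' z') = None.

Lemma set_cellE T z a y : set_cell T z a y = if y == z then a else T y.
Proof. by []. Qed.

Lemma set_cell_id T z : set_cell T z (T z) = T.
Proof. by apply: functional_extensionality => y; rewrite set_cellE; case: eqP => [->|]. Qed.

Lemma aexec_add M n1 n2 (c c' : aconf M) :
  aexec n1 c = Some c' -> aexec (n1 + n2) c = aexec n2 c'.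
Proof.
elim: n1 c => [c [->]//|n IH c] /=.
by case: (astep c) => // c1; apply: IH.
Qed.

(* Zipper configurations represent abstract tapes up to trailing blanks. *)
Definition represents (M : TM) (c : config M) (d : aconf M) : Prop :=
  let: (q, L, a, R) := c in let: (q', T, z) := d in
  [/\ q = q', a = T z,
      forall i : nat, nth None L i = T (z - 1 - i%:Z)%R
    & forall i : nat, nth None R i = T (z + 1 + i%:Z)%R].

(** A list that has run out is read as blank, which is how [head None] and [behead] act in [step];
    comparing through [nth None] lets the two kinds of step agree without any record of list
    lengths. *)
Lemma step_represents M (c : config M) (d : aconf M) : represents c d ->
  match astep d with
  | Some d' => exists c', step c = Some c' /\ represents c' d'
  | None => step c = None
  end.
Proof.
case: c => [[[q L] a] R]; case: d => [[q' T] z] /= [-> -> HL HR].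
case: (tm_delta q' (T z)) => [[[q2 a2] [] ]|] //=.
- eexists; split; first by [].
  split=> //.
  + rewrite set_cellE ifF; last by lia.
    by have := HL 0; rewrite nth0 => ->; congr T; lia.
  + move=> i; rewrite nth_behead HL set_cellE ifF; last by lia.
    by congr T; lia.
  + case=> [|i] /=; rewrite set_cellE; first by rewrite ifT //; lia.
    rewrite HR ifF; last by lia.
    by congr T; lia.
- eexists; split; first by [].
  split=> //.
  + rewrite set_cellE ifF; last by lia.
    by have := HR 0; rewrite nth0 => ->; congr T; lia.
  + case=> [|i] /=; rewrite set_cellE; first by rewrite ifT //; lia.
    rewrite HL ifF; last by lia.
    by congr T; lia.
  + move=> i; rewrite nth_behead HR set_cellE ifF; last by lia.
    by congr T; lia.
- eexists; split; first by [].
  split=> //.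
  + by rewrite addr0 set_cellE eqxx.
  + move=> i; rewrite HL addr0 set_cellE ifF //; lia.
  + move=> i; rewrite HR addr0 set_cellE ifF //; lia.
Qed.

Definition text (x : seq bool) : int -> symbol :=
  fun z => if (0 <= z)%R then nth None (map Some x) `|z| else None.

Lemma textE x (i : nat) : text x i%:Z = nth None (map Some x) i.
Proof. by []. Qed.

Lemma text_neg x z : (z < 0)%R -> text x z = None.
Proof. by move=> Hz; rewrite /text ifF //; lia. Qed.

Lemma init_represents M x : represents (init_config M x) (tm_start M, text x, 0%R).
Proof.
case: x => [|b x]; split=> // i.
- by rewrite nth_nil text_neg //; lia.
- have -> : (0 + 1 + i%:Z = (i.+1)%:Z)%R by lia.
  by rewrite textE !nth_nil.
- by rewrite nth_nil text_neg //; lia.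
Qed.

Lemma out_bits_text s (y : seq bool) :
  (forall i, nth None s i = nth None (map Some y) i) -> out_bits s = y.
Proof.
elim: y s => [|b y IH] [|a s] H //=.
- by have := H 0; rewrite /= => ->.
- by have := H 0.
- have := H 0; rewrite /= => ->; congr cons; apply: IH => i.
  exact: (H i.+1).
Qed.

Lemma exec_represents M n (c : config M) (d d' : aconf M) :
  represents c d -> aexec n d = Some d' ->
  exists c', exec n c = Some c' /\ represents c' d'.
Proof.
elim: n c d => [|n IH] c d Hr /=; first by case=> <-; exists c.
have := step_represents Hr; case: (astep d) => // d1 [c1 [-> H1]].
exact: IH.
Qed.

Lemma HT_halts (M : TM) x n T' z' (y : seq bool) :
  HT M (text x) 0%R n T' z' ->
  (forall i : nat, T' (z' + i%:Z)%R = nth None (map Some y) i) ->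
  halts_with M x n y.
Proof.
move=> [q [He Hd]] Hy.
have [c [Hc Hr]] := exec_represents (init_represents M x) He.
exists c; split=> //; split.
  by have := step_represents Hr; rewrite /= Hd.
move: Hr; case: c {Hc} => [[[q1 L] a] R] /= [_ Ha _ HR].
change (out_bits (a :: R) = y); apply: out_bits_text => -[|i]; rewrite -Hy /=; first by rewrite addr0.
by rewrite HR; congr T'; lia.
Qed.

Lemma halts_with_aexec (M : TM) x t y : halts_with M x t y ->
  exists q T z, [/\ aexec t (tm_start M, text x, 0%R) = Some (q, T, z),
     tm_delta q (T z) = None & exists2 R : seq symbol, y = out_bits (T z :: R)
       & forall i : nat, nth None R i = T (z + 1 + i%:Z)%R].
Proof.
move=> [c [Hc [Hs Ho]]].
have H n (c0 : config M) d : represents c0 d -> exec n c0 = Some c ->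
   exists d', aexec n d = Some d' /\ represents c d'.
  elim: n c0 d => [|n IH] c0 d Hr /=; first by case=> <-; exists d.
  have := step_represents Hr; case: (astep d) => [d1 [c1 [-> H1]]|->//].
  exact: IH.
have [[[q T] z] [He Hr]] := H t _ _ (init_represents M x) Hc.
exists q, T, z; case: c Hc Hs Ho {H} Hr => [[[q1 L] a] R] _ Hs Ho [Hq Ha _ HR]; subst q1 a.
split=> //; last by exists R.
by move: Hs => /=; case: tm_delta => // -[[? ?] []].
Qed.

(** * Combinators on Turing machines *)

Definition tseq (M1 M2 : TM) : TM :=
  @mkTM (tm_Q M1 + tm_Q M2)%type (inl (tm_start M1))
   (fun q a => match q with
    | inl q1 => if tm_delta q1 a is Some (q', a', m) then Some (inl q', a', m)
                else Some (inr (tm_start M2), a, MStay)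
    | inr q2 => if tm_delta q2 a is Some (q', a', m) then Some (inr q', a', m) else None
    end).

Definition tcase (Mn M0 M1 : TM) : TM :=
  @mkTM (option (tm_Q Mn + tm_Q M0 + tm_Q M1))%type None
   (fun q a => match q with
    | None => Some (Some (match a with
         | None => inl (inl (tm_start Mn))
         | Some false => inl (inr (tm_start M0))
         | Some true => inr (tm_start M1) end), a, MStay)
    | Some (inl (inl q)) =>
        if tm_delta q a is Some (q', a', m) then Some (Some (inl (inl q')), a', m) else None
    | Some (inl (inr q)) =>
        if tm_delta q a is Some (q', a', m) then Some (Some (inl (inr q')), a', m) else None
    | Some (inr q) =>
        if tm_delta q a is Some (q', a', m) then Some (Some (inr q'), a', m) else None
    end).

(** The test is made only in the extra state [None], to which every round returns. Entering and
    leaving a round cost one step each, whence the [.+2] in [HT_while_step]. *)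
Definition twhile (P : symbol -> bool) (M : TM) : TM :=
  @mkTM (option (tm_Q M))%type None
   (fun q a => match q with
    | None => if P a then Some (Some (tm_start M), a, MStay) else None
    | Some q => if tm_delta q a is Some (q', a', m) then Some (Some q', a', m)
                else Some (None, a, MStay)
    end).

Definition tact (m : move) (w : symbol -> symbol) : TM :=
  @mkTM bool false (fun q a => if q then None else Some (true, w a, m)).

Lemma aexec_sim (M N : TM) (phi : tm_Q M -> tm_Q N) :
  (forall q a q' a' m, tm_delta q a = Some (q', a', m) ->
     tm_delta (phi q) a = Some (phi q', a', m)) ->
  forall n q T z q' T' z', aexec n (q, T, z) = Some (q', T', z') ->
  aexec n (phi q, T, z) = Some (phi q', T', z').
Proof.
move=> H; elim=> [|n IH] q T z q' T' z' /=; first by case=> -> -> ->.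
case E: (tm_delta q (T z)) => [[[q1 a1] m1]|] //= H1.
by rewrite (H _ _ _ _ _ E); apply: IH.
Qed.

Lemma HT_seq M1 M2 T z n1 T1 z1 n2 T2 z2 :
  HT M1 T z n1 T1 z1 -> HT M2 T1 z1 n2 T2 z2 -> HT (tseq M1 M2) T z (n1 + n2.+1) T2 z2.
Proof.
move=> [q1 [E1 D1]] [q2 [E2 D2]]; exists (inr q2); split; last by rewrite /= D2.
have S1 := @aexec_sim M1 (tseq M1 M2) inl _ _ _ _ _ _ _ _ E1.
rewrite (aexec_add _ (S1 _)); last by move=> q a q' a' m /= ->.
rewrite /= D1 set_cell_id addr0.
by apply: (@aexec_sim M2 (tseq M1 M2) inr _ _ _ _ _ _ _ _ E2) => q a q' a' m /= ->.
Qed.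

Lemma HT_case Mn M0 M1 T z n T' z' :
  HT (match T z with None => Mn | Some false => M0 | Some true => M1 end) T z n T' z' ->
  HT (tcase Mn M0 M1) T z n.+1 T' z'.
Proof.
case E: (T z) => [[]|] [q [H D]].
- exists (Some (inr q)); rewrite /= D; split=> //.
  rewrite E -E set_cell_id addr0.
  by apply: (@aexec_sim M1 (tcase Mn M0 M1) (Some \o inr) _ _ _ _ _ _ _ _ H) => ? ? ? ? ? /= ->.
- exists (Some (inl (inr q))); rewrite /= D; split=> //.
  rewrite E -E set_cell_id addr0.
  by apply: (@aexec_sim M0 (tcase Mn M0 M1) (Some \o inl \o inr) _ _ _ _ _ _ _ _ H) => ? ? ? ? ? /= ->.
- exists (Some (inl (inl q))); rewrite /= D; split=> //.
  rewrite E -E set_cell_id addr0.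
  by apply: (@aexec_sim Mn (tcase Mn M0 M1) (Some \o inl \o inl) _ _ _ _ _ _ _ _ H) => ? ? ? ? ? /= ->.
Qed.

Lemma HT_while_stop (P : symbol -> bool) M T z : ~~ P (T z) -> HT (twhile P M) T z 0 T z.
Proof. by move=> /negbTE H; exists None; rewrite /= H. Qed.

Lemma HT_while_step (P : symbol -> bool) M T z n1 T1 z1 n2 T2 z2 :
  P (T z) -> HT M T z n1 T1 z1 -> HT (twhile P M) T1 z1 n2 T2 z2 ->
  HT (twhile P M) T z (n1 + n2).+2 T2 z2.
Proof.
move=> HP [q1 [E1 D1]] [q2 [E2 D2]]; exists q2; split=> //.
have -> : (n1 + n2).+2 = 1 + (n1 + n2.+1) by lia.
have S0 : aexec 1 (tm_start (twhile P M), T, z) = Some (Some (tm_start M) : tm_Q (twhile P M), T, z).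
  by rewrite /= HP set_cell_id addr0.
rewrite (aexec_add _ S0).
have S1 := @aexec_sim M (twhile P M) Some _ _ _ _ _ _ _ _ E1.
rewrite (aexec_add _ (S1 _)); last by move=> q a q' a' m /= ->.
by rewrite /= D1 set_cell_id addr0.
Qed.

Lemma HT_act m w T z : HT (tact m w) T z 1 (set_cell T z (w (T z))) (z + dir m)%R.
Proof. by exists true. Qed.

Definition twrite a := tact MStay (fun=> a).

Lemma HT_write a T z : HT (twrite a) T z 1 (set_cell T z a) z.
Proof. by have := HT_act MStay (fun=> a) T z; rewrite addr0. Qed.

Fixpoint tmove (m : move) (n : nat) : TM :=
  if n is n'.+1 then tseq (tact m id) (tmove m n') else tact MStay id.

Lemma HT_step m T z : HT (tact m id) T z 1 T (z + dir m)%R.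
Proof. by have := HT_act m id T z; rewrite set_cell_id. Qed.

Lemma HT_move m n T z : HT (tmove m n) T z (2 * n).+1 T (z + dir m * n%:Z)%R.
Proof.
elim: n z => [|n IH] z /=.
  by have := HT_step MStay T z; rewrite mulr0.
have := HT_seq (HT_step m T z) (IH _).
have -> : (z + dir m + dir m * n%:Z = z + dir m * n.+1%:Z)%R.
  by rewrite -addrA -[in RHS]addn1 PoszD mulrDr mulr1 [(dir m * _ + _)%R]addrC.
by have -> : (1 + (2 * n).+2 = (2 * n.+1).+1)%N by lia.
Qed.

Definition tscan (m : move) (s : nat) (P : symbol -> bool) := twhile P (tmove m s).

Lemma HT_scan m s (P : symbol -> bool) j T z :
  (forall i : nat, i < j -> P (T (z + dir m * (i * s)%:Z)%R)) ->
  ~~ P (T (z + dir m * (j * s)%:Z)%R) ->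
  HT (tscan m s P) T z (j * (2 * s + 3)) T (z + dir m * (j * s)%:Z)%R.
Proof.
elim: j z => [|j IH] z H0 H1.
  by rewrite mul0n mulr0 addr0 in H1 *; apply: HT_while_stop.
have E i : (z + dir m * s%:Z + dir m * (i * s)%:Z = z + dir m * (i.+1 * s)%:Z)%R.
  by rewrite -addrA -mulrDr -PoszD.
have := HT_while_step _ (HT_move m s T z) (IH (z + dir m * s%:Z)%R _ _).
rewrite E.
have -> : ((2 * s).+1 + j * (2 * s + 3)).+2 = j.+1 * (2 * s + 3) by lia.
apply.
- by have := H0 0 isT; rewrite mul0n mulr0 addr0.
- by move=> i Hi; rewrite E; apply: H0.
- by [].
Qed.

Definition HTb (M : TM) T z B T' z' := exists2 n, n <= B & HT M T z n T' z'.

Lemma HTb_seq M1 M2 T z B1 T1 z1 B2 T2 z2 B :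
  HTb M1 T z B1 T1 z1 -> HTb M2 T1 z1 B2 T2 z2 -> B1 + B2 < B ->
  HTb (tseq M1 M2) T z B T2 z2.
Proof.
move=> [n1 L1 H1] [n2 L2 H2] HB; exists (n1 + n2.+1); last exact: HT_seq H1 H2.
lia.
Qed.

Lemma HTb_case Mn M0 M1 T z B T' z' B' :
  HTb (match T z with None => Mn | Some false => M0 | Some true => M1 end) T z B T' z' ->
  B < B' -> HTb (tcase Mn M0 M1) T z B' T' z'.
Proof. by move=> [n L H] HB; exists n.+1; [lia | apply: HT_case]. Qed.

Lemma HTb_move m n T z B : 2 * n < B ->
  HTb (tmove m n) T z B T (z + dir m * n%:Z)%R.
Proof. by move=> H; exists (2 * n).+1 => //; apply: HT_move. Qed.

Lemma HTb_scan m s (P : symbol -> bool) j T z B :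
  (forall i : nat, i < j -> P (T (z + dir m * (i * s)%:Z)%R)) ->
  ~~ P (T (z + dir m * (j * s)%:Z)%R) -> j * (2 * s + 3) <= B ->
  HTb (tscan m s P) T z B T (z + dir m * (j * s)%:Z)%R.
Proof. by move=> H1 H2 H3; exists (j * (2 * s + 3)) => //; apply: HT_scan. Qed.

Lemma HTb_write a T z B : 0 < B -> HTb (twrite a) T z B (set_cell T z a) z.
Proof. by move=> H; exists 1 => //; apply: HT_write. Qed.

Lemma HTb_weaken M T z B T' z' B' : HTb M T z B T' z' -> B <= B' -> HTb M T z B' T' z'.
Proof. by move=> [n L H] HB; exists n => //; lia. Qed.

(** * Stack programs *)

Inductive cmd :=
  | Push of nat & bool
  | Pop of nat
  | Seq of cmd & cmd
  | If of nat & cmd & cmd & cmd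
  | While of nat & cmd.

Notation state := (nat -> seq bool).

Definition upd (s : state) r v : state := fun k => if k == r then v else s k.

Fixpoint below (m : nat) (c : cmd) : bool :=
  match c with
  | Push r _ | Pop r => r < m
  | Seq c1 c2 => below m c1 && below m c2
  | If r cn c0 c1 => [&& r < m, below m cn, below m c0 & below m c1]
  | While r c => (r < m) && below m c
  end.

Inductive run : cmd -> state -> nat -> state -> Prop :=
  | run_push r b s : run (Push r b) s 1 (upd s r (b :: s r))
  | run_pop r s : run (Pop r) s 1 (upd s r (behead (s r)))
  | run_seq c1 c2 s t1 s1 t2 s2 :
      run c1 s t1 s1 -> run c2 s1 t2 s2 -> run (Seq c1 c2) s (t1 + t2).+1 s2
  | run_if r cn c0 c1 s t s' :
      run (match ohead (s r) with None => cn | Some false => c0 | Some true => c1 end) s t s' ->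
      run (If r cn c0 c1) s t.+1 s'
  | run_while_nil r c s : s r = [::] -> run (While r c) s 1 s
  | run_while_cons r c (s : state) t1 (s1 : state) t2 (s2 : state) :
      s r != [::] -> run c s t1 s1 -> run (While r c) s1 t2 s2 ->
      run (While r c) s (t1 + t2).+1 s2.

Definition track (s : state) (k : nat) : seq bool :=
  if k is r.+1 then s r else [:: true].

(* Cell -2 - i of the tape belongs to track [i %% b]; track 0 only holds the mark
   of the home cell -2, and track [r.+1] holds register [r], bottom first. *)
Definition tape (b : nat) (s : state) (io : int -> symbol) : int -> symbol :=
  fun z => if (z <= -2)%R then
             let i := `|(-2 - z)%R|%N in
             nth None (map Some (rev (track s (i %% b)))) (i %/ b)
           else io z.

Definition pos (i : nat) : int := (-2 - i%:Z)%R.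

Lemma tape_pos b s io j k : k < b ->
  tape b s io (pos (j * b + k)) = nth None (map Some (rev (track s k))) j.
Proof.
move=> Hk; rewrite /tape /pos ifT; last by lia.
have -> : `|(-2 - (-2 - (j * b + k)%:Z))%R|%N = j * b + k by lia.
by rewrite modnMDl modn_small // divnMDl ?divn_small ?addn0 //; lia.
Qed.

Lemma tape_io b s io z : (-2 < z)%R -> tape b s io z = io z.
Proof. by move=> H; rewrite /tape ifF //; lia. Qed.

Lemma tape_upd b s io r j a v : r.+1 < b ->
  (forall i, nth None (map Some (rev v)) i =
     if i == j then a else nth None (map Some (rev (s r))) i) ->
  set_cell (tape b s io) (pos (j * b + r.+1)) a = tape b (upd s r v) io.
Proof.
move=> Hr Hv; apply: functional_extensionality => z; rewrite set_cellE.
have [Hz|Hz] := boolP (z <= -2)%R; last first.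
  rewrite !tape_io; try by lia.
  by rewrite ifF // /pos; lia.
have [i ->] : exists i, z = pos i by exists `|(-2 - z)%R|%N; rewrite /pos; lia.
have Hb : 0 < b by lia.
rewrite (divn_eq i b) !tape_pos ?ltn_mod //.
set q := i %/ b; set k := i %% b; have Hk : k < b by rewrite ltn_mod.
have -> : (pos (q * b + k) == pos (j * b + r.+1)) = (q == j) && (k == r.+1).
  apply/eqP/andP => [H|[/eqP -> /eqP ->] //].
  have H' : q * b + k = j * b + r.+1 by move: H; rewrite /pos; lia.
  have H1 := congr1 (modn^~ b) H'; have H2 := congr1 (divn^~ b) H'.
  rewrite !modnMDl !modn_small // in H1.
  rewrite !divnMDl // !divn_small // !addn0 in H2.
  by rewrite H1 H2.
case: (k =P r.+1) => [->|Hn]; last first.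
  rewrite andbF; case: k Hn {Hk} => // k' Hn; rewrite /track /upd ifF //.
  by apply/eqP => Hk; apply: Hn; rewrite Hk.
by rewrite andbT /track /upd eqxx Hv.
Qed.

Lemma nth_rev_some (s : seq bool) i :
  (nth None (map Some (rev s)) i == None) = (size s <= i).
Proof.
have [H|H] := leqP (size s) i.
  by rewrite nth_default // size_map size_rev.
by rewrite (nth_map true) ?size_rev.
Qed.

Definition nonblank : symbol -> bool := isSome.
Definition blank : symbol -> bool := fun a => ~~ isSome a.

Lemma blankE a : blank a = (a == None). Proof. by case: a. Qed.
Lemma nonblankE a : nonblank a = (a != None). Proof. by case: a. Qed.

(** Moving right by [k] reaches track 0, whose only nonblank cell is the home mark, so a scan over
    blanks with stride [b] stops exactly at home. *)
Definition t_home (b k : nat) := tseq (tmove MRight k) (tscan MRight b blank).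
Definition t_find (b k : nat) := tseq (tmove MLeft k) (tscan MLeft b nonblank).
(** On an empty register the head stays on the blank bottom cell; otherwise it goes one stride past
    the last symbol and back. The predecessor in [HTb_top] covers both cases. *)
Definition t_top (b k : nat) :=
  let Z := tseq (tscan MLeft b nonblank) (tmove MRight b) in
  tseq (tmove MLeft k) (tcase (tmove MStay 0) Z Z).
Definition t_push (b k : nat) a := tseq (t_find b k) (tseq (twrite (Some a)) (t_home b k)).
Definition t_pop (b k : nat) := tseq (t_top b k) (tseq (twrite None) (t_home b k)).

Lemma HTb_home b s io j k B : k < b -> 2 * k + 3 + j * (2 * b + 3) <= B ->
  HTb (t_home b k) (tape b s io) (pos (j * b + k)) B (tape b s io) (pos 0).
Proof.
move=> Hk HB.
have E i : i <= j -> (pos (j * b + k) + dir MRight * k%:Z + dir MRight * (i * b)%:Z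
    = pos ((j - i) * b + 0))%R.
  by move=> Hi; rewrite /pos /= mulnBl; have := leq_mul Hi (leqnn b); lia.
have -> : pos 0 = (pos (j * b + k) + dir MRight * k%:Z + dir MRight * (j * b)%:Z)%R.
  by rewrite E // subnn.
apply: HTb_seq (HTb_move _ _ _ (leqnn _)) (HTb_scan _ _ (leqnn _)) _; last by lia.
- by move=> i Hi; rewrite E ?tape_pos ?blankE ?nth_rev_some //=; lia.
- by rewrite E // tape_pos ?subnn //; lia.
Qed.

Lemma HTb_track b s io r B : r.+1 < b -> size (s r) * (2 * b + 3) <= B ->
  HTb (tscan MLeft b nonblank) (tape b s io) (pos r.+1) B
     (tape b s io) (pos (size (s r) * b + r.+1)).
Proof.
move=> Hr HB.
have E i : (pos r.+1 + dir MLeft * (i * b)%:Z = pos (i * b + r.+1))%R.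
  by rewrite /pos /=; lia.
rewrite -E; apply: HTb_scan => // [i Hi|].
- by rewrite E tape_pos // nonblankE nth_rev_some /= -ltnNge.
- by rewrite E tape_pos // nonblankE nth_rev_some /= leqnn.
Qed.

Lemma pos_left k : (pos 0 + dir MLeft * k%:Z)%R = pos k.
Proof. by rewrite /pos /=; lia. Qed.

Lemma HTb_push b s io r a B : r.+1 < b ->
  (size (s r)).+1 * (16 * b) <= B ->
  HTb (t_push b r.+1 a) (tape b s io) (pos 0) B (tape b (upd s r (a :: s r)) io) (pos 0).
Proof.
move=> Hr HB.
have H1 := HTb_move MLeft (tape b s io) (pos 0) (leqnn (2 * r.+1).+1).
rewrite pos_left in H1.
have H2 := HTb_seq H1 (HTb_track io Hr (leqnn _)) (leqnn _).
apply: HTb_seq H2 (HTb_seq (HTb_write _ _ _ (leqnn 1)) _ (leqnn _)) _.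
- rewrite (@tape_upd b s io r (size (s r)) (Some a) (a :: s r)) //; last first.
    move=> i; rewrite rev_cons map_rcons nth_rcons size_map size_rev.
    case: ltngtP => // Hi; by rewrite nth_default // size_map size_rev ltnW.
  by apply: HTb_home => //; apply: leqnn.
- have Hm : size (s r) * 2 <= size (s r) * b by rewrite leq_mul2l; lia.
  lia.
Qed.

Lemma HTb_top b s io r B : r.+1 < b ->
  (size (s r)) * (2 * b + 3) + 2 * r + 2 * b + 10 <= B ->
  HTb (t_top b r.+1) (tape b s io) (pos 0) B
    (tape b s io) (pos ((size (s r)).-1 * b + r.+1)).
Proof.
move=> Hr HB.
have H1 := HTb_move MLeft (tape b s io) (pos 0) (leqnn (2 * r.+1).+1).
rewrite pos_left in H1.
apply: HTb_seq H1 (HTb_case (B := size (s r) * (2 * b + 3) + 2 * b + 3) _ (leqnn _)) _;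
  last by lia.
have := @tape_pos b s io 0 r.+1 Hr; rewrite mul0n add0n => ->.
have := @HTb_track b s io r _ Hr (leqnn _).
rewrite /track; move E: (s r) => [|x v] Ht.
  have := @HTb_move MStay 0 (tape b s io) (pos r.+1) 1 isT.
  rewrite /= mulr0 addr0 mul0n add0n => H; apply: HTb_weaken H _; lia.
have -> : nth None (map Some (rev (x :: v))) 0 = Some (last x v).
  rewrite (nth_map true) ?size_rev // nth_rev //= subn1 /=.
  by rewrite -[size v]/(size (x :: v)).-1 nth_last.
set Z := tseq (tscan _ _ _) _; have -> : (if last x v then Z else Z) = Z by case: ifP.
have -> : pos ((size (x :: v)).-1 * b + r.+1) =
    (pos (size (x :: v) * b + r.+1) + dir MRight * b%:Z)%R.
  by rewrite /pos /=; lia.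
by apply: HTb_seq Ht (HTb_move _ _ _ (leqnn _)) _; lia.
Qed.

Lemma top_symbol b s io r : r.+1 < b ->
  tape b s io (pos ((size (s r)).-1 * b + r.+1)) = ohead (s r).
Proof.
move=> Hr; rewrite tape_pos //=.
by case: (s r) => [|x v] //=; rewrite rev_cons map_rcons nth_rcons size_map size_rev ltnn eqxx.
Qed.

Lemma HTb_pop b s io r B : r.+1 < b ->
  (size (s r)).+1 * (16 * b) <= B ->
  HTb (t_pop b r.+1) (tape b s io) (pos 0) B (tape b (upd s r (behead (s r))) io) (pos 0).
Proof.
move=> Hr HB.
apply: HTb_seq (HTb_top _ Hr (leqnn _)) (HTb_seq (HTb_write _ _ _ (leqnn 1)) _ (leqnn _)) _.
- rewrite (@tape_upd b s io r _ None (behead (s r))) //; last first.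
    case: (s r) => [|x v] i /=; first by rewrite nth_nil; case: ifP.
    rewrite rev_cons map_rcons nth_rcons size_map size_rev.
    case: ltngtP => // Hi; by rewrite nth_default // size_map size_rev ?Hi // ltnW.
  by apply: HTb_home => //; apply: leqnn.
- have : (size (s r)).-1 * (2 * b + 3) <= size (s r) * (2 * b + 3) by rewrite leq_mul2r; lia.
  have Hm : size (s r) * 2 <= size (s r) * b by rewrite leq_mul2l; lia.
  lia.
Qed.

Fixpoint compile (b : nat) (c : cmd) : TM :=
  match c with
  | Push r a => t_push b r.+1 a
  | Pop r => t_pop b r.+1
  | Seq c1 c2 => tseq (compile b c1) (compile b c2)
  | If r cn c0 c1 =>
      tseq (t_top b r.+1)
        (tcase (tseq (t_home b r.+1) (compile b cn)) (tseq (t_home b r.+1) (compile b c0))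
               (tseq (t_home b r.+1) (compile b c1)))
  | While r c =>
      tseq (tmove MLeft r.+1)
        (tseq (twhile nonblank
                (tseq (tmove MRight r.+1) (tseq (compile b c) (tmove MLeft r.+1))))
              (tmove MRight r.+1))
  end.

(** A register gains at most one bit per unit of time. Both the cost of compiled programs and the
    length of their outputs are bounded through this. *)
Lemma run_size c s t s' : run c s t s' -> forall r, size (s' r) <= size (s r) + t.
Proof.
elim=> {c s t s'}.
- by move=> r b s k; rewrite /upd; case: eqP => [->|_] /=; lia.
- by move=> r s k; rewrite /upd; case: eqP => [->|_] /=; rewrite ?size_behead; lia.
- by move=> c1 c2 s t1 s1 t2 s2 _ H1 _ H2 r; have := H1 r; have := H2 r; lia.
- by move=> r cn c0 c1 s t s' _ H k; have := H k; lia.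
- by move=> *; lia.
- by move=> r c s t1 s1 t2 s2 _ _ H1 _ H2 k; have := H1 k; have := H2 k; lia.
Qed.

Definition while_body (b k : nat) (M : TM) :=
  twhile nonblank (tseq (tmove MRight k) (tseq M (tmove MLeft k))).

(** A single command walks along the tape a bounded number of times, so it costs a number of steps
    linear in [B]. The hypothesis on [B] includes the remaining time, so [run_size] hands it on to
    every intermediate state. *)
Lemma compile_run m c s t s' : run c s t s' -> below m c ->
  forall io B, (forall r, r < m -> size (s r) + t <= B) ->
  HTb (compile m.+1 c) (tape m.+1 s io) (pos 0) (t * (60 * m.+1 * B.+1))
      (tape m.+1 s' io) (pos 0).
Proof.
have Hsc b v B : v <= B -> v * (2 * b + 3) <= B * (2 * b + 3).
  by move=> H; rewrite leq_mul2r H orbT.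
(* For loops the induction needs a second statement, about the inner machine, which rests at the
   bottom cell of the tested track instead of home. The subtracted [10 * m.+1] pays for the walks
   between this cell and home around the whole loop. *)
pose Wh c s t s' := forall io B, (forall r, r < m -> size (s r) + t <= B) ->
  if c is While r c0 then
    HTb (while_body m.+1 r.+1 (compile m.+1 c0)) (tape m.+1 s io) (pos r.+1)
      (t * (60 * m.+1 * B.+1) - 10 * m.+1) (tape m.+1 s' io) (pos r.+1)
  else True.
move=> Hrun Hb; suff [] : (forall io B, (forall r, r < m -> size (s r) + t <= B) ->
  HTb (compile m.+1 c) (tape m.+1 s io) (pos 0) (t * (60 * m.+1 * B.+1))
      (tape m.+1 s' io) (pos 0)) /\ Wh c s t s' by [].
have Hw c0 r s0 t0 s1 : r < m -> 0 < t0 -> Wh (While r c0) s0 t0 s1 ->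
  forall io B, (forall k, k < m -> size (s0 k) + t0 <= B) ->
  HTb (compile m.+1 (While r c0)) (tape m.+1 s0 io) (pos 0) (t0 * (60 * m.+1 * B.+1))
      (tape m.+1 s1 io) (pos 0).
  move=> Hr Ht H io B HB.
  have H1 := HTb_move MLeft (tape m.+1 s0 io) (pos 0) (leqnn (2 * r.+1).+1).
  have H2 := HTb_move MRight (tape m.+1 s1 io) (pos r.+1) (leqnn (2 * r.+1).+1).
  have E : (pos r.+1 + dir MRight * r.+1%:Z)%R = pos 0 by rewrite /pos /=; lia.
  rewrite pos_left in H1; rewrite E in H2.
  apply: HTb_seq H1 (HTb_seq (H io B HB) H2 (leqnn _)) _.
  have : 60 * m.+1 * B.+1 <= t0 * (60 * m.+1 * B.+1) by rewrite leq_pmull.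
  lia.
elim: Hrun Hb => {c s t s'}.
- move=> r a s /= Hr; split=> // io B HB; apply: HTb_push => //.
  have := HB _ Hr; rewrite mul1n => H.
  apply: leq_trans (_ : B.+1 * (16 * m.+1) <= _); [rewrite leq_mul2r; lia | lia].
- move=> r s /= Hr; split=> // io B HB; apply: HTb_pop => //.
  have := HB _ Hr; rewrite mul1n => H.
  apply: leq_trans (_ : B.+1 * (16 * m.+1) <= _); [rewrite leq_mul2r; lia | lia].
- move=> c1 c2 s t1 s1 t2 s2 R1 H1 R2 H2 /= /andP[b1 b2].
  have [{}H1 _] := H1 b1; have [{}H2 _] := H2 b2; split=> // io B HB.
  apply: HTb_seq (H1 io B _) (H2 io B _) _.
  + by move=> r Hr; have := HB r Hr; lia.
  + by move=> r Hr; have := HB r Hr; have := run_size R1 r; lia.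
  + by rewrite mulSn -mulnDl; lia.
- move=> r cn c0 c1 s t s' R H /= /and4P[Hr bn b0 b1]; split=> // io B HB.
  have Hs := HB _ Hr.
  have Hhome := @HTb_home m.+1 s io (size (s r)).-1 r.+1 _ Hr (leqnn _).
  have Htop := @HTb_top m.+1 s io r _ Hr (leqnn _).
  have HBt : forall r0, r0 < m -> size (s r0) + t <= B by move=> r0 /HB; lia.
  have Hbb : 2 * r.+1 + 3 + (size (s r)).-1 * (2 * m.+1 + 3) + t * (60 * m.+1 * B.+1)
       < t * (60 * m.+1 * B.+1) + 10 * m.+1 * B.+1.
    have := @Hsc m.+1 (size (s r)).-1 B; lia.
  apply: (HTb_seq Htop (HTb_case (B := t * (60 * m.+1 * B.+1) + 10 * m.+1 * B.+1) _ (leqnn _))).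
    rewrite top_symbol //.
    case: (ohead (s r)) H => [[]|] H.
    + by have [{}H _] := H b1; apply: HTb_seq Hhome (H io B HBt) Hbb.
    + by have [{}H _] := H b0; apply: HTb_seq Hhome (H io B HBt) Hbb.
    + by have [{}H _] := H bn; apply: HTb_seq Hhome (H io B HBt) Hbb.
  have := @Hsc m.+1 (size (s r)) B; rewrite mulSn; lia.
- move=> r c s Hs /= /andP[Hr bc].
  have HW : Wh (While r c) s 1 s.
    move=> io B HB; apply: HTb_weaken (_ : HTb _ _ _ 0 _ _) _ => //.
    exists 0 => //; apply: HT_while_stop; rewrite -[r.+1]add0n -[0]/(0 * m.+1).
    by rewrite tape_pos // nonblankE negbK nth_rev_some /= Hs.
  by split=> //; apply: Hw HW.
- move=> r c s t1 s1 t2 s2 Hs R1 H1 R2 H2 /= /andP[Hr bc].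
  have [{}H1 _] := H1 bc; have [_ {}H2] := H2 (introT andP (conj Hr bc)).
  have Ht2 : 0 < t2 by inversion R2.
  have HW : Wh (While r c) s (t1 + t2).+1 s2.
    move=> io B HB.
    have HB1 k : k < m -> size (s k) + t1 <= B by move=> /HB Hk; lia.
    have HB2 k : k < m -> size (s1 k) + t2 <= B.
      by move=> /HB; have := run_size R1 k; lia.
    have M1 := HTb_move MRight (tape m.+1 s io) (pos r.+1) (leqnn (2 * r.+1).+1).
    have M2 := HTb_move MLeft (tape m.+1 s1 io) (pos 0) (leqnn (2 * r.+1).+1).
    have E : (pos r.+1 + dir MRight * r.+1%:Z)%R = pos 0 by rewrite /pos /=; lia.
    rewrite E in M1; rewrite pos_left in M2.
    have [n1 L1 B1] := HTb_seq M1 (HTb_seq (H1 io B HB1) M2 (leqnn _)) (leqnn _).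
    have [n2 L2 B2] := H2 io B HB2.
    exists (n1 + n2).+2; last first.
      apply: HT_while_step B1 B2.
      rewrite -[r.+1]add0n -[0]/(0 * m.+1).
      by rewrite tape_pos // nonblankE nth_rev_some /= -ltnNge lt0n size_eq0.
    have : 60 * m.+1 * B.+1 <= t2 * (60 * m.+1 * B.+1) by rewrite leq_pmull.
    by rewrite mulSn mulnDl; lia.
  by split=> //; apply: Hw HW.
Qed.

(** * Loading the input into a register and writing the output *)

Definition init_state (x : seq bool) : state := upd (fun=> [::]) 0 x.

Lemma tape_set_io b s io z a : (-2 < z)%R ->
  set_cell (tape b s io) z a = tape b s (set_cell io z a).
Proof.
move=> Hz; apply: functional_extensionality => y; rewrite /set_cell /tape.
by case: eqP => [->|_] //; case: ifP => //; lia.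
Qed.

Lemma text_rcons x a : set_cell (text x) (size x)%:Z (Some a) = text (rcons x a).
Proof.
apply: functional_extensionality => z; rewrite set_cellE /text map_rcons nth_rcons size_map.
have [Hz|Hz] := boolP (0 <= z)%R; last by rewrite ifF //; lia.
case: ltngtP => H; [rewrite ifF //; lia | | rewrite ifT //; lia].
by rewrite ifF ?nth_default ?size_map //; lia.
Qed.

Lemma text_belast x a : set_cell (text (rcons x a)) (size x)%:Z None = text x.
Proof.
apply: functional_extensionality => z; rewrite set_cellE /text map_rcons nth_rcons size_map.
have [Hz|Hz] := boolP (0 <= z)%R; last by case: ifP.
case: ltngtP => H; [rewrite ifF //; lia | | ].
  by rewrite nth_default ?size_map; [case: ifP | lia].
by rewrite ifT ?nth_default ?size_map //; lia.
Qed.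

Lemma text_inside x (i : nat) : i < size x -> nonblank (text x i%:Z).
Proof. by move=> H; rewrite textE (nth_map false). Qed.

Lemma text_after x (i : nat) : size x <= i -> text x i%:Z = None.
Proof. by move=> H; rewrite textE nth_default // size_map. Qed.

Lemma tape_empty b x : 0 < b ->
  set_cell (text x) (-2)%R (Some true) = tape b (init_state [::]) (text x).
Proof.
move=> Hb; apply: functional_extensionality => z; rewrite set_cellE /tape.
have [->|Hz] := eqVneq z (-2)%R; first by rewrite /= div0n mod0n.
case: ifP => Hz2 //; rewrite text_neg; last by lia.
rewrite /track; case E: (_ %% b) => [|k] /=; last first.
  by rewrite /init_state /upd; case: eqP; rewrite nth_nil.
case E2: (_ %/ b) => [|q] /=; last by rewrite nth_nil.
have := divn_eq `|(-2 - z)%R| b; rewrite E E2; lia.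
Qed.

Definition t_read_bit b a :=
  tseq (twrite None) (tseq (tmove MLeft 1) (tseq (tscan MLeft 1 nonblank)
     (tseq (tmove MLeft 1) (tseq (t_push b 1 a) (tmove MRight 2))))).

(** Symbols are taken off the right end of the input, so that pushing them leaves the first one on
    top of register 0. Cell -1 stays blank and stops the leftward scan. *)
Definition t_read (b : nat) : TM :=
  tseq (tmove MLeft 2) (tseq (twrite (Some true)) (tseq (tmove MRight 2) (tseq
   (twhile nonblank (tseq (tscan MRight 1 nonblank) (tseq (tmove MLeft 1)
      (tcase (tmove MStay 0) (t_read_bit b false) (t_read_bit b true)))))
   (tmove MLeft 2)))).

Lemma HTb_out_end b s y B : 5 * size y <= B ->
  HTb (tscan MRight 1 nonblank) (tape b s (text y)) 0%R B (tape b s (text y)) (size y)%:Z.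
Proof.
move=> HB; have E i : (0 + dir MRight * (i * 1)%:Z = i%:Z)%R by rewrite /=; lia.
rewrite -[Posz (size y)]E; apply: HTb_scan; last lia.
- by move=> i Hi; rewrite E tape_io ?text_inside //; lia.
- by rewrite E tape_io ?text_after.
Qed.

Lemma HTb_out_home b s y (k : nat) z B : z = (k%:Z - 1)%R -> k <= size y -> 5 * k <= B ->
  HTb (tscan MLeft 1 nonblank) (tape b s (text y)) z B (tape b s (text y)) (-1)%R.
Proof.
move=> -> Hk HB.
have E i : (k%:Z - 1 + dir MLeft * (i * 1)%:Z = k%:Z - 1 - i%:Z)%R by rewrite /=; lia.
have E1 : (k%:Z - 1 + dir MLeft * (k * 1)%:Z = -1)%R by rewrite E; lia.
rewrite -[X in HTb _ _ _ _ _ X]E1.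
apply: HTb_scan; last lia.
- move=> i Hi; rewrite E tape_io; last by lia.
  have -> : (k%:Z - 1 - i%:Z)%R = Posz (k - 1 - i) by lia.
  by apply: text_inside; lia.
- by rewrite E tape_io ?text_neg //; lia.
Qed.

Lemma HTb_read b x : 1 < b ->
  HTb (t_read b) (text x) 0%R ((size x).+1 * (size x).+1 * (60 * b))
    (tape b (init_state x) (text [::])) (pos 0).
Proof.
move=> Hb; rewrite /t_read; set B := t_read_bit b.
set L := twhile _ _.
have HL : forall x2 x1, HTb L (tape b (init_state x2) (text x1)) 0%R
   (size x1 * (30 * (size x1 + size x2).+1 * b))
   (tape b (init_state (x1 ++ x2)) (text [::])) 0%R.
  move=> x2 x1; elim/last_ind: x1 x2 => [|x1 a IH] x2.
    by exists 0 => //; apply: HT_while_stop; rewrite tape_io ?text_after.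
  have [n2 L2 H2] := IH (a :: x2); rewrite cat_rcons.
  have HB : HTb (B a) (tape b (init_state x2) (text (rcons x1 a))) (size x1)%:Z
      (5 * size x1 + (size x2).+1 * (16 * b) + 20)
      (tape b (init_state (a :: x2)) (text x1)) 0%R.
    have H1 := HTb_write None (tape b (init_state x2) (text (rcons x1 a))) (size x1)%:Z (leqnn 1).
    rewrite tape_set_io ?text_belast in H1; last by lia.
    have H3 := @HTb_move MLeft 1 (tape b (init_state x2) (text x1)) (size x1)%:Z _ (leqnn 3).
    have H4 := @HTb_out_home b (init_state x2) x1 (size x1) _ _
      (erefl : (size x1)%:Z + dir MLeft * 1%:Z = (size x1)%:Z - 1)%R (leqnn _) (leqnn _).
    have H5 := @HTb_move MLeft 1 (tape b (init_state x2) (text x1)) (-1)%R _ (leqnn 3).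
    have H6 := @HTb_push b (init_state x2) (text x1) 0 a _ Hb (leqnn _).
    have H7 := @HTb_move MRight 2 (tape b (init_state (a :: x2)) (text x1)) (pos 0) _ (leqnn 5).
    have Eu : upd (init_state x2) 0 (a :: init_state x2 0) = init_state (a :: x2).
      by apply: functional_extensionality => k; rewrite /init_state /upd; case: eqP.
    rewrite Eu in H6.
    apply: HTb_seq H1 (HTb_seq H3 (HTb_seq H4 (HTb_seq H5 (HTb_seq H6 H7 (leqnn _)) (leqnn _))
      (leqnn _)) (leqnn _)) _.
    by rewrite /init_state /upd /=; lia.
  have HC : HTb (tcase (tmove MStay 0) (B false) (B true))
      (tape b (init_state x2) (text (rcons x1 a))) (size x1)%:Z
      (5 * size x1 + (size x2).+1 * (16 * b) + 21)
      (tape b (init_state (a :: x2)) (text x1)) 0%R.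
    apply: HTb_case (_ : HTb _ _ _ (5 * size x1 + (size x2).+1 * (16 * b) + 20) _ _) _; last lia.
    rewrite tape_io // textE map_rcons nth_rcons size_map ltnn eqxx.
    by case: (a) HB.
  have HE := HTb_out_end b (init_state x2) (leqnn (5 * size (rcons x1 a))).
  have HM := @HTb_move MLeft 1 (tape b (init_state x2) (text (rcons x1 a)))
     (size (rcons x1 a))%:Z _ (leqnn 3).
  have Ez : ((size (rcons x1 a))%:Z + dir MLeft * 1%:Z = (size x1)%:Z)%R.
    by rewrite size_rcons /=; lia.
  rewrite Ez in HM.
  have [n1 L1 H1] := HTb_seq HE (HTb_seq HM HC (leqnn _)) (leqnn _).
  exists (n1 + n2).+2; last first.
    apply: HT_while_step H1 H2.
    by rewrite tape_io //; apply: (@text_inside _ 0); rewrite size_rcons.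
  move: L1 L2; rewrite size_rcons /= addSnnS mulSn.
  set w := size x1 + (size x2).+1.
  have : w.+1 * b >= 2 * w.+1 by rewrite mulnC leq_mul2l; lia.
  have : (size x2).+1 * b <= w * b by rewrite leq_mul2r /w; lia.
  have : size x1 <= w by rewrite /w; lia.
  set u := size x1 * _; lia.
have M1 := @HTb_move MLeft 2 (text x) 0%R _ (leqnn 5).
have M2 := HTb_write (Some true) (text x) (-2)%R (leqnn 1).
rewrite (@tape_empty b) in M2; last by lia.
have M3 := @HTb_move MRight 2 (tape b (init_state [::]) (text x)) (-2)%R _ (leqnn 5).
have M4 := HL [::] x; rewrite cats0 in M4.
have M5 := @HTb_move MLeft 2 (tape b (init_state x) (text [::])) 0%R _ (leqnn 5).
apply: HTb_seq M1 (HTb_seq M2 (HTb_seq M3 (HTb_seq M4 M5 (leqnn _)) (leqnn _)) (leqnn _)) _.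
rewrite addn0; set v := (size x).+1.
have -> : size x = v.-1 by [].
have : v.-1 * (30 * v * b) <= v * v * (30 * b).
  have -> : v.-1 * (30 * v * b) = v.-1 * v * (30 * b) by lia.
  by rewrite !leq_mul2r leq_pred !orbT.
have : 1 * 2 <= (v * v) * b by apply: leq_mul; rewrite // muln_gt0.
lia.
Qed.

Definition t_out a := tseq (tmove MRight 2) (tseq (tscan MRight 1 nonblank)
  (tseq (twrite (Some a)) (tseq (tscan MLeft 1 nonblank) (tmove MLeft 1)))).

Lemma HTb_out b s y a B : 10 * size y + 30 <= B ->
  HTb (t_out a) (tape b s (text y)) (pos 0) B (tape b s (text (rcons y a))) (pos 0).
Proof.
move=> HB.
have M1 := @HTb_move MRight 2 (tape b s (text y)) (pos 0) _ (leqnn 5).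
have M2 := HTb_out_end b s (leqnn (5 * size y)).
have M3 := HTb_write (Some a) (tape b s (text y)) (size y)%:Z (leqnn 1).
rewrite tape_set_io ?text_rcons in M3; last by lia.
have M4 := @HTb_out_home b s (rcons y a) (size (rcons y a)) (size y)%:Z _ _ (leqnn _) (leqnn _).
have M5 := @HTb_move MLeft 1 (tape b s (text (rcons y a))) (-1)%R _ (leqnn 3).
apply: HTb_seq M1 (HTb_seq M2 (HTb_seq M3 (HTb_seq (M4 _) M5 (leqnn _)) (leqnn _)) (leqnn _)) _;
  by rewrite size_rcons; lia.
Qed.

Definition t_write_bit b a := tseq (t_home b 1) (tseq (t_pop b 1) (t_out a)).

(** Popping delivers the word from its first symbol on, and each symbol is appended at the right
    end. The last move leads from cell -3, the bottom of track 1, to cell 0, where [output] starts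
    to read. *)
Definition t_write (b : nat) : TM :=
  tseq (tmove MLeft 1) (tseq (while_body b 1 (tseq (t_top b 1)
     (tcase (t_home b 1) (t_write_bit b false) (t_write_bit b true)))) (tmove MRight 3)).

Lemma HTb_write_out b s : 1 < b ->
  exists s', HTb (t_write b) (tape b s (text [::])) (pos 0)
   ((size (s 0)).+1 * (size (s 0)).+1 * (100 * b)) (tape b s' (text (s 0))) 0%R.
Proof.
move=> Hb; rewrite /t_write; set B := t_write_bit b.
set L := while_body _ _ _.
have HL : forall x s y, s 0 = x -> exists s', HTb L (tape b s (text y)) (pos 1)
   (size x * (70 * (size x + size y).+1 * b)) (tape b s' (text (y ++ x))) (pos 1).
  elim=> [|a x IH] s0 y Hs.
    exists s0, 0 => //; rewrite cats0; apply: HT_while_stop.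
    rewrite -[pos 1]/(pos (0 * b + 1)) tape_pos // nonblankE negbK nth_rev_some /= Hs //.
  have [|s' [n2 L2 H2]] := IH (upd s0 0 x) (rcons y a); first by rewrite /upd.
  exists s'; rewrite cat_rcons in H2.
  have HB : HTb (B a) (tape b s0 (text y)) (pos ((size (s0 0)).-1 * b + 1))
      (5 + size x * (2 * b + 3) + (size x).+2 * (16 * b) + (10 * size y + 30) + 2)
      (tape b (upd s0 0 x) (text (rcons y a))) (pos 0).
    have H1 := @HTb_home b s0 (text y) (size (s0 0)).-1 1 _ Hb (leqnn _).
    have H3 := @HTb_pop b s0 (text y) 0 _ Hb (leqnn _).
    have H4 := HTb_out b (upd s0 0 x) a (leqnn (10 * size y + 30)).
    rewrite Hs /= in H3.
    apply: HTb_seq H1 (HTb_seq H3 H4 (leqnn _)) _; rewrite Hs /=; lia.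
  have HC : HTb (tcase (t_home b 1) (B false) (B true)) (tape b s0 (text y))
      (pos ((size (s0 0)).-1 * b + 1))
      (5 + size x * (2 * b + 3) + (size x).+2 * (16 * b) + (10 * size y + 30) + 3)
      (tape b (upd s0 0 x) (text (rcons y a))) (pos 0).
    apply: HTb_case (_ : HTb _ _ _ (5 + size x * (2 * b + 3) + (size x).+2 * (16 * b) + (10 * size y + 30) + 2) _ _) _; last lia.
    rewrite top_symbol // Hs /=.
    by case: (a) HB; rewrite Hs.
  have HT0 := @HTb_top b s0 (text y) 0 _ Hb (leqnn _).
  have M1 := @HTb_move MRight 1 (tape b s0 (text y)) (pos 1) _ (leqnn 3).
  have M2 := @HTb_move MLeft 1 (tape b (upd s0 0 x) (text (rcons y a))) (pos 0) _ (leqnn 3).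
  have [n1 L1 H1] := HTb_seq M1 (HTb_seq (HTb_seq HT0 HC (leqnn _)) M2 (leqnn _)) (leqnn _).
  exists (n1 + n2).+2; last first.
    apply: HT_while_step H1 H2.
    by rewrite -[pos 1]/(pos (0 * b + 1)) tape_pos // nonblankE nth_rev_some /= Hs.
  move: L1 L2; rewrite size_rcons Hs /= -addSnnS mulSn addSn.
  set w := (size x + size y).+1.
  have : w.+1 * b >= 2 * w.+1 by rewrite mulnC leq_mul2l; lia.
  have : (size x).+1 * b <= w * b by rewrite leq_mul2r /w; lia.
  have : (size x).+1 <= w by rewrite /w; lia.
  have : size y < w by rewrite /w; lia.
  set u := size x * (70 * _ * _); lia.
have [s' H] := HL (s 0) s [::] erefl; exists s'.
have M1 := @HTb_move MLeft 1 (tape b s (text [::])) (pos 0) _ (leqnn 3).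
have M2 := @HTb_move MRight 3 (tape b s' (text (s 0))) (pos 1) _ (leqnn 7).
apply: HTb_seq M1 (HTb_seq H M2 (leqnn _)) _.
rewrite addn0; set v := (size (s 0)).+1.
have -> : size (s 0) = v.-1 by [].
have : v.-1 * (70 * v * b) <= v * v * (70 * b).
  have -> : v.-1 * (70 * v * b) = v.-1 * v * (70 * b) by lia.
  by rewrite !leq_mul2r leq_pred !orbT.
have : 1 * 2 <= (v * v) * b by apply: leq_mul; rewrite // muln_gt0.
lia.
Qed.

(** Each command costs time linear in the register lengths, which never exceed [size x + t]; reading
    and writing symbol by symbol are quadratic too. Leftovers in the registers do no harm, since
    they lie to the left of the output. *)
Lemma machine_of_cmd c : exists (M : TM) (K : nat), forall x t s',
  run c (init_state x) t s' ->
  exists2 n, n <= K * (size x + t).+1 ^ 2 & halts_with M x n (s' 0).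
Proof.
have [m Hm Hb] : exists2 m, 0 < m & below m c.
  pose fix mx c := match c with Push r _ | Pop r => r.+1 | Seq c1 c2 => maxn (mx c1) (mx c2)
    | If r cn c0 c1 => maxn r.+1 (maxn (mx cn) (maxn (mx c0) (mx c1)))
    | While r c => maxn r.+1 (mx c) end.
  suff H k : mx c <= k -> below k c by exists (mx c).+1 => //; apply: H.
  elim: c k => /=.
  - by move=> r b k; lia.
  - by move=> r k; lia.
  - by move=> c1 IH1 c2 IH2 k; rewrite geq_max => /andP[/IH1 -> /IH2 ->].
  - by move=> r cn IHn c0 IH0 c1 IH1 k; rewrite !geq_max => /and4P[-> /IHn -> /IH0 -> /IH1 ->].
  - by move=> r c IH k; rewrite geq_max => /andP[-> /IH ->].
exists (tseq (t_read m.+1) (tseq (compile m.+1 c) (t_write m.+1))), (300 * m.+1) => x t s' H.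
have Hsz r : size (init_state x r) + t <= size x + t.
  by rewrite /init_state /upd; case: eqP => _ //=; lia.
have [s2 H3] := @HTb_write_out m.+1 s' Hm.
have H2 := @compile_run m c _ _ _ H Hb (text [::]) _ (fun r _ => Hsz r).
have [n Hn HH] := HTb_seq (@HTb_read m.+1 x Hm) (HTb_seq H2 H3 (leqnn _)) (leqnn _).
exists n; last first.
  by apply: HT_halts HH _ => i; rewrite tape_io; [rewrite add0r textE | lia].
apply: leq_trans Hn _.
have := run_size H 0; rewrite /init_state /upd /=.
set w := (size x + t).+1 => Hw; rewrite expnS expn1.
have P k1 k2 : k1 <= w -> k2 <= w -> k1 * k2 <= w * w by move=> *; apply: leq_mul.
have := P (size (s' 0)).+1 (size (s' 0)).+1 Hw Hw.
have := P (size x).+1 (size x).+1; have := P t w.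
have -> : 300 * m.+1 * (w * w) = 60 * m.+1 * (w * w) + 60 * m.+1 * (w * w) + 100 * m.+1 * (w * w) + 80 * m.+1 * (w * w) by lia.
move=> /(_ _ _)P1 /(_ _ _)P2 P3.
have {}P1 : t * w <= w * w by apply: P1; rewrite /w; lia.
have {}P2 : (size x).+1 * (size x).+1 <= w * w by apply: P2; rewrite /w; lia.
have Q1 : t * (60 * m.+1 * w) <= 60 * m.+1 * (w * w) by rewrite mulnCA leq_mul2l P1 orbT.
have Q2 : (size x).+1 * (size x).+1 * (60 * m.+1) <= 60 * m.+1 * (w * w).
  by rewrite [X in X <= _]mulnC leq_mul2l P2 orbT.
have Q3 : (size (s' 0)).+1 * (size (s' 0)).+1 * (100 * m.+1) <= 100 * m.+1 * (w * w).
  by rewrite [X in X <= _]mulnC leq_mul2l P3 orbT.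
have : 1 * 1 <= m.+1 * (w * w) by apply: leq_mul; rewrite // muln_gt0.
lia.
Qed.

(** * Runs with upper bounds on time, and basic register programs *)

Definition runb c s B s' := exists2 t, t <= B & run c s t s'.

Lemma runb_weaken c s B s' B' : runb c s B s' -> B <= B' -> runb c s B' s'.
Proof. by move=> [t Ht H] HB; exists t => //; lia. Qed.

Lemma runb_seq c1 c2 s B1 s1 B2 s2 :
  runb c1 s B1 s1 -> runb c2 s1 B2 s2 -> runb (Seq c1 c2) s (B1 + B2).+1 s2.
Proof.
by move=> [t1 L1 H1] [t2 L2 H2]; exists (t1 + t2).+1; [lia | apply: run_seq H1 H2].
Qed.

Lemma runb_push r b s : runb (Push r b) s 1 (upd s r (b :: s r)).
Proof. by exists 1 => //; constructor. Qed.

Lemma runb_pop r s : runb (Pop r) s 1 (upd s r (behead (s r))).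
Proof. by exists 1 => //; constructor. Qed.

Lemma runb_if r cn c0 c1 s B s' :
  runb (match ohead (s r) with None => cn | Some false => c0 | Some true => c1 end) s B s' ->
  runb (If r cn c0 c1) s B.+1 s'.
Proof. by move=> [t Ht H]; exists t.+1 => //; constructor. Qed.

Lemma runb_while_nil r c s : s r = [::] -> runb (While r c) s 1 s.
Proof. by move=> H; exists 1 => //; constructor. Qed.

Lemma runb_while_cons r c (s : state) B1 s1 B2 s2 : s r <> [::] ->
  runb c s B1 s1 -> runb (While r c) s1 B2 s2 -> runb (While r c) s (B1 + B2).+1 s2.
Proof.
move=> /eqP Hr [t1 L1 H1] [t2 L2 H2]; exists (t1 + t2).+1; first by lia.
exact: run_while_cons Hr H1 H2.
Qed.

Lemma runb_eq c s B s' s2 B' : runb c s B s' -> s' =1 s2 -> B <= B' -> runb c s B' s2.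
Proof. by move=> H /functional_extensionality <- HB; apply: runb_weaken HB. Qed.

Ltac upd_cases :=
  repeat match goal with
  | |- context [?a == ?b] => case: (a =P b) => ?
  end; try subst;
  repeat match goal with
  | H : is_true (?a != ?a) |- _ => by rewrite eqxx in H
  end; try done; try congruence; try (exfalso; lia).

Ltac state_eq :=
  try apply: functional_extensionality; let k := fresh "k" in move=> k; rewrite /upd /=; upd_cases.

Ltac upd_at := rewrite /upd /=; upd_cases.

Lemma upd_same s r v : upd s r v r = v. Proof. by rewrite /upd eqxx. Qed.
Lemma upd_neq s r v k : k != r -> upd s r v k = s k.
Proof. by rewrite /upd => /negbTE ->. Qed.
Lemma upd_id s r v : s r = v -> upd s r v = s.
Proof. by move=> H; apply: functional_extensionality => k; rewrite /upd; case: eqP => // ->. Qed.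
Lemma upd_upd s r v w : upd (upd s r v) r w = upd s r w.
Proof. by apply: functional_extensionality => k; rewrite /upd; case: eqP. Qed.

(** The word arrives reversed, so transfers come in pairs, with a word parked in reverse in
    between. *)
Definition rmove r r' :=
  While r (If r (Pop r) (Seq (Pop r) (Push r' false)) (Seq (Pop r) (Push r' true))).

Lemma runb_rmove r r' s : r != r' ->
  runb (rmove r r') s (5 * size (s r)).+1 (upd (upd s r' (catrev (s r) (s r'))) r [::]).
Proof.
move=> Hr; move E: (s r) => v; elim: v s E => [|b v IH] s E.
  by rewrite /= upd_id ?upd_id //; apply: runb_while_nil.
have Hb : runb (If r (Pop r) (Seq (Pop r) (Push r' false)) (Seq (Pop r) (Push r' true))) s 4
   (upd (upd s r v) r' (b :: s r')).
  apply: runb_if; rewrite E.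
  have H : runb (Seq (Pop r) (Push r' b)) s 3 (upd (upd s r v) r' (b :: s r')).
    have := runb_seq (runb_pop r s) (runb_push r' b _); rewrite E /=.
    by rewrite (@upd_neq s) // eq_sym.
  by case: b {IH E} H.
apply: runb_eq (runb_while_cons _ Hb (IH _ _)) _ _.
- by rewrite E.
- by upd_at.
- by state_eq.
- by rewrite /=; lia.
Qed.

Definition rcopy r r1 r2 :=
  While r (If r (Pop r) (Seq (Pop r) (Seq (Push r1 false) (Push r2 false)))
                        (Seq (Pop r) (Seq (Push r1 true) (Push r2 true)))).

Lemma runb_rcopy r r1 r2 s : r != r1 -> r != r2 -> r1 != r2 ->
  runb (rcopy r r1 r2) s (7 * size (s r)).+1
    (upd (upd (upd s r1 (catrev (s r) (s r1))) r2 (catrev (s r) (s r2))) r [::]).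
Proof.
move=> H1 H2 H12; move E: (s r) => v; elim: v s E => [|b v IH] s E.
  by rewrite /= !upd_id //; apply: runb_while_nil.
have Hb : runb (If r (Pop r) (Seq (Pop r) (Seq (Push r1 false) (Push r2 false)))
    (Seq (Pop r) (Seq (Push r1 true) (Push r2 true)))) s 6 (upd (upd (upd s r v) r1 (b :: s r1)) r2 (b :: s r2)).
  apply: runb_if; rewrite E.
  have H : runb (Seq (Pop r) (Seq (Push r1 b) (Push r2 b))) s 5
     (upd (upd (upd s r v) r1 (b :: s r1)) r2 (b :: s r2)).
    have := runb_seq (runb_pop r s) (runb_seq (runb_push r1 b _) (runb_push r2 b _)).
    rewrite E /= (@upd_neq _ r1) 1?eq_sym // !(@upd_neq _ r) // 1?eq_sym //.
  by case: b {IH E} H.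
apply: runb_eq (runb_while_cons _ Hb (IH _ _)) _ _.
- by rewrite E.
- by upd_at.
- by state_eq.
- by rewrite /=; lia.
Qed.

Definition rclear r := While r (Pop r).

Lemma runb_rclear r s : runb (rclear r) s (2 * size (s r)).+1 (upd s r [::]).
Proof.
move E: (s r) => v; elim: v s E => [|b v IH] s E.
  by rewrite upd_id //; apply: runb_while_nil.
apply: runb_eq (runb_while_cons _ (runb_pop r s) (IH _ _)) _ _.
- by rewrite E.
- by rewrite upd_same E.
- by rewrite upd_upd.
- by rewrite /=; lia.
Qed.

(** * Trees and polynomial-time maps between them *)

Inductive tree := Leaf | Node of tree & tree.

(** Preorder listing: a prefix code without separators, so a stack program can split a concatenation
    of trees, and the top bit alone tells a leaf from a node. *)
Fixpoint tenc (a : tree) : seq bool :=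
  if a is Node a1 a2 then true :: tenc a1 ++ tenc a2 else [:: false].

Definition tlen a := size (tenc a).

(* The counter [k] holds one bit for each tree that remains to be read. *)
Definition rtree_loop r d k :=
  While k (If r (Pop k) (Seq (Pop r) (Seq (Push d false) (Pop k)))
                        (Seq (Pop r) (Seq (Push d true) (Push k true)))).

Lemma runb_rtree_loop r d k a s w kk B s2 :
  r != d -> r != k -> d != k ->
  s r = tenc a ++ w -> s k = true :: kk ->
  runb (rtree_loop r d k) (upd (upd (upd s r w) d (catrev (tenc a) (s d))) k kk) B s2 ->
  runb (rtree_loop r d k) s (7 * tlen a + B) s2.
Proof.
move=> H1 H2 H3; rewrite /tlen; elim: a s w kk B s2 => [|a IHa b IHb] s w kk B s2 /= Hs Hk H.
  have Hb : runb (Seq (Pop r) (Seq (Push d false) (Pop k))) s 5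
      (upd (upd (upd s r w) d (false :: s d)) k kk).
    have := runb_seq (runb_pop r s) (runb_seq (runb_push d false _) (runb_pop k _)).
    rewrite Hs /= !upd_neq ?Hk //=; by [rewrite eq_sym|].
  apply: runb_weaken (runb_while_cons _ (runb_if _) H) _; first by rewrite Hk.
    by rewrite Hs; exact: Hb.
  by [].
have Hb : runb (Seq (Pop r) (Seq (Push d true) (Push k true))) s 5
    (upd (upd (upd s r (tenc a ++ tenc b ++ w)) d (true :: s d)) k (true :: true :: kk)).
  have := runb_seq (runb_pop r s) (runb_seq (runb_push d true _) (runb_push k true _)).
  rewrite Hs /= !upd_neq ?Hk ?catA //=; by [rewrite eq_sym|].
set s3 := upd _ k (true :: true :: kk) in Hb.
have Hlast : runb (rtree_loop r d k) s3 (7 * size (tenc a) + (7 * size (tenc b) + B)) s2.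
  apply: (IHa _ (tenc b ++ w) (true :: kk)).
  - by rewrite /s3; upd_at.
  - by rewrite /s3; upd_at.
  apply: (IHb _ w kk).
  - by upd_at.
  - by upd_at.
  apply: runb_eq (_ : runb _ _ B s2) _ _ => //.
  move: H; congr runb; apply: functional_extensionality => j.
  rewrite /s3 /upd /= !catrevE rev_cat -!catA.
  by upd_cases.
apply: runb_weaken (runb_while_cons _ (runb_if _) Hlast) _; first by rewrite Hk.
  by rewrite Hs; exact: Hb.
by rewrite size_cat; lia.
Qed.

Definition rtree r d k := Seq (Push k true) (rtree_loop r d k).

Lemma runb_rtree r d k a s w : r != d -> r != k -> d != k ->
  s r = tenc a ++ w -> s k = [::] ->
  runb (rtree r d k) s (7 * tlen a + 3) (upd (upd s r w) d (catrev (tenc a) (s d))).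
Proof.
move=> H1 H2 H3 Hs Hk.
set s2 := upd _ d _.
have E : upd (upd (upd (upd s k [:: true]) r w) d (catrev (tenc a) (upd s k [:: true] d))) k [::] = s2.
  by rewrite /s2; state_eq.
have HL := @runb_rtree_loop r d k a (upd s k [:: true]) w [::] 1 s2 H1 H2 H3.
have P := runb_push k true s; rewrite Hk in P.
apply: runb_weaken (runb_seq P (HL _ _ _)) _; last by lia.
- by rewrite upd_neq.
- by rewrite upd_same.
- rewrite E; apply: runb_while_nil.
  by rewrite /s2 !upd_neq // eq_sym.
Qed.

(** * Polynomial bounds *)

Definition polyb (P : nat -> nat) := exists c e, forall n, P n <= c * n.+1 ^ e.

Lemma poly_le P Q : polyb Q -> (forall n, P n <= Q n) -> polyb P.
Proof. by move=> [c [e H]] HPQ; exists c, e => n; apply: leq_trans (HPQ n) (H n). Qed.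

Lemma leq_exp a b e : a <= b -> a ^ e <= b ^ e.
Proof. by case: e => // e H; rewrite leq_exp2r. Qed.

Lemma poly_major P : polyb P -> exists Q,
  [/\ polyb Q, {homo Q : m n / m <= n} & forall n, P n <= Q n].
Proof.
move=> [c [e H]]; exists (fun n => c * n.+1 ^ e); split=> //; first by exists c, e.
by move=> m n Hmn; rewrite leq_mul2l leq_exp ?orbT.
Qed.

Lemma poly_const k : polyb (fun=> k).
Proof. by exists k, 0 => n; rewrite muln1. Qed.

Lemma poly_id : polyb id.
Proof. by exists 1, 1 => n; rewrite mul1n expn1. Qed.

Lemma poly_add P Q : polyb P -> polyb Q -> polyb (fun n => P n + Q n).
Proof.
move=> [c [e H]] [c' [e' H']]; exists (c + c'), (e + e') => n.
have L1 : n.+1 ^ e <= n.+1 ^ (e + e') by apply: leq_pexp2l; rewrite ?leq_addr.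
have L2 : n.+1 ^ e' <= n.+1 ^ (e + e') by apply: leq_pexp2l; rewrite ?leq_addl.
rewrite mulnDl; apply: leq_add; [apply: leq_trans (H n) _ | apply: leq_trans (H' n) _];
  by rewrite leq_mul2l ?L1 ?L2 orbT.
Qed.

Lemma poly_mul P Q : polyb P -> polyb Q -> polyb (fun n => P n * Q n).
Proof.
move=> [c [e H]] [c' [e' H']]; exists (c * c'), (e + e') => n.
by rewrite expnD mulnACA; apply: leq_mul.
Qed.

Lemma poly_comp P Q : polyb P -> polyb Q -> polyb (fun n => P (Q n)).
Proof.
move=> [c [e H]] [c' [e' H']]; exists (c * c'.+1 ^ e), (e' * e) => n.
apply: leq_trans (H _) _; rewrite -mulnA leq_mul2l expnM -expnMn leq_exp ?orbT //.
have : 0 < n.+1 ^ e' by rewrite expn_gt0.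
by have := H' n; rewrite mulSn; lia.
Qed.

Lemma poly_exp P e : polyb P -> polyb (fun n => P n ^ e).
Proof.
move=> HP; elim: e => [|e IH]; first exact: poly_const.
by apply: poly_le (poly_mul HP IH) _ => n; rewrite expnS.
Qed.

Lemma poly_S P : polyb P -> polyb (fun n => (P n).+1).
Proof. by move=> H; apply: poly_le (poly_add H (poly_const 1)) _ => n; rewrite addn1. Qed.

Ltac poly_tac := repeat first
  [ assumption | exact: poly_const | exact: poly_id | apply: poly_add | apply: poly_mul
  | apply: poly_exp | apply: poly_S
  | match goal with H : polyb ?P |- polyb (fun n => ?P (@?Q n)) => apply: (@poly_comp P Q) end ].

(* [pt u v]: a stack program computes [v a] from [u a] in register 0, in polynomial
   time and using only registers that it finds and leaves empty. *)
Definition pt A (u v : A -> tree) := exists c m P,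
  [/\ polyb P, 0 < m, below m c &
    forall a s, s 0 = tenc (u a) -> (forall i, 0 < i -> i < m -> s i = [::]) ->
      runb c s (P (tlen (u a))) (upd s 0 (tenc (v a)))].

Lemma below_mono m n c : m <= n -> below m c -> below n c.
Proof.
move=> H; elim: c => /=.
- by move=> r _; lia.
- by move=> r; lia.
- by move=> c1 IH1 c2 IH2 /andP[/IH1 -> /IH2 ->].
- by move=> r cn IHn c0 IH0 c1 IH1 /and4P[? /IHn -> /IH0 -> /IH1 ->]; rewrite !andbT; lia.
- by move=> r c IH /andP[? /IH ->]; rewrite andbT; lia.
Qed.

(** Lengths come for free: by [run_size] an output is no longer than the input plus the running
    time. Both bounds are made monotone so that they can be applied to overestimates. *)
Lemma pt_elim A (u v : A -> tree) : pt u v -> exists c m P S,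
  [/\ [/\ polyb P, 0 < m & below m c],
      (forall a s, s 0 = tenc (u a) -> (forall i, 0 < i -> i < m -> s i = [::]) ->
        runb c s (P (tlen (u a))) (upd s 0 (tenc (v a)))),
      polyb S, {homo P : x y / x <= y}
    & {homo S : x y / x <= y} /\ forall a, tlen (v a) <= S (tlen (u a))].
Proof.
move=> [c [m [P0 [pP0 Hm Hb H0]]]]; have [P [pP mP HP]] := poly_major pP0.
have H a s : s 0 = tenc (u a) -> (forall i, 0 < i -> i < m -> s i = [::]) ->
   runb c s (P (tlen (u a))) (upd s 0 (tenc (v a))).
  by move=> *; apply: runb_weaken (HP _); apply: H0.
exists c, m, P, (fun n => n + P n); split=> //; first by poly_tac.
split=> [x y Hxy|a]; first by rewrite leq_add // mP.
have [||t Ht R] := H a (init_state (tenc (u a))).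
- by rewrite /init_state; upd_at.
- by case.
have := run_size R 0; rewrite /init_state /upd /= -/(tlen _) => Hs.
by rewrite /tlen in Ht Hs *; lia.
Qed.

(** There is no idle command; clearing the empty register 1 serves as one. *)
Lemma pt_id A (u : A -> tree) : pt u u.
Proof.
exists (rclear 1), 2, (fun=> 1); split=> //; first by poly_tac.
move=> a s H0 H; rewrite upd_id //; apply: runb_eq (runb_rclear 1 s) _ _.
- by rewrite upd_id // H.
- by rewrite H.
Qed.

Lemma pt_comp A (u v w : A -> tree) : pt u v -> pt v w -> pt u w.
Proof.
move=> /pt_elim[c1 [m1 [P1 [S1 [[pP1 Hm1 b1] H1 pS1 mP1 [mS1 HS1]]]]]].
move=> /pt_elim[c2 [m2 [P2 [S2 [[pP2 Hm2 b2] H2 pS2 mP2 [mS2 HS2]]]]]].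
exists (Seq c1 c2), (maxn m1 m2), (fun n => (P1 n + P2 (S1 n)).+1); split.
- by poly_tac.
- by rewrite leq_max Hm1.
- by rewrite /= (below_mono (leq_maxl _ _) b1) (below_mono (leq_maxr _ _) b2).
move=> a s Hs Hi.
apply: runb_eq (runb_seq (H1 a s Hs _) (H2 a _ _ _)) _ _.
- by move=> i ? ?; apply: Hi; lia.
- by upd_at.
- by move=> i ? ?; upd_at; apply: Hi; lia.
- by state_eq.
- by rewrite ltnS leq_add2l mP2.
Qed.

Ltac below_tac := rewrite /=; repeat (apply/andP; split); try done; try lia.

(** In its uses [M] lies above all registers of the programs being combined, so the copy survives
    them. The first transfer reverses the input and the second restores its order in both copies. *)
Definition save M := Seq (rmove 0 M.+1) (rcopy M.+1 0 M).

Lemma runb_save M s : 0 < M -> s M = [::] -> s M.+1 = [::] ->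
  runb (save M) s (12 * size (s 0) + 3) (upd s M (s 0)).
Proof.
move=> HM H1 H2.
have R1 : runb (rmove 0 M.+1) s (5 * size (s 0)).+1 (upd (upd s M.+1 (rev (s 0))) 0 [::]).
  by apply: runb_eq (runb_rmove s _) _ _ => //; rewrite H2.
have N1 : M.+1 != M by lia.
have N2 : 0 != M by lia.
apply: runb_eq (runb_seq R1 (runb_rcopy _ _ N1 N2)) _ _ => //.
- by move=> k; rewrite /upd /= !catrevE; upd_cases; rewrite revK ?H1 ?cats0.
- by rewrite upd_neq // upd_same size_rev; lia.
Qed.

Definition restore M := Seq (rmove M M.+2) (rmove M.+2 0).

Lemma runb_restore M s : 0 < M -> s 0 = [::] -> s M.+2 = [::] ->
  runb (restore M) s (10 * size (s M) + 3) (upd (upd s 0 (s M)) M [::]).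
Proof.
move=> HM H1 H2.
have N1 : M != M.+2 by lia.
apply: runb_eq (runb_seq (runb_rmove s N1) (runb_rmove _ _)) _ _ => //.
- by move=> k; rewrite /upd /= !catrevE; upd_cases; rewrite ?H1 ?H2 ?cats0 ?revK.
- by rewrite upd_neq 1?eq_sym // upd_same catrevE H2 cats0 size_rev; lia.
Qed.

Lemma below_save m M : M.+1 < m -> below m (save M).
Proof. by move=> H; rewrite /=; below_tac. Qed.

Lemma below_restore m M : M.+2 < m -> below m (restore M).
Proof. by move=> H; rewrite /=; below_tac. Qed.

Lemma pt_cons A (u v w : A -> tree) : pt u v -> pt u w -> pt u (fun a => Node (v a) (w a)).
Proof.
move=> /pt_elim[c1 [m1 [P1 [S1 [[pP1 Hm1 b1] H1 pS1 mP1 [mS1 HS1]]]]]].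
move=> /pt_elim[c2 [m2 [P2 [S2 [[pP2 Hm2 b2] H2 pS2 mP2 [mS2 HS2]]]]]].
pose M := maxn m1 m2; have HM : 0 < M by rewrite leq_max Hm1.
have [L1 L2] : m1 <= M /\ m2 <= M by rewrite leq_maxl leq_maxr.
clearbody M.
(* The first value waits reversed in [M.+1] while the input is restored through [M.+2] for the
   second program. Moving it back puts it in order on top of the second value, and the pushed [true]
   is the bit of the new node. *)
exists (Seq (save M) (Seq c1 (Seq (rmove 0 M.+1) (Seq (restore M) (Seq c2
   (Seq (rmove M.+1 0) (Push 0 true))))))), M.+3,
  (fun n => 22 * n + P1 n + 10 * S1 n + P2 n + 20); split=> //; first by poly_tac.
  rewrite /below -/below below_save // below_restore //.
  by rewrite (below_mono _ b1) ?(below_mono _ b2) //=; below_tac.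
move=> a s Hs Hi.
have E1 : s M = [::] by apply: Hi; lia.
have E2 : s M.+1 = [::] by apply: Hi; lia.
have E3 : s M.+2 = [::] by apply: Hi; lia.
have R1 := runb_save HM E1 E2; rewrite Hs in R1.
have R2 := H1 a (upd s M (tenc (u a))); set s2 := upd _ 0 _ in R2.
have R3 := @runb_rmove 0 M.+1 s2 isT; set s3 := upd _ 0 _ in R3.
have R4 := @runb_restore M s3 HM; set s4 := upd _ M _ in R4.
have R5 := H2 a s4; set s5 := upd s4 0 _ in R5.
have R6 := @runb_rmove M.+1 0 s5 isT; set s6 := upd _ M.+1 _ in R6.
have X2 : s2 0 = tenc (v a) by [].
have X3 : s3 M = tenc (u a) by rewrite /s3 /s2; upd_at.
have X5 : s5 M.+1 = rev (tenc (v a)).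
  by rewrite /s5 /s4 /s3 /upd /= X2; upd_cases; rewrite catrevE /s2; upd_at; rewrite ?E2 ?cats0.
apply: runb_eq (runb_seq R1 (runb_seq (R2 _ _) (runb_seq R3 (runb_seq (R4 _ _) (runb_seq (R5 _ _)
  (runb_seq R6 (runb_push 0 true _))))))) _ _.
- by upd_at.
- by move=> i ? ?; upd_at; apply: Hi; lia.
- by rewrite /s3; upd_at.
- by rewrite /s3 /s2; upd_at.
- by rewrite /s4 X3; upd_at.
- move=> i ? ?; rewrite /s4 /s3 /s2; upd_at; apply: Hi; lia.
- move=> k; rewrite /s6 X5 !catrevE revK.
  rewrite /s5 /s4 /s3 /s2; upd_at.
- rewrite X2 X3 X5 size_rev -!/(tlen _).
  have := HS1 a; lia.
Qed.

Definition thd a := if a is Node a1 _ then a1 else Leaf.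
Definition ttl a := if a is Node _ a2 then a2 else Leaf.

Lemma pt_leaf A (u : A -> tree) : pt u (fun=> Leaf).
Proof.
exists (Seq (rclear 0) (Push 0 false)), 1, (fun n => 2 * n + 3); split=> //; first by poly_tac.
move=> a s Hs _; apply: runb_eq (runb_seq (runb_rclear 0 s) (runb_push 0 false _)) _ _.
- by state_eq.
- by rewrite Hs -/(tlen _); lia.
Qed.

Lemma pt_thd_self A (u : A -> tree) : pt u (fun a => thd (u a)).
Proof.
exists (If 0 (Pop 0) (rclear 1) (Seq (Pop 0) (Seq (rtree 0 1 2) (Seq (rclear 0) (rmove 1 0))))), 3,
  (fun n => 20 * n + 20); split=> //; first by poly_tac.
move=> a s Hs Hi; have E1 := Hi 1 isT isT; have E2 := Hi 2 isT isT.
case E: (u a) Hs => [|a1 a2] /= Hs.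
  apply: runb_eq (runb_if (_ : runb _ _ (2 * size (s 1)).+1 _)) _ _.
  - by rewrite Hs /=; apply: runb_rclear.
  - by state_eq.
  - by rewrite E1.
have R2 := @runb_rtree 0 1 2 a1 (upd s 0 (tenc a1 ++ tenc a2)) (tenc a2) isT isT isT erefl E2.
apply: runb_eq (runb_if (_ : runb _ _ (20 * tlen (Node a1 a2) + 19) _)) _ _; last by lia.
  rewrite Hs /=.
  have R1 := runb_pop 0 s; rewrite Hs /= in R1.
  apply: runb_weaken (runb_seq R1 (runb_seq R2 (runb_seq (runb_rclear 0 _) (runb_rmove _ _)))) _ => //.
  rewrite /upd /= !catrevE E1 cats0 size_rev /tlen /= size_cat; lia.
by move=> k; rewrite /upd /= !catrevE; upd_cases; rewrite E1 !cats0 revK.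
Qed.

Lemma pt_ttl_self A (u : A -> tree) : pt u (fun a => ttl (u a)).
Proof.
exists (If 0 (Pop 0) (rclear 1) (Seq (Pop 0) (Seq (rtree 0 1 2) (rclear 1)))), 3,
  (fun n => 20 * n + 20); split=> //; first by poly_tac.
move=> a s Hs Hi; have E1 := Hi 1 isT isT; have E2 := Hi 2 isT isT.
case E: (u a) Hs => [|a1 a2] /= Hs.
  apply: runb_eq (runb_if (_ : runb _ _ (2 * size (s 1)).+1 _)) _ _.
  - by rewrite Hs /=; apply: runb_rclear.
  - by state_eq.
  - by rewrite E1.
have R2 := @runb_rtree 0 1 2 a1 (upd s 0 (tenc a1 ++ tenc a2)) (tenc a2) isT isT isT erefl E2.
apply: runb_eq (runb_if (_ : runb _ _ (20 * tlen (Node a1 a2) + 19) _)) _ _; last by lia.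
  rewrite Hs /=.
  have R1 := runb_pop 0 s; rewrite Hs /= in R1.
  apply: runb_weaken (runb_seq R1 (runb_seq R2 (runb_rclear 1 _))) _ => //.
  rewrite /upd /= !catrevE E1 cats0 size_rev /tlen /= size_cat; lia.
by move=> k; rewrite /upd /=; upd_cases.
Qed.

Lemma pt_thd A (u v : A -> tree) : pt u v -> pt u (fun a => thd (v a)).
Proof. by move=> H; apply: pt_comp H (pt_thd_self _). Qed.

Lemma pt_ttl A (u v : A -> tree) : pt u v -> pt u (fun a => ttl (v a)).
Proof. by move=> H; apply: pt_comp H (pt_ttl_self _). Qed.

(** The top bit of [tenc (b a)] is the whole test; the rest of that value is cleared only after
    branching, and the saved input is then restored for the chosen branch. *)
Lemma pt_if A (u b v w : A -> tree) : pt u b -> pt u v -> pt u w ->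
  pt u (fun a => if b a is Leaf then v a else w a).
Proof.
move=> /pt_elim[c0 [m0 [P0 [S0 [[pP0 Hm0 b0] H0 pS0 mP0 [mS0 HS0]]]]]].
move=> /pt_elim[c1 [m1 [P1 [S1 [[pP1 Hm1 b1] H1 pS1 mP1 [mS1 HS1]]]]]].
move=> /pt_elim[c2 [m2 [P2 [S2 [[pP2 Hm2 b2] H2 pS2 mP2 [mS2 HS2]]]]]].
pose M := maxn m0 (maxn m1 m2); have HM : 0 < M by rewrite leq_max Hm0.
have [L0 L1 L2] : [/\ m0 <= M, m1 <= M & m2 <= M].
  by rewrite /M; split; rewrite !leq_max leqnn ?orbT.
clearbody M; pose X c := Seq (rclear 0) (Seq (restore M) c).
exists (Seq (save M) (Seq c0 (If 0 (Pop 0) (X c1) (X c2)))), M.+3,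
  (fun n => 22 * n + P0 n + 2 * S0 n + P1 n + P2 n + 20); split=> //; first by poly_tac.
  by rewrite /X /= !(below_mono _ b0) ?(below_mono _ b1) ?(below_mono _ b2) //=; below_tac.
move=> a s Hs Hi.
have E1 : s M = [::] by apply: Hi; lia.
have E2 : s M.+1 = [::] by apply: Hi; lia.
have E3 : s M.+2 = [::] by apply: Hi; lia.
have R1 := runb_save HM E1 E2; rewrite Hs in R1.
have R2 := H0 a (upd s M (tenc (u a))); set s2 := upd _ 0 _ in R2.
have X2 : s2 0 = tenc (b a) by [].
have RX c P x : below M c ->
    (forall s, s 0 = tenc (u a) -> (forall i, 0 < i -> i < M -> s i = [::]) ->
      runb c s P (upd s 0 (tenc x))) ->
    runb (X c) s2 (2 * S0 (tlen (u a)) + 10 * tlen (u a) + P + 10) (upd s 0 (tenc x)).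
  move=> bc Hc; have R3 := runb_rclear 0 s2; set s3 := upd s2 _ _ in R3.
  have R4 := @runb_restore M s3 HM; set s4 := upd _ M _ in R4.
  have X3 : s3 M = tenc (u a) by rewrite /s3 /s2; upd_at.
  have R5 := Hc s4.
  apply: runb_eq (runb_seq R3 (runb_seq (R4 _ _) (R5 _ _))) _ _.
  - by rewrite /s3; upd_at.
  - by rewrite /s3 /s2; upd_at.
  - by rewrite /s4 X3; upd_at.
  - by move=> i ? ?; rewrite /s4 /s3 /s2; upd_at; apply: Hi; lia.
  - by move=> k; rewrite /s4 /s3 /s2; upd_at.
  - rewrite X2 X3 -!/(tlen _); have := HS0 a; lia.
have R3 : runb (If 0 (Pop 0) (X c1) (X c2)) s2
   (2 * S0 (tlen (u a)) + 10 * tlen (u a) + P1 (tlen (u a)) + P2 (tlen (u a)) + 11)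
   (upd s 0 (tenc (if b a is Leaf then v a else w a))).
  apply: runb_weaken (runb_if (B := 2 * S0 (tlen (u a)) + 10 * tlen (u a) + (P1 (tlen (u a)) + P2 (tlen (u a))) + 10) _) _; last lia.
  rewrite X2; case: (b a) => [|? ?] /=; apply: RX.
  - exact: below_mono b1.
  - move=> t Ht Hti; apply: runb_weaken (H1 a t Ht _) _; last by lia.
    by move=> i ? ?; apply: Hti; lia.
  - exact: below_mono b2.
  - move=> t Ht Hti; apply: runb_weaken (H2 a t Ht _) _; last by lia.
    by move=> i ? ?; apply: Hti; lia.
apply: runb_eq (runb_seq R1 (runb_seq (R2 _ _) R3)) _ _ => //.
- by upd_at.
- by move=> i ? ?; upd_at; apply: Hi; lia.
- rewrite -/(tlen _); lia.
Qed.

Fixpoint tlist X (i : X -> tree) (l : seq X) : tree :=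
  if l is x :: l' then Node (i x) (tlist i l') else Leaf.

Arguments tlen : simpl never.

Lemma tlen_node a b : tlen (Node a b) = (tlen a + tlen b).+1.
Proof. by rewrite /tlen /= size_cat. Qed.

Lemma tlen_cons X (i : X -> tree) x l :
  tlen (tlist i (x :: l)) = (tlen (i x) + tlen (tlist i l)).+1.
Proof. exact: tlen_node. Qed.

Lemma tlen_gt0 a : 0 < tlen a. Proof. by case: a. Qed.

Lemma tlen_cat X (i : X -> tree) l1 l2 :
  tlen (tlist i (l1 ++ l2)) = (tlen (tlist i l1) + tlen (tlist i l2)).-1.
Proof.
elim: l1 => [|x l1 IH]; rewrite ?cat_cons ?tlen_cons ?IH //.
by have := tlen_gt0 (tlist i l1); have := tlen_gt0 (tlist i l2); lia.
Qed.

Lemma size_tlist X (i : X -> tree) l : size l < tlen (tlist i l).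
Proof. by elim: l => // x l; rewrite tlen_cons -[size (_ :: _)]/(size l).+1; lia. Qed.

(** Polynomially many rounds of a polynomial program can still build an exponentially long
    accumulator. The last hypothesis excludes this; as it speaks of all lists, it applies to every
    prefix and so bounds every round. *)
Lemma pt_foldl S X (iS : S -> tree) (iX : X -> tree) (f : S -> X -> S) Q :
  pt (fun p : S * X => Node (iS p.1) (iX p.2)) (fun p => iS (f p.1 p.2)) ->
  polyb Q ->
  (forall s l, tlen (iS (foldl f s l)) <= Q (tlen (iS s) + tlen (tlist iX l))) ->
  pt (fun p : S * seq X => Node (iS p.1) (tlist iX p.2)) (fun p => iS (foldl f p.1 p.2)).
Proof.
move=> /pt_elim[c [m [P [U [[pP Hm b] H pU mP [mU HU]]]]]] /poly_major[Z [pZ mZ HZ]] HQ.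
pose M := m; have HM : 0 < M by []; have Lm : m <= M by [].
have HbM : below M c by []; clearbody M.
(* From the accumulator in register 0 and the next element on top of [M], this assembles the
   encoding of the pair in register 0. The element is parked in [M.+1] and the accumulator in
   [M.+3], both reversed. *)
pose body := Seq (rtree M M.+1 M.+2) (Seq (rmove 0 M.+3) (Seq (rmove M.+1 0)
  (Seq (rmove M.+3 0) (Seq (Push 0 true) c)))).
(* A [true] on top of [M] announces another element. The final [false] of the list is popped, which
   empties [M] and ends the loop. *)
pose loop := While M (If M (Pop M) (Pop M) (Seq (Pop M) body)).
pose W n z := 7 * n + 5 * z + 5 * n + 5 * z + P (n + z).+1 + 40.
exists (Seq (Pop 0) (Seq (rtree 0 M.+1 M.+2) (Seq (rmove 0 M.+3) (Seq (rmove M.+3 M)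
  (Seq (rmove M.+1 0) loop))))), M.+4,
  (fun n => 30 * n + n * W n (Z n) + 40); split=> //.
- by rewrite /W; poly_tac.
- by rewrite /= !(below_mono _ HbM) //; below_tac.
have Hbody s st x l : s 0 = tenc (iS st) -> s M = true :: tenc (iX x) ++ l ->
    (forall i, 0 < i -> i < M.+4 -> i != M -> s i = [::]) ->
    runb (If M (Pop M) (Pop M) (Seq (Pop M) body)) s
      (W (tlen (iX x)) (tlen (iS st))) (upd (upd s M l) 0 (tenc (iS (f st x)))).
  move=> Hs0 HsM Hi; apply: runb_weaken (runb_if (B := (W (tlen (iX x)) (tlen (iS st))).-1) _) _;
    last by rewrite /W; lia.
  have E1 : s M.+1 = [::] by apply: Hi; lia.
  have E2 : s M.+2 = [::] by apply: Hi; lia.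
  have E3 : s M.+3 = [::] by apply: Hi; lia.
  rewrite HsM /=.
  have R0 := runb_pop M s; rewrite HsM /= in R0; set s0 := upd s M _ in R0.
  have N1 : M != M.+1 by lia.
  have N2 : M != M.+2 by lia.
  have N3 : M.+1 != M.+2 by lia.
  have R1 := @runb_rtree M M.+1 M.+2 (iX x) s0 l N1 N2 N3.
  set s1 := upd _ M.+1 _ in R1.
  have X1 : s1 M.+1 = rev (tenc (iX x)).
    by rewrite /s1 /s0 catrevE; upd_at; rewrite ?E1 ?cats0.
  have R2 := @runb_rmove 0 M.+3 s1 isT; set s2 := upd _ 0 _ in R2.
  have X2 : s1 0 = tenc (iS st) by rewrite /s1 /s0; upd_at.
  have R3 := @runb_rmove M.+1 0 s2 isT; set s3 := upd _ M.+1 _ in R3.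
  have X3 : s2 M.+1 = rev (tenc (iX x)) by rewrite /s2; upd_at.
  have R4 := @runb_rmove M.+3 0 s3 isT; set s4 := upd _ M.+3 _ in R4.
  have X4 : s3 M.+3 = rev (tenc (iS st)).
    rewrite /s3 /s2; upd_at; rewrite X2 catrevE /s1 /s0; upd_at; by rewrite E3 cats0.
  have X4b : s3 0 = tenc (iX x).
    by rewrite /s3 X3 /s2; upd_at; rewrite catrevE revK cats0.
  have R5 := runb_push 0 true s4; set s5 := upd s4 0 _ in R5.
  have X5 : s5 0 = tenc (Node (iS st) (iX x)).
    by rewrite /s5 /s4 X4 X4b /upd /= catrevE revK.
  have R6 := H (st, x) s5 X5.
  apply: runb_eq (runb_seq R0 (runb_seq (R1 _ _) (runb_seq R2 (runb_seq R3 (runb_seq R4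
     (runb_seq R5 (R6 _))))))) _ _.
  - by rewrite /s0; upd_at.
  - by rewrite /s0; upd_at.
  - move=> i ? ?; rewrite /s5 /s4 /s3 /s2 /s1 /s0; upd_at; apply: Hi; lia.
  - move=> k; rewrite /s5 /s4 /s3 /s2 /s1 /s0; upd_at.
  - have -> : P (tlen (Node (iS (st, x).1) (iX (st, x).2))) = P (tlen (iX x) + tlen (iS st)).+1.
      by rewrite tlen_node addnC.
    rewrite X2 X3 X4 !size_rev -!/(tlen _) /W; lia.
have Hloop n z l s st : s 0 = tenc (iS st) -> s M = tenc (tlist iX l) ->
    (forall i, 0 < i -> i < M.+4 -> i != M -> s i = [::]) ->
    tlen (tlist iX l) <= n ->
    (forall l1 l2, l = l1 ++ l2 -> tlen (iS (foldl f st l1)) <= z) ->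
    runb loop s ((size l).+1 * (W n z).+1) (upd (upd s M [::]) 0 (tenc (iS (foldl f st l)))).
  elim: l s st => [|x l IH] s st Hs0 HsM Hi Hn Hz /=.
    have R1 : runb (If M (Pop M) (Pop M) (Seq (Pop M) body)) s 2 (upd s M [::]).
      apply: runb_if; rewrite HsM /=; have := runb_pop M s; by rewrite HsM.
    apply: runb_eq (runb_while_cons _ R1 (runb_while_nil _ _)) _ _.
    - by rewrite HsM.
    - by rewrite upd_same.
    - by state_eq.
    - by rewrite /W; lia.
  have Hx : tlen (iX x) <= n by move: Hn; rewrite /= tlen_node; lia.
  have HW : W (tlen (iX x)) (tlen (iS st)) <= W n z.
    have Hst := Hz [::] (x :: l) erefl.
    have : P (tlen (iX x) + tlen (iS st)).+1 <= P (n + z).+1.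
      by apply: mP; rewrite ltnS leq_add.
    by rewrite /W; move: Hst => /=; lia.
  have R1 := Hbody s st x (tenc (tlist iX l)) Hs0 HsM Hi.
  apply: runb_eq (runb_while_cons _ R1 (IH _ (f st x) _ _ _ _ _)) _ _.
  - by rewrite HsM.
  - by upd_at.
  - by upd_at.
  - by move=> i ? ? ?; upd_at; apply: Hi.
  - by move: Hn; rewrite /= tlen_node; lia.
  - by move=> l1 l2 Hl; apply: (Hz (x :: l1) l2); rewrite Hl.
  - by state_eq.
  - by rewrite [_.+2 * _]mulSn; lia.
move=> [st l] s /= Hs Hi.
have E0 : s M = [::] by apply: Hi; lia.
have E1 : s M.+1 = [::] by apply: Hi; lia.
have E2 : s M.+2 = [::] by apply: Hi; lia.
have E3 : s M.+3 = [::] by apply: Hi; lia.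
have R0 := runb_pop 0 s; rewrite Hs /= in R0; set s0 := upd s 0 _ in R0.
have N3 : M.+1 != M.+2 by lia.
have R1 := @runb_rtree 0 M.+1 M.+2 (iS st) s0 (tenc (tlist iX l)) isT isT N3.
set s1 := upd _ M.+1 _ in R1.
have R2 := @runb_rmove 0 M.+3 s1 isT; set s2 := upd _ 0 _ in R2.
have N4 : M.+3 != M by lia.
have R3 := @runb_rmove M.+3 M s2 N4; set s3 := upd _ M.+3 _ in R3.
have R4 := @runb_rmove M.+1 0 s3 isT; set s4 := upd _ M.+1 _ in R4.
have X1 : s1 0 = tenc (tlist iX l) by rewrite /s1; upd_at.
have X1b : s1 M.+1 = rev (tenc (iS st)) by rewrite /s1 /s0 catrevE; upd_at; rewrite ?E1 ?cats0.
have X2 : s2 M.+3 = rev (tenc (tlist iX l)).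
  by rewrite /s2 X1 catrevE; upd_at; rewrite /s1 /s0; upd_at; rewrite E3 cats0.
have X3 : s3 M.+1 = rev (tenc (iS st)) by rewrite /s3 /s2; upd_at.
have Y0 : s4 0 = tenc (iS st).
  rewrite /s4 X3; upd_at; rewrite catrevE revK /s3 /s2; upd_at; by rewrite cats0.
have YM : s4 M = tenc (tlist iX l).
  rewrite /s4 /s3 X2 catrevE revK /s2 /s1 /s0; upd_at; by rewrite E0 cats0.
have Hn : tlen (tlist iX l) <= tlen (Node (iS st) (tlist iX l)) by rewrite tlen_node; lia.
apply: runb_eq (runb_seq R0 (runb_seq (R1 _ _) (runb_seq R2 (runb_seq R3 (runb_seq R4
  (Hloop _ (Z (tlen (Node (iS st) (tlist iX l)))) _ _ _ Y0 YM _ Hn _)))))) _ _.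
- by [].
- by rewrite /s0; upd_at.
- move=> i ? ? ?; rewrite /s4 /s3 /s2 /s1 /s0; upd_at; by apply: Hi.
- move=> l1 l2 Hl; apply: leq_trans (HQ _ _) (leq_trans (HZ _) (mZ _ _ _)).
  rewrite Hl tlen_node tlen_cat; have := tlen_gt0 (tlist iX l2); lia.
- move=> k; rewrite /s4 /s3 /s2 /s1 /s0; upd_at.
- rewrite X1 X2 X3 !size_rev -!/(tlen _).
  set n := tlen (Node _ _); have := size_tlist iX l.
  have HnE : n = (tlen (iS st) + tlen (tlist iX l)).+1 by rewrite /n tlen_node.
  set w := W _ _ => Hsz.
  have : (size l).+2 * w.+1 <= n * w.+1 by rewrite leq_mul2r; lia.
  have : 0 < tlen (iS st) by apply: tlen_gt0.
  lia.
Qed.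

Definition ibool (b : bool) := if b then Node Leaf Leaf else Leaf.
Notation ibits := (tlist ibool).

(** A list cell holding [false] is encoded by the bits 10 and one holding [true] by 1100. Bits and
    cells are pushed in the opposite order, starting from the leaf that ends the list. *)
Definition to_bits :=
  Seq (rmove 0 1) (Seq (Push 0 false) (While 1 (If 1 (Pop 1)
    (Seq (Pop 1) (Seq (Push 0 false) (Push 0 true)))
    (Seq (Pop 1) (Seq (Push 0 false) (Seq (Push 0 false) (Seq (Push 0 true) (Push 0 true)))))))).

Lemma runb_to_bits s : s 1 = [::] ->
  runb to_bits s (20 * size (s 0) + 10) (upd s 0 (tenc (ibits (s 0)))).
Proof.
move=> H1; rewrite /to_bits; set c := While 1 _.
have HL u : forall s v, s 1 = u -> s 0 = tenc (ibits v) ->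
    runb c s (12 * size u + 1) (upd (upd s 0 (tenc (ibits (catrev u v)))) 1 [::]).
  elim: u => [|b u IH] s0 v E1 E0.
    by rewrite !upd_id //; apply: runb_while_nil.
  have Hb : runb (If 1 (Pop 1)
     (Seq (Pop 1) (Seq (Push 0 false) (Push 0 true)))
     (Seq (Pop 1) (Seq (Push 0 false) (Seq (Push 0 false) (Seq (Push 0 true) (Push 0 true)))))) s0 11
     (upd (upd s0 1 u) 0 (tenc (ibits (b :: v)))).
    apply: runb_weaken (runb_if (B := 10) _) _ => //; rewrite E1 /=; case: b E1 => E1.
      apply: runb_eq (runb_seq (runb_pop _ _) (runb_seq (runb_push _ _ _) (runb_seq (runb_push _ _ _)
        (runb_seq (runb_push _ _ _) (runb_push _ _ _))))) _ _ => //.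
      by move=> k; rewrite /upd /= E0 ?E1; upd_cases.
    apply: runb_eq (runb_seq (runb_pop _ _) (runb_seq (runb_push _ _ _) (runb_push _ _ _))) _ _ => //.
    by move=> k; rewrite /upd /= E0 ?E1; upd_cases.
  apply: runb_eq (runb_while_cons _ Hb (IH _ (b :: v) _ _)) _ _ => //.
  - by rewrite E1.
  - by state_eq.
  - by rewrite /=; lia.
apply: runb_eq (runb_seq (runb_rmove s _) (runb_seq (runb_push _ _ _) (HL (rev (s 0)) _ [::] _ _))) _ _ => //.
- by rewrite /upd /= catrevE H1 cats0.
- by move=> k; rewrite !catrevE ?revK ?cats0; upd_at.
- by rewrite size_rev; lia.
Qed.

Definition of_bits :=
  Seq (While 0 (If 0 (Pop 0) (Pop 0) (Seq (Pop 0) (If 0 (Pop 0) (Seq (Pop 0) (Push 1 false))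
        (Seq (Pop 0) (Seq (Pop 0) (Seq (Pop 0) (Push 1 true)))))))) (rmove 1 0).

Lemma runb_of_bits s w : s 0 = tenc (ibits w) -> s 1 = [::] ->
  runb of_bits s (20 * size w + 10) (upd s 0 w).
Proof.
rewrite /of_bits; set body := If _ _ _ _.
have HL : forall s, s 0 = tenc (ibits w) ->
    runb (While 0 body) s (12 * size w + 5) (upd (upd s 0 [::]) 1 (catrev w (s 1))).
  elim: w => [|b w IH] s0 E0.
    have Hb : runb body s0 2 (upd s0 0 [::]).
      by apply: runb_if; rewrite E0 /=; have := runb_pop 0 s0; rewrite E0.
    apply: runb_eq (runb_while_cons _ Hb (runb_while_nil _ _)) _ _ => //.
    - by rewrite E0.
    - by state_eq.
  have Hb : runb body s0 11 (upd (upd s0 0 (tenc (ibits w))) 1 (b :: s0 1)).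
    apply: runb_weaken (runb_if (B := 10) _) _ => //; rewrite E0 /=.
    case: b E0 => E0.
      apply: runb_eq (runb_seq (runb_pop _ _) (runb_if (B := 7) _)) _ _; last by [].
      rewrite E0 /upd /=; apply: runb_eq (runb_seq (runb_pop _ _)
        (runb_seq (runb_pop _ _) (runb_seq (runb_pop _ _) (runb_push _ _ _)))) _ _ => //.
      by state_eq.
    apply: runb_eq (runb_seq (runb_pop _ _) (runb_if (B := 7) _)) _ _; last by [].
    rewrite E0 /upd /=; apply: runb_eq (runb_seq (runb_pop _ _) (runb_push _ _ _)) _ _ => //.
    by state_eq.
  apply: runb_eq (runb_while_cons _ Hb (IH _ _)) _ _.
  - by rewrite E0.
  - by upd_at.
  - by state_eq.
  - by rewrite /=; lia.
move=> E0 E1; apply: runb_eq (runb_seq (HL s E0) (runb_rmove _ _)) _ _ => //.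
- by move=> k; rewrite E1 !catrevE; upd_at; rewrite ?cats0 ?revK ?cats0.
- by rewrite E1 /upd /= catrevE cats0 size_rev; lia.
Qed.

(** Turns an encoding into data of type [seq bool]; equality of encoded values will be decided by
    comparing these words. *)
Lemma pt_bits A (u : A -> tree) : pt u (fun a => ibits (tenc (u a))).
Proof.
exists to_bits, 2, (fun n => 20 * n + 10); split=> //; first by poly_tac.
by move=> a s Hs Hi; have := @runb_to_bits s (Hi 1 isT isT); rewrite Hs.
Qed.

(** * Simulation of a Turing machine by a stack program *)

Definition csym (l : seq symbol) : seq bool :=
  flatten (map (fun a => if a is Some b then [:: true; b] else [:: false; false]) l).

Definition push_sym r (a : symbol) :=
  if a is Some b then Seq (Push r b) (Push r true) else Seq (Push r false) (Push r false).

(** A register can only be inspected by branching, so the rest of the program is given as a function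
    of the popped symbol. An exhausted stack counts as blank tape. *)
Definition pop_sym r (k : symbol -> cmd) :=
  If r (k None) (Seq (Pop r) (Seq (Pop r) (k None)))
    (Seq (Pop r) (If r (Pop r) (Seq (Pop r) (k (Some false))) (Seq (Pop r) (k (Some true))))).

Lemma runb_push_sym r a s l : s r = csym l ->
  runb (push_sym r a) s 3 (upd s r (csym (a :: l))).
Proof.
move=> H; case: a => [b|]; apply: runb_eq (runb_seq (runb_push _ _ _) (runb_push _ _ _)) _ _ => //;
  by rewrite upd_same H; state_eq.
Qed.

Lemma runb_pop_sym r k s l B s' : s r = csym l ->
  runb (k (head None l)) (upd s r (csym (behead l))) B s' ->
  runb (pop_sym r k) s (B + 7) s'.
Proof.
case: l => [|[b|] l] H HB.
- rewrite /= upd_id // in HB; apply: runb_weaken (runb_if (B := B) _) _; last lia.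
  by rewrite H.
- apply: runb_weaken (runb_if (B := B + 5) _) _; last lia.
  rewrite H /=; have R := runb_pop r s; rewrite H /= in R.
  apply: runb_weaken (runb_seq R (runb_if (B := B + 2) _)) _; last lia.
  rewrite upd_same /=; have R2 := runb_pop r (upd s r (b :: csym l)).
  rewrite upd_same upd_upd /= in R2.
  by case: b {H R} HB R2 => HB R2; apply: runb_weaken (runb_seq R2 HB) _; lia.
- apply: runb_weaken (runb_if (B := B + 4) _) _; last lia.
  rewrite H /=; have R := runb_pop r s; rewrite H /= in R.
  have R2 := runb_pop r (upd s r (false :: csym l)); rewrite upd_same upd_upd /= in R2.
  by apply: runb_weaken (runb_seq R (runb_seq R2 HB)) _; lia.
Qed.

Fixpoint pushn r n :=
  if n is n'.+1 then Seq (Push r true) (pushn r n') else Push r true.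

Lemma runb_pushn r n s :
  runb (pushn r n) s (2 * n + 1) (upd s r (nseq n.+1 true ++ s r)).
Proof.
elim: n s => [|n IH] s; first exact: runb_push.
apply: runb_eq (runb_seq (runb_push _ _ _) (IH _)) _ _; last by lia.
rewrite upd_same -(cat1s true) catA (_ : nseq n.+1 true ++ [:: true] = nseq n.+2 true).
  by state_eq.
by rewrite -[X in _ ++ X]/(nseq 1 true) -nseqD addn1.
Qed.

Section Simulation.
Variable M : TM.
Notation Q := (tm_Q M).

(** Registers 1 and 2 hold the tape to the left of the head and from the head on. Register 3 holds
    the state in unary, one more than its index in [enum Q], so that an empty register 3 means that
    the machine has halted. *)
Definition sim_act (q : Q) : cmd :=
  pop_sym 2 (fun a => match tm_delta q a with
    | None => push_sym 2 a
    | Some (q', a', m) =>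
        Seq (match m with
             | MStay => push_sym 2 a'
             | MRight => push_sym 1 a'
             | MLeft => Seq (push_sym 2 a') (pop_sym 1 (fun b => push_sym 2 b))
             end) (pushn 3 (index q' (enum Q)))
    end).

(** Each entry consumes one tick of register 3; the entry at which the register runs empty is the
    current state. *)
Fixpoint dispatch (l : seq Q) : cmd :=
  if l is q :: l' then Seq (Pop 3) (If 3 (sim_act q) (dispatch l') (dispatch l')) else Pop 3.

Lemma runb_dispatch q l s B s' : q \in l -> s 3 = nseq (index q l).+1 true ->
  runb (sim_act q) (upd s 3 [::]) B s' -> runb (dispatch l) s (B + 4 * size l) s'.
Proof.
elim: l s => //= q0 l IH s; rewrite inE; have [->|Hq] := eqVneq q q0 => /=.
  move=> _ E H; have R := runb_pop 3 s; rewrite E /= in R.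
  apply: runb_weaken (runb_seq R (runb_if (B := B) _)) _; last by lia.
  by rewrite upd_same.
move=> Hl E H; have R := runb_pop 3 s; rewrite E /= in R.
apply: runb_weaken (runb_seq R (runb_if (B := B + 4 * size l) _)) _; last by lia.
by rewrite upd_same /=; apply: IH => //; rewrite upd_upd.
Qed.

Definition sim_loop := While 3 (dispatch (enum Q)).

Definition sim_state (s : state) (L R : seq symbol) (u : seq bool) : state :=
  upd (upd (upd s 1 (csym L)) 2 (csym R)) 3 u.

Definition sim_rel (L R : seq symbol) (T : int -> symbol) (z : int) :=
  (forall i : nat, nth None L i = T (z - 1 - i%:Z)%R) /\
  (forall i : nat, nth None R i = T (z + i%:Z)%R).

Definition sim_cost := 40 + 6 * size (enum Q).

Lemma runb_sim_act q L R T z s : sim_rel L R T z ->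
  exists L' R' u, [/\ sim_rel L' R' (if tm_delta q (T z) is Some (_, a, _) then set_cell T z a else T)
     (if tm_delta q (T z) is Some (_, _, m) then (z + dir m)%R else z),
    u = (if tm_delta q (T z) is Some (q', _, _) then nseq (index q' (enum Q)).+1 true else [::])
  & runb (sim_act q) (sim_state s L R [::]) (33 + 2 * size (enum Q)) (sim_state s L' R' u)].
Proof.
move=> [HL HR].
have Hhead : head None R = T z by have := HR 0; rewrite nth0 addr0.
have HR' i : nth None (behead R) i = T (z + 1 + i%:Z)%R.
  by rewrite nth_behead HR; congr T; lia.
have Rel : forall a m q', tm_delta q (T z) = Some (q', a, m) ->
  exists L' R', sim_rel L' R' (set_cell T z a) (z + dir m)%R /\
  runb (match m with
             | MStay => push_sym 2 a
             | MRight => push_sym 1 a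
             | MLeft => Seq (push_sym 2 a) (pop_sym 1 (fun b => push_sym 2 b))
             end) (sim_state s L (behead R) [::]) 20 (sim_state s L' R' [::]).
  move=> a [] q' _.
  - exists (behead L), (head None L :: a :: behead R); split; first split.
    + move=> i; rewrite nth_behead HL set_cellE ifF; last by rewrite /=; lia.
      by congr T; rewrite /=; lia.
    + case=> [|[|i]] /=; rewrite set_cellE.
      * rewrite ifF; last by lia.
        by have := HL 0; rewrite nth0 => ->; congr T; lia.
      * by rewrite ifT //; lia.
      * rewrite ifF; last by lia.
        by rewrite HR'; congr T; lia.
    + have R1 := @runb_push_sym 2 a (sim_state s L (behead R) [::]) (behead R) erefl.
      have R2 := @runb_push_sym 2 (head None L) (upd (upd (sim_state s L (behead R) [::]) 2 (csym (a :: behead R))) 1 (csym (behead L))) (a :: behead R) erefl.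
      apply: runb_eq (runb_seq R1 (runb_pop_sym _ R2)) _ _ => //.
      by rewrite /sim_state; state_eq.
  - exists (a :: L), (behead R); split; first split.
    + case=> [|i] /=; rewrite set_cellE; first by rewrite ifT //; lia.
      rewrite ifF; last by lia.
      by rewrite HL; congr T; lia.
    + move=> i; rewrite HR' set_cellE ifF //=; lia.
    + have R1 := @runb_push_sym 1 a (sim_state s L (behead R) [::]) L erefl.
      by apply: runb_eq R1 _ _ => //; rewrite /sim_state; state_eq.
  - exists L, (a :: behead R); split; first split.
    + move=> i; rewrite HL set_cellE addr0 ifF //; lia.
    + case=> [|i] /=; rewrite set_cellE !addr0 ?eqxx // ifF; last by lia.
      by rewrite HR'; congr T; lia.
    + have R1 := @runb_push_sym 2 a (sim_state s L (behead R) [::]) (behead R) erefl.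
      by apply: runb_eq R1 _ _ => //; rewrite /sim_state; state_eq.
have Pop2 k B s' : runb (k (T z)) (sim_state s L (behead R) [::]) B s' ->
    runb (pop_sym 2 k) (sim_state s L R [::]) (B + 7) s'.
  rewrite -Hhead => H; apply: (runb_pop_sym (l := R)) => //.
  by apply: runb_eq (_ : runb _ _ B s') _ _ => //; move: H; congr runb; rewrite /sim_state; state_eq.
case E: (tm_delta q (T z)) => [[[q' a] m]|].
- have [L' [R' [HT Hr]]] := Rel _ _ _ E.
  exists L', R', (nseq (index q' (enum Q)).+1 true); split=> //.
  have R3 := runb_pushn 3 (index q' (enum Q)) (sim_state s L' R' [::]).
  apply: runb_weaken (Pop2 _ (20 + (2 * size (enum Q) + 1)).+1 _ _) _; last by lia.
  rewrite E; apply: runb_eq (runb_seq Hr R3) _ _.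
    by rewrite /sim_state upd_same cats0; state_eq.
  have : index q' (enum Q) <= size (enum Q) by apply: index_size.
  lia.
- exists L, (T z :: behead R), [::]; split=> //.
    split=> // -[|i] /=; rewrite ?addr0 // HR'; congr T; lia.
  apply: runb_weaken (Pop2 _ 3 _ _) _; last by lia.
  rewrite E.
  have R1 := @runb_push_sym 2 (T z) (sim_state s L (behead R) [::]) (behead R) erefl.
  by apply: runb_eq R1 _ _ => //; rewrite /sim_state; state_eq.
Qed.

Lemma runb_sim_loop t q T z q' T' z' L R s :
  aexec t (q, T, z) = Some (q', T', z') -> tm_delta q' (T' z') = None -> sim_rel L R T z ->
  exists L' R', sim_rel L' R' T' z' /\
    runb sim_loop (sim_state s L R (nseq (index q (enum Q)).+1 true))
      (t.+1 * sim_cost) (sim_state s L' R' [::]).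
Proof.
have Hd L0 R0 q0 B s' : runb (sim_act q0) (sim_state s L0 R0 [::]) B s' ->
    runb (dispatch (enum Q)) (sim_state s L0 R0 (nseq (index q0 (enum Q)).+1 true))
     (B + 4 * size (enum Q)) s'.
  move=> H; apply: (@runb_dispatch q0); rewrite ?mem_enum //.
  by move: H; congr runb; rewrite /sim_state upd_upd.
elim: t q T z L R => [|t IH] q T z L R He Hn Hrel; have [L1 [R1 [u []]]] := runb_sim_act q s Hrel.
  case: He => E1 E2 E3; subst q' T' z'; rewrite Hn => Hr -> /Hd Hb; exists L1, R1; split=> //.
  apply: runb_weaken (runb_while_cons _ Hb (runb_while_nil _ _)) _ => //.
  by rewrite /sim_cost; lia.
move: He => /=; case: (tm_delta q (T z)) => // -[[q1 a] m] He Hr -> /Hd Hb.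
have [L' [R' [Hr' Hb']]] := IH _ _ _ _ _ He Hn Hr.
exists L', R'; split=> //.
apply: runb_weaken (runb_while_cons _ Hb Hb') _ => //.
by rewrite [t.+2 * _]mulSn /sim_cost; move: (size (enum Q)) => w; lia.
Qed.

Definition sim_init := Seq (rmove 0 4) (Seq
  (While 4 (If 4 (Pop 4) (Seq (Pop 4) (push_sym 2 (Some false))) (Seq (Pop 4) (push_sym 2 (Some true)))))
  (pushn 3 (index (tm_start M) (enum Q)))).

Lemma runb_sim_init x :
  runb sim_init (init_state x) (14 * size x + 2 * size (enum Q) + 10)
    (sim_state (fun=> [::]) [::] (map Some x) (nseq (index (tm_start M) (enum Q)).+1 true)).
Proof.
rewrite /sim_init; set c := While 4 _.
have HL u : forall s (v : seq bool), s 4 = u -> s 2 = csym (map Some v) ->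
    runb c s (7 * size u + 1) (upd (upd s 2 (csym (map Some (catrev u v)))) 4 [::]).
  elim: u => [|b u IH] s v E4 E2; first by rewrite !upd_id //; apply: runb_while_nil.
  have Hb : runb (If 4 (Pop 4) (Seq (Pop 4) (push_sym 2 (Some false))) (Seq (Pop 4) (push_sym 2 (Some true)))) s 6
      (upd (upd s 4 u) 2 (csym (map Some (b :: v)))).
    apply: runb_if; rewrite E4 /=.
    have R1 := runb_pop 4 s; rewrite E4 /= in R1.
    have R2 := @runb_push_sym 2 (Some b) (upd s 4 u) (map Some v) E2.
    by case: b {IH E4} R1 R2 => R1 R2; exact: runb_seq R1 R2.
  apply: runb_eq (runb_while_cons _ Hb (IH _ (b :: v) _ _)) _ _ => //.
  - by rewrite E4.
  - by state_eq.
  - by rewrite /=; lia.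
apply: runb_eq (runb_seq (runb_rmove (init_state x) _) (runb_seq (HL (rev x) _ [::] _ _) (runb_pushn 3 _ _))) _ _ => //.
- by move=> k; rewrite /sim_state /init_state !catrevE revK cats0 /upd /= ?cats0; upd_cases.
- rewrite size_rev /init_state upd_same; have : index (tm_start M) (enum Q) <= size (enum Q) by apply: index_size.
  lia.
Qed.

(** Register 5 is a flag: [While] tests only for emptiness, but the loop must stop at the first
    blank rather than at the end of the stack. The working registers are cleared because the
    programs that follow expect them empty. *)
Definition sim_out := Seq (Push 5 true) (Seq
  (While 5 (pop_sym 2 (fun a => if a is Some b then Push 4 b else Pop 5)))
  (Seq (rclear 1) (Seq (rclear 2) (rmove 4 0)))).

Lemma out_bits_ext s1 s2 : (forall i, nth None s1 i = nth None s2 i) -> out_bits s1 = out_bits s2.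
Proof.
elim: s1 s2 => [|a s1 IH] [|b s2] H //=.
- by have := H 0 => /= <-.
- by have := H 0 => /= ->.
- have := H 0 => /= ->; case: b {H} (fun i => H i.+1) => //= b H.
  by rewrite (IH s2).
Qed.

Lemma out_bits_size s : size (out_bits s) <= size s.
Proof. by elim: s => [|[b|] s IH]. Qed.

Lemma size_csym l : size (csym l) = 2 * size l.
Proof. by elim: l => // -[b|] l; rewrite /csym /= -/(csym l) => ->; lia. Qed.

Lemma runb_sim_out L R :
  runb sim_out (sim_state (fun=> [::]) L R [::]) (30 * size R + 4 * size L + 30) (init_state (out_bits R)).
Proof.
rewrite /sim_out; set c := While 5 _.
have HL : forall s, s 2 = csym R -> s 5 = [:: true] -> exists R',
    size R' <= size R /\
    runb c s (9 * size R + 11) (upd (upd (upd s 4 (catrev (out_bits R) (s 4))) 2 (csym R')) 5 [::]).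
  have Hend R0 s : s 2 = csym R0 -> s 5 = [:: true] -> head None R0 = None ->
      runb c s 11 (upd (upd s 2 (csym (behead R0))) 5 [::]).
    move=> E2 E5 Hh.
    have Hb : runb (pop_sym 2 (fun a : symbol => if a is Some b then Push 4 b else Pop 5)) s 8
       (upd (upd s 2 (csym (behead R0))) 5 [::]).
      apply: (runb_pop_sym (l := R0) (B := 1)) => //; rewrite Hh.
      by have := runb_pop 5 (upd s 2 (csym (behead R0))); rewrite upd_neq // E5.
    apply: runb_weaken (runb_while_cons _ Hb (runb_while_nil _ _)) _ => //.
    by rewrite E5.
  elim: R => [|[b|] R IH] s E2 E5.
  - exists [::]; split=> //; apply: runb_eq (Hend [::] s E2 E5 erefl) _ _ => //.
    by state_eq.
  - have Hb : runb (pop_sym 2 (fun a : symbol => if a is Some b then Push 4 b else Pop 5)) s 8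
       (upd (upd s 2 (csym R)) 4 (b :: s 4)).
      by apply: (runb_pop_sym (l := Some b :: R) (B := 1)) => //; apply: runb_push.
    have [||R' [HR' H]] := IH (upd (upd s 2 (csym R)) 4 (b :: s 4)); first by [].
      by rewrite /upd.
    exists R'; split; first by rewrite /=; lia.
    apply: runb_eq (runb_while_cons _ Hb H) _ _.
    + by rewrite E5.
    + by state_eq.
    + by rewrite /=; lia.
  - exists R; split=> //; apply: runb_eq (Hend (None :: R) s E2 E5 erefl) _ _ => //=.
      by state_eq.
    by lia.
have [||R' [HR' H]] := HL (upd (sim_state (fun=> [::]) L R [::]) 5 [:: true]); [by []|by []|].
have R1 := runb_push 5 true (sim_state (fun=> [::]) L R [::]).
apply: runb_eq (runb_seq R1 (runb_seq H (runb_seq (runb_rclear 1 _) (runb_seq (runb_rclear 2 _) (runb_rmove _ _))))) _ _ => //.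
- by move=> k; rewrite /sim_state /init_state /upd /= !catrevE !cats0 ?revK; upd_cases.
- rewrite /sim_state /upd /= !size_csym catrevE cats0 size_rev; have := out_bits_size R; lia.
Qed.

End Simulation.

Lemma runb_size c s B s' r : runb c s B s' -> size (s' r) <= size (s r) + B.
Proof. by move=> [t Ht /run_size H]; have := H r; lia. Qed.

Definition sim (M : TM) := Seq (sim_init M) (Seq (sim_loop M) sim_out).

Lemma runb_sim M : exists K, forall x t y, halts_with M x t y ->
  runb (sim M) (init_state x) (K * (size x + t).+1) (init_state y).
Proof.
exists (200 * sim_cost M + 400) => x t y /halts_with_aexec[q [T [z [He Hd [R0 Hy HR0]]]]].
have H0 : sim_rel [::] (map Some x) (text x) 0%R.
  split=> i; last by rewrite add0r textE.
  by rewrite nth_nil text_neg //; lia.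
have [L [R [HR Hl]]] := runb_sim_loop (fun=> [::]) He Hd H0.
have Ey : out_bits R = y.
  rewrite Hy; apply: out_bits_ext => -[|i]; rewrite HR.2 ?addr0 //=.
  by rewrite HR0; congr T; lia.
have Hi := runb_sim_init M x.
have Ho := runb_sim_out L R; rewrite Ey in Ho.
have S1 := runb_size 1 Hl; have S2 := runb_size 2 Hl.
rewrite /sim_state /upd /= !size_csym size_map in S1 S2.
apply: runb_weaken (runb_seq Hi (runb_seq Hl Ho)) _.
have : size (enum (tm_Q M)) <= sim_cost M by rewrite /sim_cost; lia.
have : sim_cost M <= (size x + t).+1 * sim_cost M by rewrite leq_pmull.
have : t.+1 * sim_cost M <= (size x + t).+1 * sim_cost M by rewrite leq_mul2r; lia.
set v := (size x + t).+1; have -> : (200 * sim_cost M + 400) * v = 200 * (v * sim_cost M) + 400 * v by lia.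
have : size x < v by rewrite /v; lia.
lia.
Qed.

Lemma tlen_ibits w : size w < tlen (ibits w) <= 4 * size w + 1.
Proof.
elim: w => // b w /andP[IH1 IH2]; rewrite tlen_cons.
by case: b; rewrite /= ?tlen_node /tlen /= in IH1 IH2 *; lia.
Qed.

(* The machine is simulated on stacks, so that the junk it leaves on its tape does no harm. *)
Lemma machine_comp (M : TM) (g : seq bool -> seq bool) :
  pt ibits (fun x => ibits (g x)) -> exists (N : TM) P,
  [/\ polyb P, {homo P : m n / m <= n} & forall x t y, halts_with M x t y ->
     exists2 n, n <= P (size x + t) & halts_with N x n (g y)].
Proof.
move=> /pt_elim[c [m [P0 [S0 [[pP Hm b] H pS mP [mS HS]]]]]].
have [K HK] := runb_sim M.
have [N [K2 HN]] := machine_of_cmd (Seq (sim M) (Seq to_bits (Seq c of_bits))).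
pose Z n := 4 * (n + K * n.+1) + 1.
pose P1 n := K * n.+1 + 20 * Z n + P0 (Z n) + 20 * S0 (Z n) + 30.
have pZ : polyb Z by rewrite /Z; poly_tac.
have pP1 : polyb P1 by rewrite /P1; poly_tac.
have pP2 : polyb (fun n => K2 * (n + P1 n).+1 ^ 2).
  by apply: poly_mul (poly_const _) (poly_exp _ _); poly_tac.
have [P [pPP mPP HP]] := poly_major pP2.
exists N, P; split=> // x t y Hx.
have R1 := HK _ _ _ Hx.
have Hy := runb_size 0 R1; rewrite /init_state !upd_same in Hy.
have R2 := @runb_to_bits (init_state y) erefl.
rewrite [X in runb _ _ _ X](_ : _ = init_state (tenc (ibits y))) in R2; last by rewrite /init_state; state_eq.
have R3 : runb c (init_state (tenc (ibits y))) (P0 (tlen (ibits y))) (init_state (tenc (ibits (g y)))).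
  apply: runb_eq (H y _ erefl _) _ _ => //; last by rewrite /init_state; state_eq.
  by case.
have R4 := @runb_of_bits (init_state (tenc (ibits (g y)))) (g y) erefl erefl.
have [u Hu Hrun] := runb_seq R1 (runb_seq R2 (runb_seq R3 R4)).
have [n Hn HH] := HN _ _ _ Hrun.
exists n; last by move: HH; rewrite upd_same.
apply: leq_trans Hn (leq_trans _ (HP _)).
rewrite leq_mul2l leq_exp ?orbT // ltnS; set v := size x + t.
have Lx : size x <= v by rewrite leq_addr.
have /andP[Ly1 Ly2] := tlen_ibits y; have /andP[Lg1 _] := tlen_ibits (g y).
have LZ : tlen (ibits y) <= Z v by rewrite /Z; lia.
have LP := mP _ _ LZ; have LS := leq_trans (HS y) (mS _ _ LZ).
rewrite /init_state !upd_same in Hu.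
apply: leq_add => //; apply: leq_trans Hu _; rewrite /P1 -/v; lia.
Qed.

(** * Polynomial-time functions between encodable types *)

Class encodable (T : Type) := Encodable { inj : T -> tree; inj_inj : injective inj }.

Notation len a := (tlen (inj a)).

(** Unary, so only numbers that are polynomially bounded may be computed with; the binary numerals
    of an instance stay words of type [seq bool]. *)
Fixpoint inat n := if n is n'.+1 then Node Leaf (inat n') else Leaf.

Lemma inat_inj : injective inat.
Proof. by elim=> [|m IH] [|n] //= [/IH ->]. Qed.

Lemma ibool_inj : injective ibool. Proof. by case=> [] []. Qed.

Lemma tlist_inj X (i : X -> tree) : injective i -> injective (tlist i).
Proof. by move=> Hi; elim=> [|x s IH] [|y t] //= [/Hi -> /IH ->]. Qed.

Definition ipair A B (i : A -> tree) (j : B -> tree) (p : A * B) := Node (i p.1) (j p.2).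

Lemma ipair_inj A B (i : A -> tree) (j : B -> tree) :
  injective i -> injective j -> injective (ipair i j).
Proof. by move=> Hi Hj [a b] [c d] [/Hi -> /Hj ->]. Qed.

Instance encodable_bool : encodable bool := Encodable ibool_inj.
Instance encodable_nat : encodable nat := Encodable inat_inj.
Instance encodable_seq X (e : encodable X) : encodable (seq X) := Encodable (tlist_inj inj_inj).
Instance encodable_prod A B (a : encodable A) (b : encodable B) : encodable (A * B) :=
  Encodable (ipair_inj inj_inj inj_inj).

Definition good A B (a : encodable A) (b : encodable B) (f : A -> B) :=
  pt (fun x : A => inj x) (fun x => inj (f x)).
Arguments good {A B a b} f.

Lemma pt_ext A (u v w : A -> tree) : pt u v -> v =1 w -> pt u w.
Proof. by move=> H /functional_extensionality <-. Qed.

Lemma pt_reindex A B (h : B -> A) (u v : A -> tree) : pt u v -> pt (fun b => u (h b)) (fun b => v (h b)).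
Proof. by move=> [c [m [P [H1 H2 H3 H4]]]]; exists c, m, P; split=> // b; apply: H4. Qed.

Section Library.
Context {E A B : Type} {eE : encodable E} {eA : encodable A} {eB : encodable B}.

Lemma good_ext (f g : E -> A) : good f -> f =1 g -> good g.
Proof. by move=> H /functional_extensionality <-. Qed.

Lemma good_id : good (fun e : E => e).
Proof. exact: pt_id. Qed.

Lemma good_comp (g : A -> B) (f : E -> A) : good g -> good f -> good (fun e => g (f e)).
Proof. by move=> Hg Hf; apply: pt_comp Hf (pt_reindex f Hg). Qed.

Lemma pt_const (u : E -> tree) t : pt u (fun=> t).
Proof. by elim: t => [|a IHa b IHb]; [apply: pt_leaf | apply: pt_cons]. Qed.

Lemma good_const (c : A) : good (fun e : E => c).
Proof. exact: pt_const. Qed.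

Lemma good_pair (f : E -> A) (g : E -> B) : good f -> good g -> good (fun e => (f e, g e)).
Proof. exact: pt_cons. Qed.

Lemma good_fst (f : E -> A * B) : good f -> good (fun e => (f e).1).
Proof. exact: pt_thd. Qed.

Lemma good_snd (f : E -> A * B) : good f -> good (fun e => (f e).2).
Proof. exact: pt_ttl. Qed.

Lemma good_if (b : E -> bool) (f g : E -> A) : good b -> good f -> good g ->
  good (fun e => if b e then f e else g e).
Proof.
move=> Hb Hf Hg; apply: pt_ext (pt_if Hb Hg Hf) _ => e.
by rewrite /= /ibool; case: (b e).
Qed.

Lemma good_cons (x : E -> A) (l : E -> seq A) : good x -> good l -> good (fun e => x e :: l e).
Proof. exact: pt_cons. Qed.

Lemma good_nilp (l : E -> seq A) : good l -> good (fun e => nilp (l e)).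
Proof.
move=> Hl; apply: pt_ext (pt_if Hl (pt_const _ (ibool true)) (pt_const _ (ibool false))) _ => e.
by rewrite /=; case: (l e).
Qed.

Lemma good_head x0 (l : E -> seq A) : good l -> good (fun e => head x0 (l e)).
Proof.
move=> Hl; apply: pt_ext (pt_if Hl (pt_const _ (inj x0)) (pt_thd Hl)) _ => e.
by rewrite /=; case: (l e).
Qed.

Lemma good_behead (l : E -> seq A) : good l -> good (fun e => behead (l e)).
Proof.
move=> Hl; apply: pt_ext (pt_ttl Hl) _ => e.
by rewrite /=; case: (l e).
Qed.

Lemma good_succ (f : E -> nat) : good f -> good (fun e => (f e).+1).
Proof. by move=> Hf; apply: pt_cons (pt_leaf _) Hf. Qed.

Lemma good_pred (f : E -> nat) : good f -> good (fun e => (f e).-1).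
Proof.
move=> Hf; apply: pt_ext (pt_ttl Hf) _ => e.
by rewrite /=; case: (f e).
Qed.

Lemma good_eq0 (f : E -> nat) : good f -> good (fun e => f e == 0).
Proof.
move=> Hl; apply: pt_ext (pt_if Hl (pt_const _ (ibool true)) (pt_const _ (ibool false))) _ => e.
by rewrite /=; case: (f e).
Qed.

Lemma good_ticks (f : E -> nat) : good f -> good (fun e => nseq (f e) false).
Proof.
by move=> Hf; apply: pt_ext Hf _ => e; rewrite /=; elim: (f e) => //= n ->.
Qed.

Lemma len_pair (a : A) (b : B) : len (a, b) = (len a + len b).+1.
Proof. exact: tlen_node. Qed.

Lemma len_cons (a : A) (l : seq A) : len (a :: l) = (len a + len l).+1.
Proof. exact: tlen_node. Qed.

Lemma len_gt0 (a : A) : 0 < len a.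
Proof. exact: tlen_gt0. Qed.

End Library.

Lemma len_nil A (eA : encodable A) : len ([::] : seq A) = 1. Proof. by []. Qed.
Lemma len_succ n : len n.+1 = (len n).+2. Proof. by rewrite /= tlen_node. Qed.
Lemma len_nat n : len n = (2 * n).+1.
Proof. by elim: n => // n; rewrite len_succ; lia. Qed.
Lemma len_bool (b : bool) : len b <= 3. Proof. by case: b. Qed.

Lemma len_cat A (eA : encodable A) (l1 l2 : seq A) : len (l1 ++ l2) = (len l1 + len l2).-1.
Proof. exact: tlen_cat. Qed.

(** * Folds of bounded growth and the functions built from them *)

Lemma good_foldl E S X (eE : encodable E) (eS : encodable S) (eX : encodable X)
    (f : E -> S -> X -> S) (s0 : E -> S) (l : E -> seq X) Q :
  good (fun p : E * S * X => f p.1.1 p.1.2 p.2) -> good s0 -> good l -> polyb Q ->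
  (forall e s l, len (foldl (f e) s l) <= Q (len e + len s + len l)) ->
  good (fun e => foldl (f e) (s0 e) (l e)).
Proof.
move=> Hf Hs Hl pQ HQ.
(* The environment travels along in the accumulator, because [pt_foldl] iterates a function without
   parameters. *)
pose f' (p : E * S) (x : X) := (p.1, f p.1 p.2 x).
have Ef e s k : foldl f' (e, s) k = (e, foldl (f e) s k) by elim: k s => //= x k IH s; rewrite IH.
have Hf' : pt (fun p : (E * S) * X => Node (inj p.1) (inj p.2)) (fun p => inj (f' p.1 p.2)).
  apply: pt_cons Hf.
  exact: (good_fst (good_fst (good_id (E := (E * S) * X)))).
pose Q' n := (n + Q n).+1.
have pQ' : polyb Q' by rewrite /Q'; poly_tac.
have [Q2 [pQ2 mQ2 HQ2]] := poly_major pQ'.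
have HF (p : E * S) k : len (foldl f' p k) <= Q2 (len p + len k).
  case: p => e s; rewrite Ef !len_pair.
  apply: leq_trans (_ : Q' (len e + len s + len k) <= _).
    by rewrite /Q'; have := HQ e s k; have := len_gt0 k; lia.
  by apply: leq_trans (HQ2 _) (mQ2 _ _ _); lia.
have H1 : pt (fun e : E => inj e) (fun e => Node (Node (inj e) (inj (s0 e))) (inj (l e))).
  by apply: pt_cons Hl; apply: pt_cons Hs; apply: pt_id.
have H2 := pt_reindex (fun e => ((e, s0 e), l e)) (pt_foldl Hf' pQ2 HF).
apply: pt_ext (pt_ttl (pt_comp H1 H2)) _ => e.
by rewrite /= Ef.
Qed.

(** If what a round adds is bounded independently of the accumulator, the additions sum up to a
    polynomial; an accumulator that doubles in each round would not be allowed. *)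
Lemma good_foldl_add E S X (eE : encodable E) (eS : encodable S) (eX : encodable X)
    (f : E -> S -> X -> S) (s0 : E -> S) (l : E -> seq X) Q :
  good (fun p : E * S * X => f p.1.1 p.1.2 p.2) -> good s0 -> good l -> polyb Q ->
  (forall e s x, len (f e s x) <= len s + Q (len e + len x)) ->
  good (fun e => foldl (f e) (s0 e) (l e)).
Proof.
move=> Hf Hs Hl pQ HQ; have [Q2 [pQ2 mQ2 HQ2]] := poly_major pQ.
apply: (good_foldl (Q := fun n => n + n * Q2 n)) => //; first by poly_tac.
move=> e s k; have : forall n, len e + len k <= n -> len (foldl (f e) s k) <= len s + len k * Q2 n.
  elim: k s => [|x k IH] s n Hn; first by rewrite /=; lia.
  rewrite [foldl _ _ _]/=; apply: leq_trans (IH _ n _) _; first by rewrite len_cons in Hn; lia.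
  have H1 := HQ e s x; have : Q (len e + len x) <= Q2 n.
    by apply: leq_trans (HQ2 _) (mQ2 _ _ _); rewrite len_cons in Hn; lia.
  rewrite len_cons mulSn mulnDl; lia.
move=> /(_ (len e + len s + len k)) H; apply: leq_trans (H _) _; first by lia.
by rewrite leq_add ?leq_mul //; lia.
Qed.

Ltac add_poly P := eapply (good_foldl_add (Q := P)); [ | | | poly_tac | ].
Ltac var := repeat first [exact: good_id | apply: good_fst | apply: good_snd].

Lemma good_rev E A (eE : encodable E) (eA : encodable A) (l : E -> seq A) : good l -> good (fun e => rev (l e)).
Proof.
move=> Hl; apply: good_ext (_ : good (fun e => foldl (fun s x => x :: s) [::] (l e))) _; last first.
  move=> e; rewrite /rev; elim: (l e) [::] => //= x k IH s; exact: IH.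
add_poly (fun n => n.+1).
- by apply: good_cons; var.
- exact: good_const.
- by [].
- by move=> e s x; rewrite len_cons; lia.
Qed.

Lemma good_cat E A (eE : encodable E) (eA : encodable A) (l1 l2 : E -> seq A) : good l1 -> good l2 -> good (fun e => l1 e ++ l2 e).
Proof.
move=> H1 H2; apply: good_ext (_ : good (fun e => foldl (fun s x => x :: s) (l2 e) (rev (l1 e)))) _.
  add_poly (fun n => n.+1) => //.
  - by apply: good_cons; var.
  - exact: good_rev.
  - by move=> e s x; rewrite len_cons; lia.
by move=> e; rewrite foldl_rev; elim: (l1 e) => //= x k ->.
Qed.

Lemma good_map E A B (eE : encodable E) (eA : encodable A) (eB : encodable B) (h : E -> A -> B) (l : E -> seq A) :
  good (fun p : E * A => h p.1 p.2) -> good l -> good (fun e => map (h e) (l e)).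
Proof.
move=> Hh Hl.
apply: good_ext (_ : good (fun e => rev (foldl (fun s x => h e x :: s) [::] (l e)))) _; last first.
  by move=> e; rewrite -{1}[l e]revK foldl_rev -[RHS]revK -map_rev; congr rev;
    elim: (rev (l e)) => //= x k ->.
apply: good_rev; have /pt_elim[c0 [m0 [P0 [S [_ _ pS _ [_ HS]]]]]] := Hh.
add_poly (fun n => (S n.+1).+1) => //.
- apply: good_cons; last by var.
  apply: (good_comp (g := fun p : E * A => h p.1 p.2) (f := fun p : E * seq B * A => (p.1.1, p.2))) => //.
  by apply: good_pair; var.
- exact: good_const.
- by move=> e s x; have := HS (e, x); rewrite len_pair len_cons /=; lia.
Qed.

Lemma good_filter E A (eE : encodable E) (eA : encodable A) (h : E -> A -> bool) (l : E -> seq A) :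
  good (fun p : E * A => h p.1 p.2) -> good l -> good (fun e => filter (h e) (l e)).
Proof.
move=> Hh Hl.
apply: good_ext (_ : good (fun e => rev (foldl (fun s x => if h e x then x :: s else s) [::] (l e)))) _; last first.
  by move=> e; rewrite -{1}[l e]revK foldl_rev -[RHS]revK -filter_rev; congr rev;
    elim: (rev (l e)) => //= x k ->.
apply: good_rev; add_poly (fun n => n.+1) => //.
- apply: good_if; try (apply: good_cons); var.
  apply: (good_comp (g := fun p : E * A => h p.1 p.2) (f := fun p : E * seq A * A => (p.1.1, p.2))) => //.
  by apply: good_pair; var.
- exact: good_const.
- by move=> e s x; case: ifP => _; rewrite ?len_cons; lia.
Qed.

Lemma good_flatten E A (eE : encodable E) (eA : encodable A) (l : E -> seq (seq A)) : good l -> good (fun e => flatten (l e)).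
Proof.
move=> Hl; apply: good_ext (_ : good (fun e => foldl (fun s x => s ++ x) [::] (l e))) _; last first.
  move=> e; rewrite -[RHS]cat0s; elim: (l e) [::] => [|x k IH] s /=; first by rewrite cats0.
  by rewrite IH catA.
add_poly (fun n : nat => n) => //.
- by apply: good_cat; var.
- exact: good_const.
- by move=> e s x; rewrite len_cat; lia.
Qed.

Lemma good_size E A (eE : encodable E) (eA : encodable A) (l : E -> seq A) : good l -> good (fun e => size (l e)).
Proof.
move=> Hl; apply: good_ext (_ : good (fun e => foldl (fun s _ => s.+1) 0 (l e))) _; last first.
  by move=> e; rewrite -[RHS]add0n; elim: (l e) 0 => [|x k IH] s /=; rewrite ?addn0 // IH addSnnS.
add_poly (fun n => n + 2) => //.
- by apply: good_succ; var.
- exact: good_const.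
- by move=> e s x; rewrite len_succ; lia.
Qed.

Lemma good_negb E (eE : encodable E) (b : E -> bool) : good b -> good (fun e => ~~ b e).
Proof. by move=> H; apply: (good_if H); apply: good_const. Qed.

Lemma good_andb E (eE : encodable E) (b c : E -> bool) : good b -> good c -> good (fun e => b e && c e).
Proof. by move=> H1 H2; apply: (good_if H1) => //; apply: good_const. Qed.

Lemma good_orb E (eE : encodable E) (b c : E -> bool) : good b -> good c -> good (fun e => b e || c e).
Proof. by move=> H1 H2; apply: (good_if H1) => //; apply: good_const. Qed.

Lemma good_has E A (eE : encodable E) (eA : encodable A) (h : E -> A -> bool) (l : E -> seq A) :
  good (fun p : E * A => h p.1 p.2) -> good l -> good (fun e => has (h e) (l e)).
Proof.
move=> Hh Hl; apply: good_ext (good_negb (good_nilp (good_filter Hh Hl))) _ => e.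
by rewrite /nilp size_filter -lt0n -has_count.
Qed.

Lemma good_all E A (eE : encodable E) (eA : encodable A) (h : E -> A -> bool) (l : E -> seq A) :
  good (fun p : E * A => h p.1 p.2) -> good l -> good (fun e => all (h e) (l e)).
Proof.
move=> Hh Hl; apply: good_ext (good_negb (good_has (good_negb Hh) Hl)) _ => e.
by rewrite /= -all_predC; apply: eq_all => x; apply: negbK.
Qed.

Lemma good_last E A (eE : encodable E) (eA : encodable A) (x0 : A) (l : E -> seq A) : good l -> good (fun e => last x0 (l e)).
Proof.
move=> Hl; apply: good_ext (_ : good (fun e => foldl (fun _ x => x) x0 (l e))) _; last first.
  by move=> e; elim: (l e) x0 => //= x k ->.
add_poly (fun n : nat => n) => //.
- by var.
- exact: good_const.
- by move=> e s x; lia.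
Qed.

Lemma good_eqb E (eE : encodable E) (b c : E -> bool) : good b -> good c -> good (fun e => b e == c e).
Proof.
move=> H1 H2; apply: good_ext (good_if H1 H2 (good_negb H2)) _ => e.
by case: (b e) (c e) => [] [].
Qed.

Lemma good_eq_bits E (eE : encodable E) (u v : E -> seq bool) :
  good u -> good v -> good (fun e => u e == v e).
Proof.
move=> Hu Hv.
pose f (_ : E) (st : bool * seq bool) (b : bool) :=
  (st.1 && (~~ nilp st.2 && (b == head true st.2)), behead st.2).
apply: good_ext (_ : good (fun e => (foldl (f e) (true, v e) (u e)).1 &&
   nilp (foldl (f e) (true, v e) (u e)).2)) _.
  have H : good (fun e => foldl (f e) (true, v e) (u e)).
    eapply (good_foldl_add (Q := fun _ => 3)) => //; last first.
    - move=> e st x; have -> : len st = (len st.1 + len st.2).+1 by case: st => *; exact: len_pair.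
      rewrite /f len_pair; set b' := st.1 && _; have := len_bool b'; have := len_gt0 st.1.
      by case: (st.2) => [|y s]; rewrite /behead ?len_cons; lia.
    - by poly_tac.
    - by apply: good_pair => //; apply: good_const.
    - rewrite /f; apply: good_pair; last by apply: good_behead; do ![apply: good_fst|apply: good_snd|exact: good_id].
      apply: good_andb; first by do ![apply: good_fst|apply: good_snd|exact: good_id].
      apply: good_andb; first by apply: good_negb; apply: good_nilp; do ![apply: good_fst|apply: good_snd|exact: good_id].
      by apply: good_eqb; first [apply: good_head|idtac]; do ![apply: good_fst|apply: good_snd|exact: good_id].
  by apply: good_andb; [apply: good_fst | apply: good_nilp; apply: good_snd].
move=> e; have Hf k s : (foldl (f e) (false, s) k).1 = false.
  by elim: k s => //= x k IH s; rewrite IH.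
elim: (u e) (v e) => [|a x IH] [|b y] //=; rewrite /f /= -/(f e).
- by rewrite Hf.
- have [<-|Hab] := eqVneq a b; first by rewrite IH eqseq_cons eqxx.
  by rewrite Hf eqseq_cons (negbTE Hab).
Qed.

(** Values of any encodable type are compared through the words that encode them: [inj] is injective
    and [tenc] is a prefix code. *)
Lemma good_eq E (eE : encodable E) (T : eqType) (eT : encodable T) (u v : E -> T) :
  good u -> good v -> good (fun e => u e == v e).
Proof.
have H w : good w -> good (fun e : E => tenc (inj (w e) : tree)).
  by move=> Hw; apply: pt_comp Hw (pt_bits _).
move=> /H Hu /H Hv; apply: good_ext (good_eq_bits Hu Hv) _ => e.
apply/eqP/eqP => [|-> //] He; apply: inj_inj.
have tenc_inj : forall a b s t, tenc a ++ s = tenc b ++ t -> a = b /\ s = t.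
  elim=> [|a IHa b IHb] [|c d] s t //=; first by case.
  case; rewrite -!catA => /IHa[-> /IHb[-> ->]]; by [].
by apply: (proj1 (tenc_inj _ _ [::] [::] _)); rewrite !cats0.
Qed.

(** A hook of [good_step], redefined below whenever further functions have been shown to be
    computable. *)
Ltac good_user := fail.

Ltac good_step :=
  cbv beta;
  lazymatch goal with
  | |- good (fun _ => ?c) => exact: good_const
  | |- good (fun e => e) => exact: good_id
  | |- good (@fst _ _) => exact: (good_fst good_id)
  | |- good (@snd _ _) => exact: (good_snd good_id)
  | |- good S => exact: (good_succ good_id)
  | |- good (fun e => ((@?w1 e), (@?w2 e))) => apply: good_pair
  | |- good (fun e => fst (@?w1 e)) => apply: good_fst
  | |- good (fun e => snd (@?w1 e)) => apply: good_snd
  | |- good (fun e => (@?w1 e) :: (@?w2 e)) => apply: good_cons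
  | |- good (fun e => rev (@?w1 e)) => apply: good_rev
  | |- good (fun e => (@?w1 e) ++ (@?w2 e)) => apply: good_cat
  | |- good (fun e => flatten (@?w1 e)) => apply: good_flatten
  | |- good (fun e => size (@?w1 e)) => apply: good_size
  | |- good (fun e => ~~ (@?w1 e)) => apply: good_negb
  | |- good (fun e => (@?w1 e) && (@?w2 e)) => apply: good_andb
  | |- good (fun e => (@?w1 e) || (@?w2 e)) => apply: good_orb
  | |- good (fun e => nilp (@?w1 e)) => apply: good_nilp
  | |- good (fun e => head (@?w1 e) (@?w2 e)) => apply: good_head
  | |- good (fun e => behead (@?w1 e)) => apply: good_behead
  | |- good (fun e => last (@?w1 e) (@?w2 e)) => apply: good_last
  | |- good (fun e => S (@?w1 e)) => apply: good_succ
  | |- good (fun e => predn (@?w1 e)) => apply: good_pred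
  | |- good (fun e => map (@?w1 e) (@?w2 e)) => eapply good_map
  | |- good (fun e => filter (@?w1 e) (@?w2 e)) => eapply good_filter
  | |- good (fun e => has (@?w1 e) (@?w2 e)) => eapply good_has
  | |- good (fun e => all (@?w1 e) (@?w2 e)) => eapply good_all
  | |- good (fun e => nseq (@?w1 e) false) => apply: good_ticks
  | |- good (fun e => (@?w1 e) == (@?w2 e)) => first [apply: good_eq | apply: (good_eq (T := nat))
      | apply: (good_eq (T := bool)) | apply: (good_eq (T := seq nat)) | apply: (good_eq (T := seq bool))
      | apply: (good_eq (T := seq (nat * nat)))]
  | |- good _ => first [good_user | apply: good_if]
  end.

Ltac good_tac := repeat first [assumption | good_step].

Lemma good_subn E (eE : encodable E) (f g : E -> nat) : good f -> good g -> good (fun e => f e - g e).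
Proof.
move=> Hf Hg; apply: good_ext (_ : good (fun e => foldl (fun s _ => s.-1) (f e) (nseq (g e) false))) _.
  eapply (good_foldl_add (Q := fun=> 0)) => //; try by good_tac.
    by poly_tac.
  by move=> e [|s] x; rewrite ?len_succ /=; lia.
by move=> e; elim: (g e) (f e) => [|n IH] m; rewrite ?subn0 //= IH; lia.
Qed.

Lemma good_leq E (eE : encodable E) (f g : E -> nat) : good f -> good g -> good (fun e => f e <= g e).
Proof. by move=> Hf Hg; apply: good_eq0; apply: good_subn. Qed.

Lemma good_iota E (eE : encodable E) (f : E -> nat) : good f -> good (fun e => iota 0 (f e)).
Proof.
move=> Hf.
have Hi k s : foldl (fun s (_ : bool) => s ++ [:: size s]) s k = s ++ iota (size s) (size k).
  elim: k s => [|x k IH] s /=; first by rewrite cats0.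
  by rewrite IH size_cat /= addn1 -catA.
apply: good_ext (_ : good (fun e => foldl (fun s (_ : bool) => s ++ [:: size s]) [::] (nseq (f e) false))) _; last first.
  by move=> e; rewrite Hi size_nseq.
(* The appended number is the size of the accumulator, so its length is not bounded by environment
   and element alone; the final length is bounded directly by a quadratic polynomial. *)
eapply (good_foldl (Q := fun n => n + n * (2 * n).+4)) => //; try by good_tac.
  by poly_tac.
move=> e s k; rewrite Hi len_cat.
have Hk : size k < len k by apply: size_tlist.
have Hs : size s < len s by apply: size_tlist.
have : forall a n, len (iota a n) <= n * (2 * (a + n)).+4 + 1.
  move=> a n; elim: n a => // n IH a; rewrite [iota _ _]/= len_cons len_nat.
  by have := IH a.+1; rewrite mulSn addSnnS; lia.
move=> /(_ (size s) (size k)) H.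
have : size k * (2 * (size s + size k)).+4 <= (len e + len s + len k) * (2 * (len e + len s + len k)).+4.
  by apply: leq_mul; lia.
lia.
Qed.

Lemma good_undup E (eE : encodable E) (T : eqType) (eT : encodable T) (l : E -> seq T) :
  good l -> good (fun e => undup (l e)).
Proof.
move=> Hl; apply: good_ext (_ : good (fun e => foldl (fun u x => if has (fun y => y == x) u then u else x :: u) [::] (rev (l e)))) _.
  eapply (good_foldl_add (Q := fun n => n.+1)) => //; try by good_tac.
    by poly_tac.
  by move=> e s x; case: ifP => _; rewrite ?len_cons; lia.
move=> e; rewrite foldl_rev; elim: (l e) => //= x k ->.
by rewrite -(mem_undup k) -has_pred1.
Qed.

Lemma good_index E (eE : encodable E) (T : eqType) (eT : encodable T) (x : E -> T) (l : E -> seq T) :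
  good x -> good l -> good (fun e => index (x e) (l e)).
Proof.
move=> Hx Hl.
pose f e (st : bool * nat) y := if st.1 || (y == x e) then (true, st.2) else (false, st.2.+1).
apply: good_ext (_ : good (fun e => (foldl (f e) (false, 0) (l e)).2)) _.
  apply: good_snd; eapply (good_foldl_add (Q := fun=> 5)) => //; try by good_tac.
  - rewrite /f; good_tac; apply: (good_comp Hx); good_tac.
  - by poly_tac.
  - move=> e [b n] y; rewrite /f; case: ifP => _; rewrite [_.2]/= !len_pair ?len_succ;
      have := len_bool true; have := len_bool false; have := len_gt0 b; lia.
move=> e; have Ht k n : foldl (f e) (true, n) k = (true, n) by elim: k.
have : forall n, (foldl (f e) (false, n) (l e)).2 = n + index (x e) (l e).
  elim: (l e) => [|y k IH] n /=; first by rewrite addn0.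
  by rewrite {2}/f /=; case: eqVneq => _; rewrite ?Ht ?addn0 //= IH addnS.
by move=> ->.
Qed.

(** * Binary numerals *)

Fixpoint incb (s : seq bool) : seq bool :=
  if s is b :: s' then (if b then false :: incb s' else true :: s') else [:: true].

(** The numeral of [n.+1], least significant bit first: [enc_nat] shifts numbers by one, so the
    numerals are exactly the words that end in [true], and none is empty. Counting up makes it
    visibly computable from a unary [n]. *)
Definition ubin (n : nat) : seq bool := iter n incb [:: true].

Lemma len_incb s : len (incb s) <= len s + 4.
Proof.
have H3 : len true = 3 by []; have H1 : len false = 1 by [].
elim: s => [|[] s IH].
- by rewrite len_cons len_nil H3.
- by rewrite (_ : incb (true :: s) = false :: incb s) // !len_cons H3 H1; move: IH; set x := len _; set y := len _; lia.
- by rewrite (_ : incb (false :: s) = true :: s) // !len_cons H3 H1; set x := len _; lia.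
Qed.

Lemma good_incb E (eE : encodable E) (s : E -> seq bool) : good s -> good (fun e => incb (s e)).
Proof.
(* The first component is the carry and the second the reversed sum. The new digit is the exclusive
   or of digit and carry, and a carry left at the end becomes a new leading digit. *)
move=> Hs; pose f (st : bool * seq bool) (b : bool) := (st.1 && b, (b != st.1) :: st.2).
have Hf : good (fun e => foldl f (true, [::]) (s e)).
  eapply (good_foldl_add (Q := fun=> 9)) => //; try by rewrite /f; good_tac.
    by poly_tac.
  move=> e [c u] b; rewrite /f [(c, u).1]/= [(c, u).2]/= !len_pair len_cons.
  by have := len_bool (c && b); have := len_bool (b != c); have := len_gt0 c; lia.
apply: good_ext (_ : good (fun e => rev (foldl f (true, [::]) (s e)).2 ++
   (if (foldl f (true, [::]) (s e)).1 then [:: true] else [::]))) _; first by good_tac.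
have H0 k u : foldl f (false, u) k = (false, catrev k u).
  by elim: k u => //= b k IH u; rewrite {2}/f /= IH; case: b.
move=> e; have : forall u, rev (foldl f (true, u) (s e)).2 ++
   (if (foldl f (true, u) (s e)).1 then [:: true] else [::]) = rev u ++ incb (s e).
  elim: (s e) => [//|[] k IH] u.
    by rewrite [foldl _ _ _]/= {2 4}/f /= IH /= rev_cons cat_rcons.
  by rewrite [foldl _ _ _]/= {2 4}/f /= H0 /= cats0 catrevE rev_cat revK rev_cons cat_rcons.
by move=> ->.
Qed.

Lemma good_ubin E (eE : encodable E) (f : E -> nat) : good f -> good (fun e => ubin (f e)).
Proof.
move=> Hf; apply: good_ext (_ : good (fun e => foldl (fun s (_ : bool) => incb s) [:: true] (nseq (f e) false))) _.
  eapply (good_foldl_add (Q := fun=> 4)) => //; try by good_tac.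
  - by apply: good_incb; good_tac.
  - by poly_tac.
  - by move=> e s x; apply: len_incb.
move=> e; have : forall s, foldl (fun s (_ : bool) => incb s) s (nseq (f e) false) = iter (f e) incb s.
  by elim: (f e) => //= n IH s; rewrite IH -iterSr.
by move=> ->.
Qed.

Ltac good_user ::=
  lazymatch goal with
  | |- good (fun e => (@?w1 e) - (@?w2 e)) => apply: good_subn
  | |- good (fun e => (@?w1 e) <= (@?w2 e)) => apply: good_leq
  | |- good (fun e => iota 0 (@?w1 e)) => apply: good_iota
  | |- good (fun e => undup (@?w1 e)) => apply: good_undup
  | |- good (fun e => index (@?w1 e) (@?w2 e)) => apply: good_index
  | |- good (fun e => ubin (@?w1 e)) => apply: good_ubin
  | H : good ?f |- good (fun e => ?f (@?w1 e)) => apply: (good_comp H)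
  end.

Fixpoint bval (s : seq bool) : nat := if s is b :: s' then b + 2 * bval s' else 0.

Lemma bval_gt0 s : last false s -> 0 < bval s.
Proof.
elim: s => // b s IH /= H; case: s IH H => [|c s] IH /= H; first by rewrite H.
by have := IH H; rewrite /=; lia.
Qed.

Lemma bval_inj s t : last false s -> last false t -> bval s = bval t -> s = t.
Proof.
elim: s t => [|b s IH] [|c t] //= Hs Ht H.
have Hb : b = c by move: H; case: b c {Hs Ht} => [] []; lia.
have Hv : bval s = bval t by rewrite Hb in H; lia.
rewrite Hb; congr cons; case: s t IH Hs Ht Hv {H} => [|b' s] [|c' t] IH Hs Ht Hv //.
- by have := bval_gt0 (Ht : last false (c' :: t)); rewrite -Hv.
- by have := bval_gt0 (Hs : last false (b' :: s)); rewrite Hv.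
- exact: IH.
Qed.

Lemma pos_bits_last p : last false (pos_bits p).
Proof.
elim: p => //= p.
  by case: (pos_bits p).
Qed.

Lemma pos_bits_val p : bval (pos_bits p) = nat_of_pos p.
Proof. by elim: p => //= p ->; rewrite NatTrec.doubleE; lia. Qed.

Lemma bin_succ n : last false (bin n.+1) /\ bval (bin n.+1) = n.+1.
Proof.
have := bin_of_natK n.+1; rewrite /bin; case: (bin_of_nat n.+1) => [|p] //= H.
by rewrite pos_bits_last pos_bits_val.
Qed.

Lemma incb_last s : last false s -> last false (incb s).
Proof.
elim: s => // -[] s IH /=; last by case: s IH.
case: s IH => [|c s] //= IH /IH; by case: c {IH}.
Qed.

Lemma incb_val s : bval (incb s) = (bval s).+1.
Proof. by elim: s => // -[] s IH //=; rewrite ?IH; lia. Qed.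

Lemma ubin_spec n : last false (ubin n) /\ bval (ubin n) = n.+1.
Proof.
elim: n => // n [IH1 IH2]; rewrite /ubin iterS -/(ubin n).
by rewrite incb_val IH2; split=> //; apply: incb_last.
Qed.

Lemma ubinE n : ubin n = bin n.+1.
Proof.
have [H1 H2] := ubin_spec n; have [H3 H4] := bin_succ n.
by apply: bval_inj => //; rewrite H2 H4.
Qed.

Lemma ubin_val s : last false s -> ubin (bval s).-1 = s.
Proof.
move=> H; have [H1 H2] := ubin_spec (bval s).-1; apply: bval_inj => //.
by rewrite H2 prednK // bval_gt0.
Qed.

Lemma ubin_inj : injective ubin.
Proof. by move=> m n H; have [_] := ubin_spec m; rewrite H; have [_ ->] := ubin_spec n; case. Qed.

(** * Parsing formulas *)

Notation literal := (bool * seq bool)%type.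
Notation cnf := (seq (seq (seq literal))).

Definition ebits (s : seq bool) : seq bool :=
  flatten (map (fun b => [:: b; b]) s) ++ [:: false; true].
Definition elist (l : seq (seq bool)) : seq bool :=
  [:: true; false] ++ flatten l ++ [:: false; true].
(** The fixed words [[:: true]], [[:: false; true]], [[:: true; true]] and
    [[:: false; false; true]], here and in the next definitions, are the shifted numerals of the
    tags 0, 1, 2 and 3 of [code_form]. *)
Definition elit (l : literal) : seq bool :=
  if l.1 then elist [:: ebits [:: true]; ebits l.2]
  else elist [:: ebits [:: false; true]; elist [:: ebits [:: true]; ebits l.2]].
Definition eterm (t : seq literal) := elist (ebits [:: true; true] :: map elit t).
Definition eclause (c : seq (seq literal)) := elist (ebits [:: false; false; true] :: map eterm c).
Definition eform (f : cnf) := elist (ebits [:: true; true] :: map eclause f).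
Definition einput (x : cnf * seq bool) := elist [:: eform x.1; ebits x.2].

(* A parser state: nesting depth, digits of the number being read, the last literal,
   and the finished parts of the current term, clause, formula, and the weight. *)
Notation pstate := (nat * seq bool * literal * seq literal * seq (seq literal) * cnf * seq bool)%type.
Notation p_depth c := c.1.1.1.1.1.1.
Notation p_cur c := c.1.1.1.1.1.2.
Notation p_lit c := c.1.1.1.1.2.
Notation p_term c := c.1.1.1.2.
Notation p_clause c := c.1.1.2.
Notation p_form c := c.1.2.
Notation p_weight c := c.2.

(** Depth 1 is the whole input, 2 the formula, 3 a clause, 4 a term, 5 a literal and 6 the variable
    under a negation; the depth of the last number read in a literal gives its sign. Tags pass
    through the literal field too and are overwritten. A separator ends a number if digits are
    pending and a list otherwise, which is unambiguous as no numeral is empty. *)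
Definition pstep (c : pstate) (x y : bool) : pstate :=
  if x == y then
    (p_depth c, p_cur c ++ [:: x], p_lit c, p_term c, p_clause c, p_form c, p_weight c)
  else if x then
    ((p_depth c).+1, p_cur c, p_lit c, p_term c, p_clause c, p_form c, p_weight c)
  else if ~~ nilp (p_cur c) then
    if p_depth c == 1 then
      (p_depth c, [::], p_lit c, p_term c, p_clause c, p_form c, p_cur c)
    else (p_depth c, [::], (p_depth c == 5, p_cur c), p_term c, p_clause c, p_form c, p_weight c)
  else
    ((p_depth c).-1, [::],
     if p_depth c == 5 then (false, [::]) else p_lit c,
     if p_depth c == 5 then p_term c ++ [:: p_lit c]
       else if p_depth c == 4 then [::] else p_term c,
     if p_depth c == 4 then p_clause c ++ [:: p_term c]
       else if p_depth c == 3 then [::] else p_clause c,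
     if p_depth c == 3 then p_form c ++ [:: p_clause c] else p_form c,
     p_weight c).

Definition bstep (st : seq bool * pstate) (y : bool) : seq bool * pstate :=
  if nilp st.1 then ([:: y], st.2) else ([::], pstep st.2 (head true st.1) y).

Definition pinit : pstate := (0, [::], (false, [::]), [::], [::], [::], [::]).

Definition parse_input (x : seq bool) : cnf * seq bool :=
  let c := (foldl bstep ([::], pinit) x).2 in (p_form c, p_weight c).

Definition wf_input (d : nat) (x : cnf * seq bool) : bool :=
  all (all (fun t => [&& 0 < size t, size t <= d & all (fun l => last false l.2) t])) x.1
  && last false x.2.

(** The parser never fails. Whether the input was well formed is decided afterwards, by encoding
    what was found and comparing. *)
Definition valid (d : nat) (x : seq bool) : bool := wf_input d (parse_input x) && (einput (parse_input x) == x).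

Definition runs (c : pstate) (s : seq bool) (c' : pstate) :=
  forall s', foldl bstep ([::], c) (s ++ s') = foldl bstep ([::], c') s'.

Lemma runs_cat c s c1 t c2 : runs c s c1 -> runs c1 t c2 -> runs c (s ++ t) c2.
Proof. by move=> H1 H2 s'; rewrite -catA H1 H2. Qed.

Lemma runs_nil c : runs c [::] c. Proof. by []. Qed.

Lemma runs_tok c x y : runs c [:: x; y] (pstep c x y). Proof. by []. Qed.

Lemma runs_bits dp cur l t c f k s :
  runs (dp, cur, l, t, c, f, k) (flatten (map (fun b => [:: b; b]) s)) (dp, cur ++ s, l, t, c, f, k).
Proof.
elim: s cur => [|b s IH] cur; first by rewrite cats0.
rewrite [map _ _]/= [flatten _]/=; apply: (runs_cat (s := [:: b; b])) (runs_tok _ b b) _.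
rewrite /pstep eqxx /=; have := IH (cur ++ [:: b]); by rewrite -catA.
Qed.

Lemma runs_num dp l t c f k s : s != [::] ->
  runs (dp, [::], l, t, c, f, k) (ebits s)
    (if dp == 1 then (dp, [::], l, t, c, f, s) else (dp, [::], (dp == 5, s), t, c, f, k)).
Proof.
move=> Hs; apply: runs_cat (runs_bits _ _ _ _ _ _ _ _) _.
have := runs_tok (dp, s, l, t, c, f, k) false true.
by rewrite /pstep /= /nilp size_eq0 Hs.
Qed.

Lemma runs_open dp l t c f k :
  runs (dp, [::], l, t, c, f, k) [:: true; false] (dp.+1, [::], l, t, c, f, k).
Proof. by []. Qed.

(** The literal field is left existential because tags leave junk in it between two literals. *)
Definition weak_runs (dp : nat) t c f k s (dp' : nat) t' c' f' k' :=
  forall l, exists l', runs (dp, [::], l, t, c, f, k) s (dp', [::], l', t', c', f', k').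

Lemma weak_cat dp t c f k s dp1 t1 c1 f1 k1 s2 dp2 t2 c2 f2 k2 :
  weak_runs dp t c f k s dp1 t1 c1 f1 k1 -> weak_runs dp1 t1 c1 f1 k1 s2 dp2 t2 c2 f2 k2 ->
  weak_runs dp t c f k (s ++ s2) dp2 t2 c2 f2 k2.
Proof.
move=> H1 H2 l; have [l1 {}H1] := H1 l; have [l2 {}H2] := H2 l1.
by exists l2; apply: runs_cat H1 H2.
Qed.

Lemma runs_elist dp l t c f k L c1 :
  runs (dp.+1, [::], l, t, c, f, k) (flatten L) c1 ->
  runs (dp, [::], l, t, c, f, k) (elist L) (pstep c1 false true).
Proof. by move=> H; apply: runs_cat (runs_open _ _ _ _ _ _) (runs_cat H (runs_tok _ _ _)). Qed.

Lemma weak_lit x t c f k : x.2 != [::] :> seq bool ->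
  weak_runs 4 t c f k (elit x) 4 (t ++ [:: x]) c f k.
Proof.
case: x => [[] s] /= Hs l; exists (false, [::]); rewrite /elit /=.
  have H1 := @runs_num 5 l t c f k [:: true] isT; rewrite /= in H1.
  have H2 := @runs_num 5 (true, [:: true]) t c f k s Hs; rewrite /= in H2.
  exact: (runs_elist (dp := 4) (L := [:: ebits [:: true]; ebits s]) (runs_cat H1 (runs_cat H2 (runs_nil _)))).
have H1 := @runs_num 5 l t c f k [:: false; true] isT; rewrite /= in H1.
have H2 := @runs_num 6 (true, [:: false; true]) t c f k [:: true] isT; rewrite /= in H2.
have H3 := @runs_num 6 (false, [:: true]) t c f k s Hs; rewrite /= in H3.
have H4 := runs_elist (dp := 5) (L := [:: ebits [:: true]; ebits s]) (runs_cat H2 (runs_cat H3 (runs_nil _))).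
exact: (runs_elist (dp := 4) (L := [:: ebits [:: false; true]; elist [:: ebits [:: true]; ebits s]])
  (runs_cat H1 (runs_cat H4 (runs_nil _)))).
Qed.

Lemma weak_elist dp t c f k t' c' f' k' s L : s != [::] -> 0 < dp ->
  weak_runs dp.+1 t c f k (flatten L) dp.+1 t' c' f' k' ->
  forall l, exists l', runs (dp, [::], l, t, c, f, k) (elist (ebits s :: L))
     (pstep (dp.+1, [::], l', t', c', f', k') false true).
Proof.
move=> Hs Hdp H l; have H1 := @runs_num dp.+1 l t c f k s Hs.
rewrite eqSS (gtn_eqF Hdp) in H1; have [l' H2] := H (dp.+1 == 5, s).
by exists l'; apply: (runs_elist (L := ebits s :: L)) (runs_cat H1 H2).
Qed.

Lemma weak_term x c f k : all (fun l : literal => last false l.2) x ->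
  weak_runs 3 [::] c f k (eterm x) 3 [::] (c ++ [:: x]) f k.
Proof.
move=> Hx l; have H : forall t, weak_runs 4 t c f k (flatten (map elit x)) 4 (t ++ x) c f k.
  elim: x Hx => [|y x IH] /= Hx t; first by rewrite cats0 => l'; exists l'.
  have /andP[Hy /IH{}IH] := Hx.
  rewrite (_ : t ++ y :: x = (t ++ [:: y]) ++ x); last by rewrite -catA.
  by apply: weak_cat (weak_lit _ _ _ _ _) (IH _); case: (y.2) Hy.
have [l' H'] := @weak_elist 3 [::] c f k _ _ _ _ [:: true; true] _ isT isT (H [::]) l.
by exists l'; exact: H'.
Qed.

Lemma weak_clause x f k : all (all (fun l : literal => last false l.2)) x ->
  weak_runs 2 [::] [::] f k (eclause x) 2 [::] [::] (f ++ [:: x]) k.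
Proof.
move=> Hx l; have H : forall c, weak_runs 3 [::] c f k (flatten (map eterm x)) 3 [::] (c ++ x) f k.
  elim: x Hx => [|y x IH] /= Hx c; first by rewrite cats0 => l'; exists l'.
  have /andP[Hy /IH{}IH] := Hx.
  rewrite (_ : c ++ y :: x = (c ++ [:: y]) ++ x); last by rewrite -catA.
  exact: weak_cat (weak_term _ _ _ Hy) (IH _).
have [l' H'] := @weak_elist 2 [::] [::] f k _ _ _ _ [:: false; false; true] _ isT isT (H [::]) l.
by exists l'; exact: H'.
Qed.

Lemma weak_form x k : all (all (all (fun l : literal => last false l.2))) x ->
  weak_runs 1 [::] [::] [::] k (eform x) 1 [::] [::] x k.
Proof.
move=> Hx l; have H : forall f, weak_runs 2 [::] [::] f k (flatten (map eclause x)) 2 [::] [::] (f ++ x) k.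
  elim: x Hx => [|y x IH] /= Hx f; first by rewrite cats0 => l'; exists l'.
  have /andP[Hy /IH{}IH] := Hx.
  rewrite (_ : f ++ y :: x = (f ++ [:: y]) ++ x); last by rewrite -catA.
  exact: weak_cat (weak_clause _ _ Hy) (IH _).
have [l' H'] := @weak_elist 1 [::] [::] [::] k _ _ _ _ [:: true; true] _ isT isT (H [::]) l.
by exists l'; exact: H'.
Qed.

Lemma wf_last d x : wf_input d x -> all (all (all (fun l : literal => last false l.2))) x.1.
Proof.
move=> /andP[H _]; apply: sub_all H => c; apply: sub_all => t; by case/and3P.
Qed.

Lemma parse_einput d x : wf_input d x -> parse_input (einput x) = x.
Proof.
case: x => F k H; have Hk : k != [::] by move: H => /andP[_] /=; case: (k).
have [l H1] := weak_form [::] (wf_last H) (false, [::]).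
have H2 := @runs_num 1 l [::] [::] F [::] k Hk; rewrite /= in H2.
have H3 := runs_elist (dp := 0) (L := [:: eform F; ebits k]) (runs_cat H1 (runs_cat H2 (runs_nil _))).
by have := H3 [::]; rewrite cats0 /parse_input -/pinit => ->.
Qed.

Lemma validP d x : valid d x <-> exists2 y, wf_input d y & x = einput y.
Proof.
split=> [/andP[H /eqP <-]|[y Hy ->]]; first by exists (parse_input x).
by rewrite /valid (parse_einput Hy) Hy eqxx.
Qed.

Lemma good_parse_state : good (fun x : seq bool => foldl bstep ([::], pinit) x).
Proof.
(* A step only adds a digit or moves finished parts to another component, so the state grows by a
   constant; 60 is a generous one. *)
apply: (good_foldl_add (f := fun=> bstep) (s0 := fun=> ([::], pinit)) (l := id) (Q := fun=> 60)); try by good_tac.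
- rewrite /bstep /pstep; good_tac.
- by poly_tac.
- move=> _ [u c] b; rewrite /bstep [(u, c).1]/= [(u, c).2]/=; case: ifP => Hu.
    case: u Hu => // _; rewrite !len_pair len_cons len_nil; have := len_bool b; lia.
  rewrite !len_pair len_nil; generalize (len_gt0 u).
  case: c => [[[[[[dp cur] l] t] cl] f] k]; rewrite /pstep; cbn [fst snd].
  have Hpred : len dp.-1 <= len dp by rewrite !len_nat; lia.
  have := len_bool (head true u); have := len_bool (dp == 5); have := len_bool false.
  generalize (len_gt0 k) (len_gt0 t) (len_gt0 cl) (len_gt0 cur) (len_gt0 l).
  have Hl : len l = (len l.1 + len l.2).+1 by case: (l) => *; apply: len_pair.
  by do ![case: ifP => ?]; cbn [fst snd]; rewrite ?len_pair ?len_cat ?len_cons ?len_nil ?len_succ; cbn [fst snd]; lia.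
Qed.

Lemma good_parse : good parse_input.
Proof. by rewrite /parse_input; have H := good_parse_state; good_tac. Qed.

(** * Codes *)

Lemma enc_CNat n : enc (CNat n) = ebits (ubin n).
Proof.
change (enc_nat n = ebits (ubin n)); rewrite /enc_nat -ubinE /ebits; congr (flatten _ ++ _); apply: eq_map => b.
by case: b.
Qed.

Lemma enc_CList l : enc (CList l) = elist (map enc l).
Proof. by []. Qed.

Fixpoint code_nested_ind (P : code -> Prop) (HN : forall n, P (CNat n))
    (HL : forall l, (forall i, i < size l -> P (nth (CNat 0) l i)) -> P (CList l)) c : P c :=
  match c with
  | CNat n => HN n
  | CList l => HL l ((fix go l : forall i, i < size l -> P (nth (CNat 0) l i) :=
      match l return forall i, i < size l -> P (nth (CNat 0) l i) with
      | [::] => fun i H => False_ind _ (notF H)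
      | c :: l' => fun i => match i return i < size (c :: l') -> P (nth (CNat 0) (c :: l') i) with
          | 0 => fun _ => code_nested_ind HN HL c
          | i'.+1 => fun H => go l' i' H
          end
      end) l)
  end.

Lemma ebits_inj u v s t : ebits u ++ s = ebits v ++ t -> u = v /\ s = t.
Proof.
rewrite /ebits; elim: u v => [|a u IH] [|b v] //=.
- by case.
- by case; case: b.
- by case; case: a.
- by case=> -> _ /IH[-> ->].
Qed.

(** No code starts with the separator 01, so the end of a list cannot be mistaken for a further
    member. *)
Lemma enc_head c : exists s, enc c = [:: true; false] ++ s \/ exists b, enc c = [:: b; b] ++ s.
Proof.
case: c => [n|l]; last by eexists; left; rewrite enc_CList.
rewrite enc_CNat; have [] := ubin_spec n; case: (ubin n) => // b u _ _.
by eexists; right; exists b.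
Qed.

(** Stronger than injectivity, as the induction demands: the members of a list are concatenated, so
    each must be recognizable with an arbitrary continuation. *)
Lemma enc_prefix c1 c2 s1 s2 : enc c1 ++ s1 = enc c2 ++ s2 -> c1 = c2 /\ s1 = s2.
Proof.
elim/code_nested_ind: c1 c2 s1 s2 => [n|l IH] [m|k] s1 s2.
- by rewrite !enc_CNat => /ebits_inj[/ubin_inj -> ->].
- rewrite enc_CNat enc_CList; have [] := ubin_spec n; case: (ubin n) => // b u _ _ /=.
  by case; case: b.
- rewrite enc_CNat enc_CList; have [] := ubin_spec m; case: (ubin m) => // b u _ _ /=.
  by case; case: b.
rewrite !enc_CList /elist /= => -[]; rewrite -!catA.
elim: l k IH => [|c l IHl] [|d k] IH.
- by case.
- have [s [E|[b E]]] := enc_head d; rewrite /= E //=.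
  by case=> <-.
- have [s [E|[b E]]] := enc_head c; rewrite /= E //=.
  by case=> ->.
rewrite /= -!catA => /(IH 0 isT)[/= -> /IHl[]].
  by move=> i Hi; apply: (IH i.+1).
by case=> -> ->.
Qed.

Lemma enc_inj : injective enc.
Proof. by move=> c d H; apply: (proj1 (enc_prefix (s1 := [::]) (s2 := [::]) _)); rewrite H. Qed.

Lemma decodeP x : decode_spec x (decode x).
Proof.
rewrite /decode; apply: epsilon_spec.
have [[c Hc]|H] := excluded_middle_informative (exists c, enc c = x).
  by exists (Some c).
by exists None => c Hc; apply: H; exists c.
Qed.

Lemma decode_enc c : decode (enc c) = Some c.
Proof.
by have := decodeP (enc c); case: (decode _) => [d /enc_inj ->|/(_ c)].
Qed.

Lemma param_last_nil : param_last [::] = 0.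
Proof.
rewrite /param_last; have := decodeP [::]; case: (decode _) => // c /= H.
have [s [E|[b E]]] := enc_head c; by rewrite E in H.
Qed.

Lemma param_last_enc l k : param_last (enc (CList (rcons l (CNat k)))) = k.
Proof. by rewrite /param_last decode_enc last_rcons. Qed.

(** * Weighted satisfiability *)

Notation ixcnf := (seq (seq (seq (bool * nat)))).

Definition wsat (n : nat) (F : ixcnf) (k : nat) : Prop :=
  exists I : seq nat, [/\ uniq I, size I = k, all (fun i => i < n) I
    & all (has (all (fun l => (l.2 \in I) == l.1))) F].

Definition lit_form (l : literal) : Defs.form :=
  if l.1 then FVar (bval l.2).-1 else FNeg (FVar (bval l.2).-1).
Definition form_of (F : cnf) : Defs.form :=
  FAnd [seq FOr [seq FAnd (map lit_form t) | t <- c] | c <- F].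

Definition cnf_vars (F : cnf) : seq (seq bool) := undup [seq l.2 | l <- flatten (flatten F)].
Definition cnf_index (F : cnf) : ixcnf :=
  [seq [seq [seq (l.1, index l.2 (cnf_vars F)) | l <- t] | t <- c] | c <- F].

Lemma enc_node n l : enc (CList (CNat n :: l)) = elist (ebits (ubin n) :: map enc l).
Proof. by rewrite enc_CList map_cons enc_CNat. Qed.

Lemma elit_form l : last false l.2 -> elit l = enc (code_form (lit_form l)).
Proof.
case: l => [[] s] Hs.
  change (elit (true, s) = enc (CList [:: CNat 0; CNat (bval s).-1])).
  by rewrite enc_node map_cons enc_CNat ubin_val.
change (elit (false, s) = enc (CList [:: CNat 1; CList [:: CNat 0; CNat (bval s).-1]])).
by rewrite enc_node map_cons enc_node map_cons enc_CNat ubin_val.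
Qed.

Lemma eform_form F : all (all (all (fun l : literal => last false l.2))) F ->
  eform F = enc (code_form (form_of F)).
Proof.
move=> HF; change (eform F = enc (CList (CNat 2 ::
  map code_form [seq FOr [seq FAnd (map lit_form t) | t <- c] | c <- F]))).
rewrite enc_node -!map_comp; congr (elist (_ :: _)); apply/eq_in_map => c /(allP HF) Hc.
change (eclause c = enc (CList (CNat 3 :: map code_form [seq FAnd (map lit_form t) | t <- c]))).
rewrite enc_node -!map_comp; congr (elist (_ :: _)); apply/eq_in_map => t /(allP Hc) Ht.
change (eterm t = enc (CList (CNat 2 :: map code_form (map lit_form t)))).
rewrite enc_node -!map_comp; congr (elist (_ :: _)); apply/eq_in_map => l /(allP Ht) Hl.
exact: elit_form.
Qed.

Lemma einput_enc d x : wf_input d x ->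
  einput x = enc (CList [:: code_form (form_of x.1); CNat (bval x.2).-1]).
Proof.
move=> Hx; rewrite enc_CList !map_cons -eform_form; last exact: wf_last Hx.
by rewrite enc_CNat ubin_val //; case/andP: Hx.
Qed.

Lemma Gamma_form d x : wf_input d x -> Gamma 2 d (form_of x.1).
Proof.
move=> /andP[H _]; rewrite /Gamma /= all_map; apply: sub_all H => c Hc /=.
rewrite all_map; apply: sub_all Hc => t /and3P[H1 H2 _] /=.
by rewrite size_map H1 H2 all_map /=; apply/allP => -[[] u] _.
Qed.

Lemma choose_list (X Y : Type) (f : Y -> X) (P : pred X) (Q : pred Y) (s : seq X) :
  (forall x, P x -> exists2 y, Q y & x = f y) -> all P s -> exists2 t, all Q t & s = map f t.
Proof.
move=> H; elim: s => [_|x s IH /= /andP[/H[y Hy ->] /IH[t Ht ->]]]; first by exists [::].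
by exists (y :: t); rewrite //= Hy.
Qed.

Lemma lit_form_surj f : is_lit f -> exists2 l : literal, last false l.2 & f = lit_form l.
Proof.
case: f => [i|[i||l|l]|l|l] // _; have [H1 H2] := ubin_spec i.
- by exists (true, ubin i); rewrite // /lit_form /= H2.
- by exists (false, ubin i); rewrite // /lit_form /= H2.
Qed.

(** A conjunction of disjunctions of bounded conjunctions of literals is just three nested lists, so
    the parser need not handle any other shape of formula. *)
Lemma Gamma_form_surj d alpha k : Gamma 2 d alpha ->
  exists2 x, wf_input d x & alpha = form_of x.1 /\ k = (bval x.2).-1.
Proof.
have [Hk1 Hk2] := ubin_spec k.
case: alpha => // l; rewrite /Gamma /= => Hl.
pose Q1 (c : seq (seq literal)) := all (fun t => [&& 0 < size t, size t <= d & all (fun l : literal => last false l.2) t]) c.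
have [|F HF ->] := @choose_list _ _ (fun c : seq (seq literal) => FOr [seq FAnd (map lit_form t) | t <- c]) _ Q1 _ _ Hl.
  move=> [i|g|l1|l1] // Hl1.
  have [|c Hc ->] := @choose_list _ _ (fun t => FAnd (map lit_form t)) _
     (fun t : seq literal => [&& 0 < size t, size t <= d & all (fun l : literal => last false l.2) t]) _ _ Hl1;
    last by exists c.
  move=> [i|g|l2|l2] // /andP[/andP[H1 H2] H3].
  have [t Ht E] := choose_list lit_form_surj H3.
  by exists t; rewrite ?E // -(size_map lit_form) -E H1 H2.
by exists (F, ubin k); rewrite /= ?Hk2 // /wf_input /= Hk1 andbT.
Qed.

Lemma lang_WSat d x : lang (WSat (Gamma 2 d)) x <->
  valid d x /\ sat_weight (form_of (parse_input x).1) (bval (parse_input x).2).-1.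
Proof.
split=> [[alpha [k [-> HG Hs]]]|[/andP[Hw /eqP He] Hs]].
  have [y Hy [E1 E2]] := Gamma_form_surj k HG.
  have Ex := einput_enc Hy; rewrite -E1 -E2 in Ex.
  by rewrite -Ex (parse_einput Hy) -E1 -E2; split=> //; apply/validP; exists y.
exists (form_of (parse_input x).1), (bval (parse_input x).2).-1; split=> //; last exact: Gamma_form Hw.
by rewrite -(einput_enc Hw) He.
Qed.

Lemma param_valid d x : valid d x -> param_last x = (bval (parse_input x).2).-1.
Proof.
by move=> /andP[Hw /eqP {1}<-]; rewrite (einput_enc Hw) (param_last_enc [:: _]).
Qed.

Notation lit_var l := (bval l.2).-1.

Lemma vars_form F : vars (form_of F) = [seq lit_var l | l : literal <- flatten (flatten F)].
Proof.
have Ht t : flatten (map vars (map lit_form t)) = [seq lit_var l | l : literal <- t].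
  by elim: t => //= -[[] u] t ->.
have Hc c : flatten (map vars [seq FAnd (map lit_form t) | t <- c]) =
    [seq lit_var l | l : literal <- flatten c].
  by elim: c => //= t c ->; rewrite map_cat Ht.
by rewrite /=; elim: F => //= c F ->; rewrite flatten_cat map_cat Hc.
Qed.

Lemma eval_form a F : eval a (form_of F) =
  all (has (all (fun l : literal => a (lit_var l) == l.1))) F.
Proof.
rewrite /= all_map; apply: eq_all => c /=; rewrite has_map; apply: eq_has => t /=.
rewrite all_map; apply: eq_all => -[[] u] /=; by case: (a _).
Qed.

Lemma eq_in_cnf (X : eqType) (F : seq (seq (seq X))) (P P' : pred X) :
  {in flatten (flatten F), P =1 P'} -> all (has (all P)) F = all (has (all P')) F.
Proof.
move=> H; apply: eq_in_all => c Hc; apply: eq_in_has => t Ht; apply: eq_in_all => l Hl.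
by apply: H; apply/flattenP; exists t => //; apply/flattenP; exists c.
Qed.

(** [sat_weight] lets only variables of the formula be true, so renaming each by its place in
    [cnf_vars] preserves weights. The new names are small, while the old ones, written in binary,
    may be exponentially large. *)
Lemma sat_wsat F k : all (all (all (fun l : literal => last false l.2))) F ->
  sat_weight (form_of F) k <-> wsat (size (cnf_vars F)) (cnf_index F) k.
Proof.
move=> HF; set U := cnf_vars F.
have HL l : l \in flatten (flatten F) -> last false l.2.
  by case/flattenP => t /flattenP[c /(allP HF) Hc /(allP Hc) Ht] /(allP Ht).
have HU l : l \in flatten (flatten F) -> l.2 \in U by move=> Hl; rewrite mem_undup map_f.
have HU2 u : u \in U -> exists2 l, l \in flatten (flatten F) & u = l.2.
  by rewrite mem_undup => /mapP.
have Uub u : u \in U -> ubin (bval u).-1 = u by move=> /HU2[l /HL Hl ->]; apply: ubin_val.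
have idx_inj u v : u \in U -> index u U = index v U -> u = v.
  move=> Hu Hi; have Hv : v \in U by rewrite -index_mem -Hi index_mem.
  by rewrite -(nth_index [::] Hu) -(nth_index [::] Hv) Hi.
have HV v : v \in vars (form_of F) <-> ubin v \in U.
  rewrite vars_form; split.
    by case/mapP => l Hl ->; rewrite ubin_val ?HU // HL.
  move=> Hv; have [l Hl E] := HU2 _ Hv; apply/mapP; exists l => //.
  by rewrite -E; have [_ ->] := ubin_spec v.
have HE I : all (has (all (fun l => (l.2 \in I) == l.1))) (cnf_index F) =
    all (has (all (fun l : literal => (index l.2 U \in I) == l.1))) F.
  rewrite /cnf_index all_map; apply: eq_all => c /=; rewrite has_map; apply: eq_has => t /=.
  by rewrite all_map.
split=> [[S [uS sS subS eS]]|[I [uI sI aI eI]]].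
- exists [seq index (ubin v) U | v <- S]; split.
  + rewrite map_inj_in_uniq // => v w Hv Hw /idx_inj E; apply: ubin_inj; apply: E.
    by apply/HV; apply: subS.
  + by rewrite size_map.
  + by apply/allP => _ /mapP[v Hv ->]; rewrite index_mem; apply/HV; apply: subS.
  + rewrite HE; rewrite eval_form in eS; rewrite (eq_in_cnf (P' := fun l => (lit_var l \in S) == l.1)) ?eS // => l Hl /=.
    congr (_ == _); apply/mapP/idP => [[v Hv /idx_inj E]|Hv].
      by have [_ H2] := ubin_spec v; rewrite (E (HU _ Hl)) H2.
    by exists (lit_var l) => //; rewrite ubin_val // HL.
- have HI i : i \in I -> nth [::] U i \in U by move=> /(allP aI); apply: mem_nth.
  exists [seq (bval (nth [::] U i)).-1 | i <- I]; split.
  + rewrite map_inj_in_uniq // => i j Hi Hj E.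
    apply/eqP; rewrite -(nth_uniq [::] (allP aI _ Hi) (allP aI _ Hj) (undup_uniq _)).
    by rewrite -(Uub _ (HI _ Hi)) -(Uub _ (HI _ Hj)) E.
  + by rewrite size_map.
  + by move=> _ /mapP[i Hi ->]; apply/HV; rewrite Uub HI.
  + rewrite eval_form; rewrite HE in eI; rewrite (eq_in_cnf (P' := fun l => (index l.2 U \in I) == l.1)) ?eI // => l Hl /=.
    congr (_ == _); apply/mapP/idP => [[i Hi E]|Hv]; last first.
      by exists (index l.2 U) => //; rewrite nth_index // HU.
    have -> : l.2 = nth [::] U i by rewrite -(Uub _ (HU _ Hl)) E Uub // HI.
    by rewrite index_uniq ?undup_uniq //; apply: (allP aI).
Qed.

Lemma wsat_le n F k : wsat n F k -> k <= n.
Proof.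
move=> [I [uI <- /allP aI _]]; rewrite -[n](size_iota 0); apply: uniq_leq_size => // i /aI.
by rewrite mem_iota.
Qed.

(** * From weighted satisfiability to hitting set *)

Definition hitting (sets : seq (seq nat)) (k : nat) : Prop :=
  exists Q : seq nat, size Q <= k /\ all (has (mem Q)) sets.

Fixpoint tuples (T : Type) (D : nat) (s : seq T) : seq (seq T) :=
  if D is D'.+1 then flatten [seq [seq x :: t | t <- tuples D' s] | x <- s] else [:: [::]].

Lemma mem_tuples (T : eqType) D (s t : seq T) :
  (t \in tuples D s) = (size t == D) && all (fun x => x \in s) t.
Proof.
elim: D t => [|D IH] [|y t] //=.
  by apply/flattenP => -[_ /mapP[x _ ->] /mapP[]].
apply/flattenP/andP => [[_ /mapP[x Hx ->] /mapP[u Hu [-> ->]]]|[Ht /andP[Hy Ha]]].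
  by move: Hu; rewrite IH eqSS => /andP[-> ->]; rewrite Hx.
exists [seq y :: t | t <- tuples D s]; first exact: map_f.
by apply: map_f; rewrite IH -eqSS Ht.
Qed.

Lemma tuples_uniq (T : eqType) D (s : seq T) : uniq s -> uniq (tuples D s).
Proof.
move=> Hs; elim: D => // D IH; apply: (allpairs_uniq (f := cons)) => //.
by move=> [x t] [y u] _ _ /= [-> ->].
Qed.

Definition item := (nat * nat)%type.
Definition slot (o : seq item) : seq nat := map fst o.

(* An object is a tuple of items (i, a), each claiming that the i-th smallest chosen
   variable is number a - 1; variables -1 and n serve as sentinels. Two objects are
   compatible if together they describe a strictly increasing map. *)
Definition compat (o o' : seq item) : bool :=
  all (fun x => all (fun y => ((x.1 < y.1) == (x.2 < y.2)) && ((y.1 < x.1) == (y.2 < x.2))) o') o.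

(** A positive literal is certified by an item whose rank is not that of a sentinel, a negative one
    by two items of consecutive ranks that enclose the variable. The sentinels ensure that every
    false variable has such an enclosing pair. *)
Definition sat_lit (k : nat) (o : seq item) (l : bool * nat) : bool :=
  if l.1 then has (fun x => (0 < x.1) && (x.1 <= k) && (x.2 == l.2.+1)) o
  else has (fun x => has (fun y => (y.1 == x.1.+1) && ((x.2 < l.2.+1) && (l.2.+1 < y.2))) o) o.

(** Ranks may repeat. Constant tuples will reveal the value of a single rank, and repetition pads
    tuples that are too short. *)
Definition slots D k := tuples D (iota 0 k.+2).
Definition objects D n k := tuples D (flatten [seq [seq (i, a) | a <- iota 0 n.+2] | i <- iota 0 k.+2]).

(* Hitting these sets forces, in turn: one object for each slot, compatibility of any two
   chosen objects, and a true term in each clause. *)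
Definition object_sets D n k (F : ixcnf) : seq (seq (seq item)) :=
  let O := objects D n k in let S := slots D k in
  [seq [seq o <- O | slot o == s] | s <- S] ++
  (flatten [seq [seq [seq o' <- O | ((slot o' == slot o) && (o' != o)) ||
                                    ((slot o' == s) && compat o o')] | s <- S] | o <- O] ++
   [seq [seq o <- O | has (all (sat_lit k o)) c] | c <- F]).

(** The first position with a value above [y] is the upper end of the gap; as [y] does not occur,
    the value before it is strictly smaller. *)
Lemma gap (g : seq nat) y : head 0 g < y -> y < last 0 g -> y \notin g ->
  exists i, [/\ i.+1 < size g, nth 0 g i < y & y < nth 0 g i.+1].
Proof.
move=> H0 H1 H2; have Hh : has (fun a => y < a) g.
  by apply/hasP; exists (last 0 g) => //; case: g H1 {H0 H2} => // a g _; apply: mem_last.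
have := nth_find 0 Hh; have := Hh; rewrite has_find.
case E: (find _ g) => [|i] Hs Hy; first by rewrite nth0 in Hy; lia.
exists i; split=> //.
have := @before_find _ 0 (fun a => y < a) g i; rewrite E => /(_ (leqnn _)) /negbT.
rewrite -leqNgt leq_eqVlt => /orP[/eqP Ei|//].
by rewrite -Ei mem_nth // in H2; apply: ltnW.
Qed.

Lemma mem_objects D n k o : (o \in objects D n k) =
  (size o == D) && all (fun x => (x.1 < k.+2) && (x.2 < n.+2)) o.
Proof.
rewrite mem_tuples; congr (_ && _); apply: eq_all => -[i a].
apply/flattenP/andP => [[_ /mapP[j Hj ->] /mapP[b Hb [-> ->]]]|[Hi Ha]].
  by move: Hj Hb; rewrite !mem_iota.
exists [seq (i, a) | a <- iota 0 n.+2]; first by apply/mapP; exists i => //; rewrite mem_iota.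
by apply/mapP; exists a => //; rewrite mem_iota.
Qed.

Lemma mem_slots D k s : (s \in slots D k) = (size s == D) && all (fun i => i < k.+2) s.
Proof. by rewrite mem_tuples; congr (_ && _); apply: eq_all => i; rewrite mem_iota. Qed.

Lemma slot_objects D n k o : o \in objects D n k -> slot o \in slots D k.
Proof.
rewrite mem_objects mem_slots size_map => /andP[-> H]; rewrite all_map.
by apply: sub_all H => x /= /andP[].
Qed.

Lemma wsat_hit D n k F : all (all (fun t => (size t).*2 <= D)) F ->
  all (all (all (fun l => l.2 < n))) F -> wsat n F k ->
  exists Q, size Q <= size (slots D k) /\ all (has (mem Q)) (object_sets D n k F).
Proof.
move=> HD Hn [I [uI sI aI eI]].
(* Variables are shifted by one, so that 0 and [n.+1] serve as sentinels at the ranks 0 and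
   [k.+1]. *)
pose g := 0 :: rcons (map S (sort leq I)) n.+1.
have sg : size g = k.+2 by rewrite /= size_rcons size_map size_sort sI.
have mg i : i \in sort leq I -> i < n by rewrite mem_sort; apply: (allP aI).
have Sg : sorted ltn g.
  rewrite /g /= rcons_path; apply/andP; split.
    have : sorted ltn (sort leq I).
      by rewrite ltn_sorted_uniq_leq sort_uniq uI /= sort_sorted //; apply: leq_total.
    by case: (sort leq I) => //= x L H; rewrite path_map.
  have := mem_last 0 (map S (sort leq I)); rewrite inE => /orP[/eqP ->//|/mapP[i /mg Hi ->]].
  exact: Hi.
have Ag i : nth 0 g i < n.+2.
  have [H|H] := ltnP i (size g); last by rewrite nth_default.
  have := mem_nth 0 H; move: (nth 0 g i) => y; rewrite inE mem_rcons inE.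
  by case/or3P => [/eqP ->|/eqP ->|/mapP[j /mg Hj ->]] //; rewrite ltnS ltnW.
have Hcmp i j : i < k.+2 -> j < k.+2 -> (i < j) = (nth 0 g i < nth 0 g j).
  move=> Hi Hj; have Hlt a b : a < k.+2 -> b < k.+2 -> a < b -> nth 0 g a < nth 0 g b.
    by move=> Ha Hb; apply: (sorted_ltn_nth ltn_trans 0 Sg); rewrite inE sg.
  have [H|H|->] := ltngtP i j; last by rewrite ltnn.
  - by rewrite Hlt.
  - by have := Hlt _ _ Hj Hi H; lia.
(* The object with ranks [s] that tells the truth about the assignment; the hitting set consists of
   these, one for each slot. *)
pose w (s : seq nat) : seq item := [seq (i, nth 0 g i) | i <- s].
have sw s : slot (w s) = s by rewrite /slot -map_comp map_id_in.
have Ow s : s \in slots D k -> w s \in objects D n k.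
  rewrite mem_slots mem_objects size_map => /andP[-> Hs] /=; rewrite all_map.
  by apply: sub_all Hs => i /= ->; rewrite Ag.
have Cw s s' : s \in slots D k -> s' \in slots D k -> compat (w s) (w s').
  rewrite !mem_slots => /andP[_ /allP Hs] /andP[_ /allP Hs'].
  apply/allP => _ /mapP[i /Hs Hi ->]; apply/allP => _ /mapP[j /Hs' Hj ->] /=.
  by rewrite -!Hcmp // !eqxx.
exists (map w (slots D k)); split; first by rewrite size_map.
have mw s : s \in slots D k -> w s \in map w (slots D k) by apply: map_f.
rewrite /object_sets !all_cat; apply/and3P; split.
- apply/allP => _ /mapP[s Hs ->]; apply/hasP; exists (w s); last exact: mw.
  by rewrite mem_filter sw eqxx Ow.
- apply/allP => _ /flattenP[_ /mapP[o Ho ->] /mapP[s Hs ->]]; apply/hasP.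
  have Hso := slot_objects Ho.
  (* Either [o] is truthful, hence compatible with the truthful object of [s], or the truthful
     object with the ranks of [o] differs from [o]. *)
  have [E|E] := eqVneq (w (slot o)) o.
    exists (w s); last exact: mw.
    have Hc := Cw _ _ Hso Hs; rewrite E in Hc.
    by rewrite mem_filter Ow // sw eqxx Hc orbT.
  by exists (w (slot o)); [rewrite mem_filter Ow // sw eqxx E | apply: mw].
- apply/allP => _ /mapP[c Hc ->]; apply/hasP.
  have /hasP[t Ht Et] := allP eI _ Hc.
  (* A true variable needs only its own rank, listed twice; a false one needs the two ranks around
     its gap. *)
  have Hlit l : l \in t -> exists p : nat * nat, [/\ p.1 < k.+2, p.2 < k.+2 &
      forall o, (p.1, nth 0 g p.1) \in o -> (p.2, nth 0 g p.2) \in o -> sat_lit k o l].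
    move=> Hl; have Hln : l.2 < n by apply: (allP (allP (allP Hn _ Hc) _ Ht) _ Hl).
    have := allP Et _ Hl; case: l Hl Hln => [[] x] /= Hl Hx.
    - rewrite eqb_id => HxI.
      have Hi : index x (sort leq I) < k by rewrite -sI -(size_sort leq) index_mem mem_sort.
      exists ((index x (sort leq I)).+1, (index x (sort leq I)).+1); split; try by rewrite ltnS ltnW.
      move=> o Ho _; rewrite /sat_lit /=; apply/hasP; eexists; first exact: Ho.
      rewrite /= Hi nth_rcons size_map size_sort sI Hi (nth_map 0) ?size_sort ?sI //.
      by rewrite nth_index ?mem_sort // eqxx.
    - rewrite eqbF_neg => HxI.
      have [|||i [H1 H2 H3]] := @gap g x.+1.
      + by [].
      + by rewrite /g /= last_rcons.
      + rewrite /g inE mem_rcons inE !negb_or /= eqSS (ltn_eqF Hx) /=.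
        by rewrite mem_map ?mem_sort //; apply: succn_inj.
      rewrite sg in H1; exists (i, i.+1); split=> //; first exact: ltnW.
      move=> o Hi Hi1; rewrite /sat_lit /=; apply/hasP; eexists; first exact: Hi.
      apply/hasP; eexists; first exact: Hi1.
      by rewrite /= eqxx H2 H3.
  have [u [Hu1 Hu2 Hu3]] : exists u, [/\ size u = (size t).*2, all (fun i => i < k.+2) u &
      forall o, {subset w u <= o} -> all (sat_lit k o) t].
    elim: (t) Hlit => [|l t' IH] Hlit; first by exists [::].
    have [|u [H1 H2 H3]] := IH; first by move=> l' Hl'; apply: Hlit; rewrite inE Hl' orbT.
    have [|[i j] [Hi Hj Ho]] := Hlit l; first by rewrite inE eqxx.
    exists (i :: j :: u); split; rewrite /= ?H1 ?Hi ?Hj //.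
    move=> o Hsub; rewrite H3 ?Ho //; try by apply: Hsub; rewrite /= !inE eqxx ?orbT.
    by move=> x Hx; apply: Hsub; rewrite /= !inE Hx !orbT.
  pose s := u ++ nseq (D - size u) 0.
  have Hsize : size u <= D by rewrite Hu1; apply: (allP (allP HD _ Hc)).
  have Hs : s \in slots D k.
    by rewrite mem_slots size_cat size_nseq subnKC // eqxx all_cat Hu2 all_nseq orbT.
  exists (w s); last exact: mw.
  rewrite mem_filter Ow // andbT; apply/hasP; exists t => //.
  by apply: Hu3 => x Hx; rewrite /w map_cat mem_cat Hx.
Qed.

Lemma uniq_map_inj (X Y : eqType) (f : X -> Y) (s : seq X) :
  uniq (map f s) -> {in s &, injective f}.
Proof.
elim: s => //= x s IH /andP[Hx /IH{}IH] y z; rewrite !inE.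
have Hn w : w \in s -> f w <> f x by move=> Hw E; move: Hx; rewrite -E map_f.
move=> /orP[/eqP ->|Hy] /orP[/eqP ->|Hz] // E; last exact: IH.
- by case: (Hn _ Hz).
- by case: (Hn _ Hy).
Qed.

Lemma hit_wsat D n k F : 0 < D ->
  (exists Q, size Q <= size (slots D k) /\ all (has (mem Q)) (object_sets D n k F)) ->
  wsat n F k.
Proof.
move=> HD [Q [sQ]]; rewrite /object_sets !all_cat => /and3P[H1 H2 H3].
have Sl s : s \in slots D k -> exists2 o, o \in Q & o \in objects D n k /\ slot o = s.
  move=> Hs; have /hasP[o] := allP H1 _ (map_f _ Hs).
  by rewrite mem_filter => /andP[/eqP Eo Ho] HQ; exists o.
have uS : uniq (slots D k) by apply: tuples_uniq; apply: iota_uniq.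
(* Every slot occurs in [Q], and [Q] has at most as many members as there are slots, so no slot
   occurs twice. *)
have uQ : uniq (map slot Q).
  apply: (leq_size_uniq uS); last by rewrite size_map.
  by move=> s /Sl[o Ho [_ <-]]; apply: map_f.
have Qinj := uniq_map_inj uQ.
have CQ o o' : o \in Q -> o \in objects D n k -> o' \in Q -> o' \in objects D n k -> compat o o'.
  move=> HoQ HoO Ho'Q Ho'O.
  have Hs : [seq o2 <- objects D n k | (slot o2 == slot o) && (o2 != o) || (slot o2 == slot o') && compat o o2]
     \in flatten [seq [seq [seq o2 <- objects D n k | (slot o2 == slot o) && (o2 != o) || (slot o2 == s) && compat o o2]
        | s <- slots D k] | o <- objects D n k].
    apply/flattenP; exists [seq [seq o2 <- objects D n k | (slot o2 == slot o) && (o2 != o) || (slot o2 == s) && compat o o2]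
        | s <- slots D k]; first by apply/mapP; exists o.
    by apply/mapP; exists (slot o') => //; apply: slot_objects Ho'O.
  have /hasP[o2] := allP H2 _ Hs; rewrite mem_filter => /andP[Hc Ho2] Ho2Q.
  case/orP: Hc => /andP[/eqP E]; last by rewrite (Qinj _ _ Ho2Q Ho'Q E).
  by rewrite (Qinj _ _ Ho2Q HoQ E) eqxx.
have base i : i < k.+2 -> nseq D i \in slots D k.
  by move=> Hi; rewrite mem_slots size_nseq eqxx all_nseq Hi orbT.
(* The object with the constant tuple of [i] tells the value of rank [i]; [0 < D] ensures that it
   has a first item. *)
pose ob i := nth [::] Q (find (fun o => slot o == nseq D i) Q).
pose gam i := (head (0, 0) (ob i)).2.
have Hob i : i < k.+2 -> [/\ ob i \in Q, ob i \in objects D n k & (i, gam i) \in ob i].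
  move=> Hi; have [o HoQ [HoO Es]] := Sl _ (base _ Hi).
  have Hh : has (fun o => slot o == nseq D i) Q by apply/hasP; exists o => //; rewrite Es.
  have E1 : slot (ob i) = nseq D i by apply/eqP; exact: nth_find Hh.
  have Q1 : ob i \in Q by apply: mem_nth; rewrite -has_find.
  have E2 : ob i = o by apply: Qinj => //; rewrite E1 Es.
  split=> //; first by rewrite E2.
  rewrite /gam; move: E1; case: (ob i) => [|[a b] t] /=; first by case: (D) HD.
  by case: (D) HD => // D' _ [-> _]; rewrite inE eqxx.
have cmp o i a j : o \in Q -> o \in objects D n k -> (i, a) \in o -> j < k.+2 ->
    (i < j) = (a < gam j) /\ (j < i) = (gam j < a).
  move=> HoQ HoO Hi Hj; have [Q1 O1 I1] := Hob _ Hj.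
  have /allP/(_ _ Hi)/allP/(_ _ I1)/= := CQ _ _ HoQ HoO Q1 O1.
  by case/andP => /eqP -> /eqP ->.
have mono i j : i < k.+2 -> j < k.+2 -> (i < j) = (gam i < gam j).
  move=> Hi Hj; have [Q1 O1 I1] := Hob _ Hi.
  by have [] := cmp _ _ _ _ Q1 O1 I1 Hj.
(* Compatibility of an item with the constant object of the same rank excludes both strict
   inequalities between the values, so all chosen objects agree with [gam]. *)
have val o i a : o \in Q -> o \in objects D n k -> (i, a) \in o -> i < k.+2 /\ a = gam i.
  move=> HoQ HoO Hi; have Hik : i < k.+2.
    by move: HoO; rewrite mem_objects => /andP[_ /allP/(_ _ Hi)/andP[]].
  by split=> //; have [] := cmp _ _ _ _ HoQ HoO Hi Hik; rewrite ltnn; lia.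
have pos i : 0 < i -> i < k.+2 -> 0 < gam i.
  by move=> H0 Hi; have := mono 0 i isT Hi; rewrite H0; lia.
have memI x : (x \in [seq (gam i).-1 | i <- iota 1 k]) <-> exists2 i, 0 < i <= k & x.+1 = gam i.
  split=> [/mapP[i]|[i /andP[H0 Hi] E]].
    rewrite mem_iota => /andP[H0 Hi] ->; exists i; first by rewrite H0; lia.
    by rewrite prednK // pos //; lia.
  apply/mapP; exists i; first by rewrite mem_iota; lia.
  by rewrite -E.
exists [seq (gam i).-1 | i <- iota 1 k]; split.
- rewrite map_inj_in_uniq ?iota_uniq // => i j; rewrite !mem_iota => /andP[Hi0 Hi] /andP[Hj0 Hj] E.
  have := mono i j; have := mono j i; have := pos i Hi0; have := pos j Hj0.
  by move=> /(_ _)A1 /(_ _)A2 /(_ _ _)A3 /(_ _ _)A4; lia.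
- by rewrite size_map size_iota.
- apply/allP => x /memI[i /andP[H0 Hi] E].
  have Hm : gam i < gam k.+1 by rewrite -mono // ltnS leqW.
  have [_ O1 I1] := Hob k.+1 (leqnn _).
  move: O1; rewrite mem_objects => /andP[_ /allP/(_ _ I1)/andP[_ /=]].
  lia.
- apply/allP => c Hc; have /hasP[o] := allP H3 _ (map_f _ Hc).
  rewrite mem_filter => /andP[/hasP[t Ht Hs] HoO] HoQ; apply/hasP; exists t => //.
  apply/allP => -[b x] /(allP Hs); rewrite /sat_lit /=; case: b.
    case/hasP => -[i a] Hi /= /andP[/andP[H0 Hik] /eqP Ea]; rewrite eqb_id; apply/memI.
    by exists i; [rewrite H0 | have [_ <-] := val _ _ _ HoQ HoO Hi].
  (* If the variable were chosen with rank [m], monotonicity of [gam] would place [m] strictly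
     between [i] and [i.+1]. *)
  case/hasP => -[i a] Hi /hasP[[j b] Hj] /= /and3P[/eqP Ej Ha Hb]; rewrite eqbF_neg.
  apply/negP => /memI[m /andP[H0 Hm] E].
  have [Hi2 Ea] := val _ _ _ HoQ HoO Hi; have [Hj2 Eb] := val _ _ _ HoQ HoO Hj.
  have Hm2 : m < k.+2 by rewrite ltnS leqW.
  rewrite E Ea -mono // in Ha; rewrite E Eb -mono // Ej in Hb.
  by rewrite ltnS leqNgt Ha in Hb.
Qed.

Definition hit_sets (D n k : nat) (F : ixcnf) : seq (seq nat) :=
  [seq [seq index o (objects D n k) | o <- s] | s <- object_sets D n k F].

Lemma object_sets_sub D n k F s o : s \in object_sets D n k F -> o \in s -> o \in objects D n k.
Proof.
rewrite /object_sets !mem_cat => /or3P[/mapP[? _ ->]|/flattenP[_ /mapP[? _ ->] /mapP[? _ ->]]|/mapP[? _ ->]];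
  by rewrite mem_filter => /andP[].
Qed.

Lemma hittingP D n k F :
  hitting (hit_sets D n k F) (size (slots D k)) <->
  exists Q, size Q <= size (slots D k) /\ all (has (mem Q)) (object_sets D n k F).
Proof.
have Hsub := @object_sets_sub D n k F; set O := objects D n k in Hsub *.
split=> [[Q [sQ /allP HQ]]|[Q [sQ /allP HQ]]].
- exists (map (nth [::] O) Q); split; first by rewrite size_map.
  apply/allP => s Hs; have /hasP[_ /mapP[o Ho ->] HoQ] := HQ _ (map_f _ Hs).
  apply/hasP; exists o => //; apply/mapP; exists (index o O) => //.
  by rewrite nth_index //; apply: Hsub Ho.
- exists (map (index^~ O) Q); split; first by rewrite size_map.
  apply/allP => _ /mapP[s Hs ->]; have /hasP[o Ho HoQ] := HQ _ Hs.
  by apply/hasP; exists (index o O); apply: map_f.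
Qed.

Lemma wsat_hitting D n k F : 0 < D -> all (all (fun t => (size t).*2 <= D)) F ->
  all (all (all (fun l => l.2 < n))) F ->
  wsat n F k <-> hitting (hit_sets D n k F) (size (slots D k)).
Proof.
by move=> H1 H2 H3; rewrite hittingP; split; [apply: wsat_hit | apply: hit_wsat].
Qed.

Lemma hit_sets_lt D n k F : all (all (fun j => j < size (objects D n k))) (hit_sets D n k F).
Proof.
apply/allP => _ /mapP[s Hs ->]; apply/allP => _ /mapP[o Ho ->].
by rewrite index_mem; apply: object_sets_sub Hs Ho.
Qed.

(** The voter problems must spend the budget exactly, which requires that there be at least as many
    objects as the budget. *)
Lemma slots_le_objects D n k : size (slots D k) <= size (objects D n k).
Proof.
pose z (s : seq nat) : seq item := [seq (i, 0) | i <- s].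
have zi : injective z by apply: inj_map => i j [].
rewrite -(size_map z); apply: uniq_leq_size; first by rewrite map_inj_uniq // tuples_uniq ?iota_uniq.
move=> _ /mapP[s Hs ->]; move: Hs; rewrite mem_slots mem_objects size_map => /andP[-> H] /=.
by rewrite all_map; apply: sub_all H => i /= ->.
Qed.

(** * Weighted majority graphs *)

Lemma prefers_cat (s1 s2 : seq nat) (a b : nat) : prefers (s1 ++ s2) a b =
  if a \in s1 then (if b \in s1 then prefers s1 a b else true)
  else (if b \in s1 then false else prefers s2 a b).
Proof.
rewrite /prefers !index_cat.
case Ha: (a \in s1); case Hb: (b \in s1) => //.
- by rewrite ltn_addr // index_mem.
- by apply/negbTE; rewrite -leqNgt; apply: ltnW; rewrite ltn_addr // index_mem.
- by rewrite ltn_add2l.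
Qed.

Lemma prefersN (s : seq nat) (a b : nat) : a != b -> (a \in s) || (b \in s) -> prefers s b a = ~~ prefers s a b.
Proof.
move=> Hab Hs; rewrite /prefers -leqNgt [RHS]leq_eqVlt; case: eqP => //= E.
have H (x y : nat) : x \in s -> index y s = index x s -> x = y.
  move=> Hx Hi; have Hy : y \in s by rewrite -index_mem Hi index_mem.
  by rewrite -[x](nth_index 0 Hx) -Hi nth_index.
case/orP: Hs => H1; first by rewrite (H a b H1 E) eqxx in Hab.
by rewrite (H b a H1 (esym E)) eqxx in Hab.
Qed.

Lemma prefers_rev (s : seq nat) (a b : nat) : uniq s -> a \in s -> b \in s -> prefers (rev s) a b = prefers s b a.
Proof.
move=> Hu; have H (c : nat) : c \in s -> index c (rev s) = size s - (index c s).+1.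
  move=> Hc; have Hi : index c s < size s by rewrite index_mem.
  have E : nth 0 (rev s) (size s - (index c s).+1) = c.
    rewrite nth_rev; last by lia.
    have -> : size s - (size s - (index c s).+1).+1 = index c s by lia.
    exact: nth_index.
  by rewrite -{1}E index_uniq ?rev_uniq // size_rev ltn_subrL (leq_ltn_trans _ Hi).
move=> Ha Hb; rewrite /prefers !H //; move: Ha Hb; rewrite -!index_mem.
by move: (index a s) (index b s) (size s) => i j n; lia.
Qed.

Definition sgn (v : seq nat) (a b : nat) : int := ((prefers v a b)%:Z - (prefers v b a)%:Z)%R.

Lemma WMG_nil a b : WMG [::] a b = 0%R. Proof. by []. Qed.

Lemma WMG_cons v V a b : WMG (v :: V) a b = (sgn v a b + WMG V a b)%R.
Proof. by rewrite /WMG /sgn /= !PoszD; lia. Qed.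

Lemma WMG_cat V1 V2 a b : WMG (V1 ++ V2) a b = (WMG V1 a b + WMG V2 a b)%R.
Proof. by rewrite /WMG !count_cat !PoszD; lia. Qed.

Lemma WMG_anti V a b : WMG V b a = (- WMG V a b)%R.
Proof. by rewrite /WMG; lia. Qed.

Lemma sgn_bound v a b : (- 1 <= sgn v a b <= 1)%R.
Proof. by rewrite /sgn; case: prefers; case: prefers. Qed.

Lemma WMG_bound V a b : (- (size V)%:Z <= WMG V a b <= (size V)%:Z)%R.
Proof.
elim: V => [|v V IH]; first by rewrite WMG_nil.
rewrite WMG_cons; have := sgn_bound v a b; rewrite /=; lia.
Qed.

Lemma sgnE (v : seq nat) (a b : nat) : a != b -> (a \in v) || (b \in v) ->
  sgn v a b = (if prefers v a b then 1 else - 1)%R.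
Proof. by move=> H1 H2; rewrite /sgn (prefersN H1 H2); case: prefers. Qed.

Lemma sgn_rev (v : seq nat) (a b : nat) : uniq v -> a \in v -> b \in v -> sgn (rev v) a b = (- sgn v a b)%R.
Proof. by move=> Hu Ha Hb; rewrite /sgn !prefers_rev //; lia. Qed.

(* McGarvey's construction: two votes whose majority graph is A x B. *)
Definition vote_pair (X A B Y : seq nat) : seq (seq nat) :=
  [:: X ++ A ++ B ++ Y; rev Y ++ rev A ++ rev B ++ rev X].

Definition edge (A B : seq nat) (a b : nat) : int :=
  (2 * ((a \in A) && (b \in B))%:Z - 2 * ((a \in B) && (b \in A))%:Z)%R.

(** The second vote is the reverse of the first except that [A] stays before [B], so all other pairs
    cancel. The proof runs through the blocks that contain [a] and [b]. *)
Lemma WMG_pair (X A B Y : seq nat) (a b : nat) : uniq (X ++ A ++ B ++ Y) ->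
  a \in X ++ A ++ B ++ Y -> b \in X ++ A ++ B ++ Y ->
  WMG (vote_pair X A B Y) a b = edge A B a b.
Proof.
have Hblk (c : nat) : uniq (X ++ A ++ B ++ Y) -> c \in X ++ A ++ B ++ Y ->
  [|| [&& c \in X, c \notin A, c \notin B & c \notin Y],
      [&& c \notin X, c \in A, c \notin B & c \notin Y],
      [&& c \notin X, c \notin A, c \in B & c \notin Y] |
      [&& c \notin X, c \notin A, c \notin B & c \in Y]].
  rewrite !cat_uniq !mem_cat !has_cat => /and3P[_ H1 /and3P[_ H2 /and3P[_ H3 _]]].
  move: H1 H2; rewrite !negb_or => /and3P[XA XB XY] /andP[AB AY].
  have N (s t : seq nat) : ~~ has (mem s) t -> c \in t -> c \notin s.
    by move=> /hasPn H /H.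
  by case/or4P => H; have := N _ _ XA; have := N _ _ XB; have := N _ _ XY;
    have := N _ _ AB; have := N _ _ AY; have := N _ _ H3; rewrite H;
    case: (c \in X); case: (c \in A); case: (c \in B); case: (c \in Y) => // *; exfalso; auto.
move=> Hu Ha Hb; have := Hblk a Hu Ha; have := Hblk b Hu Hb.
have [UX [UA [UB UY]]] : uniq X /\ uniq A /\ uniq B /\ uniq Y.
  by move: Hu; rewrite !cat_uniq => /and3P[-> _ /and3P[-> _ /and3P[-> _ ->]]].
rewrite /vote_pair !WMG_cons WMG_nil /sgn !prefers_cat !mem_rev /edge.
case/or4P => /and4P[b1 b2 b3 b4]; case/or4P => /and4P[a1 a2 a3 a4];
  rewrite ?(negbTE a1) ?(negbTE a2) ?(negbTE a3) ?(negbTE a4) ?a1 ?a2 ?a3 ?a4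
          ?(negbTE b1) ?(negbTE b2) ?(negbTE b3) ?(negbTE b4) ?b1 ?b2 ?b3 ?b4 //=;
  by rewrite ?prefers_rev //; do 2?case: (prefers _ _ _).
Qed.

Lemma perm_vote_pair X A B Y C v : perm_eq (X ++ A ++ B ++ Y) C ->
  v \in vote_pair X A B Y -> perm_eq v C.
Proof.
move=> HC; rewrite !inE => /orP[] /eqP -> //; apply: perm_trans HC.
apply/permP => P; rewrite !count_cat !count_rev; lia.
Qed.

Definition times (n : nat) (V : seq (seq nat)) : seq (seq nat) := flatten [seq V | _ <- iota 0 n].

Lemma WMG_times n V a b : WMG (times n V) a b = (n%:Z * WMG V a b)%R.
Proof.
rewrite /times; elim: n 0 => [|n IH] i; first by rewrite /= WMG_nil mul0r.
by rewrite /= WMG_cat IH; lia.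
Qed.

Lemma mem_times n V v : v \in times n V -> v \in V.
Proof. by case/flattenP => _ /mapP[i _ ->]. Qed.

(** * Strengths of paths *)

(** The only upper bound on strengths used below: together with [path_last] it confines the analysis
    of a path to the candidate before its end. *)
Lemma strength_rcons V c s d : (strength V c (rcons s d) <= WMG V (last c s) d)%R.
Proof.
rewrite /strength; have Hmin (w : int) ws x : x \in w :: ws -> (foldl Order.min w ws <= x)%R.
  elim: ws w x => [|y ws IH] w x; first by rewrite inE => /eqP ->.
  have Hw (v : int) : (foldl Order.min v ws <= v)%R by apply: IH; rewrite inE eqxx.
  rewrite !inE /= => /or3P[/eqP ->|/eqP ->|Hx].
  - by apply: le_trans (Hw _) _; rewrite ge_min lexx.
  - by apply: le_trans (Hw _) _; rewrite ge_min lexx orbT.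
  - by apply: IH; rewrite inE Hx orbT.
have E : pairmap (WMG V) c (rcons s d) = rcons (pairmap (WMG V) c s) (WMG V (last c s) d).
  by elim: s c => //= y s IH c; rewrite IH.
rewrite E; case: (pairmap _ _ _) => [|w ws] //=.
by apply: Hmin; rewrite inE mem_rcons inE eqxx orbT.
Qed.

Lemma strength1 V c d : strength V c [:: d] = WMG V c d. Proof. by []. Qed.

Lemma strength2 V c d e : strength V c [:: d; e] = Order.min (WMG V c d) (WMG V d e).
Proof. by []. Qed.

Lemma path_last C c d s : is_path C c d s -> c != d ->
  exists x s', [/\ s = rcons s' d, x = last c s', x \in C & x != d].
Proof.
case/and4P; case: (lastP s) => // s' y _; rewrite last_rcons => /eqP -> Hu Ha Hcd.
exists (last c s'), s'; split=> //.
  apply: (allP Ha); rewrite -rcons_cons mem_rcons inE mem_last orbT //.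
move: Hu; rewrite -rcons_cons rcons_uniq => /andP[Hd _].
by apply: contraNneq Hd => <-; apply: mem_last.
Qed.

Lemma is_path1 (K : seq nat) (a b : nat) : a != b -> a \in K -> b \in K -> is_path K a b [:: b].
Proof. by move=> H Ha Hb; rewrite /is_path /= eqxx inE H Ha Hb. Qed.

Lemma is_path2 (K : seq nat) (a c b : nat) : a != c -> a != b -> c != b ->
  a \in K -> c \in K -> b \in K -> is_path K a b [:: c; b].
Proof.
by move=> H1 H2 H3 Ha Hc Hb; rewrite /is_path /= eqxx !inE negb_or H1 H2 H3 Ha Hb Hc.
Qed.

Lemma prefers_filter (P : pred nat) v a b : P a -> P b -> prefers (filter P v) a b = prefers v a b.
Proof.
move=> Ha Hb; elim: v => // x v IH.
have -> : filter P (x :: v) = (if P x then [:: x] else [::]) ++ filter P v by rewrite /=; case: ifP.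
rewrite -[x :: v]cat1s; case: ifP => Hx; first by rewrite !prefers_cat IH.
rewrite cat0s IH [RHS]prefers_cat !inE; have [E|_] := eqVneq a x; first by rewrite -E Ha in Hx.
by have [E|_] := eqVneq b x; first by rewrite -E Hb in Hx.
Qed.

Lemma WMG_filter (P : pred nat) V a b : P a -> P b -> WMG (map (filter P) V) a b = WMG V a b.
Proof.
move=> Ha Hb; elim: V => // v V IH; rewrite map_cons !WMG_cons IH; congr (_ + _)%R.
by rewrite /sgn !prefers_filter.
Qed.

Lemma count_split (T S : Type) (p : pred S) (f : T -> S) (P : pred T) s :
  count p (map f s) = count p (map f (filter P s)) + count p (map f (filter (fun x => ~~ P x) s)).
Proof. by elim: s => //= x s ->; case: (P x) => /=; lia. Qed.

(** * Adding candidates *)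

(* Candidates: 0 is the distinguished candidate, j + 1 stands for the j-th set, and
   m + o + 1 for the o-th object, which can be added. *)
Definition ac_clauses m : seq nat := [seq j.+1 | j <- iota 0 m].
Definition ac_objects m N : seq nat := [seq (m + o).+1 | o <- iota 0 N].
Definition ac_hits (sets : seq (seq nat)) N j : seq nat :=
  [seq (size sets + o).+1 | o <- [seq o <- iota 0 N | has (fun x => x == o) (nth [::] sets j)]].
Definition ac_rest (sets : seq (seq nat)) N j : seq nat :=
  [seq (size sets + o).+1 | o <- [seq o <- iota 0 N | ~~ has (fun x => x == o) (nth [::] sets j)]] ++
  0 :: [seq i.+1 | i <- [seq i <- iota 0 (size sets) | ~~ (i == j)]].
(** All majority edges get the same weight 2 and all other pairs tie, so no strength exceeds 2, and
    a path has strength 2 iff it follows majority edges throughout. *)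
Definition ac_votes (sets : seq (seq nat)) N : seq (seq nat) :=
  let m := size sets in
  vote_pair [::] (ac_clauses m) [:: 0] (ac_objects m N) ++
  (vote_pair [::] [:: 0] (ac_objects m N) (ac_clauses m) ++
   flatten [seq vote_pair [::] (ac_hits sets N j) [:: j.+1] (ac_rest sets N j) | j <- iota 0 m]).

Section AddCandidates.
Variables (sets : seq (seq nat)) (N : nat).
Notation m := (size sets).
Notation Cl := (ac_clauses m).
Notation Ob := (ac_objects m N).
Notation C := (0 :: Cl).

Lemma ac_uniq : uniq (C ++ Ob).
Proof.
have E1 : Cl = iota 1 m by rewrite -[1]addn0 iotaDl; apply: eq_map => i; rewrite add1n.
have E2 : Ob = iota m.+1 N by rewrite -[m.+1]addn0 iotaDl; apply: eq_map => i; rewrite addSn.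
have -> : C ++ Ob = iota 0 (m + N).+1 by rewrite E1 E2 /= iotaD add1n.
exact: iota_uniq.
Qed.

Lemma ac_mem_Cl a : (a \in Cl) = (0 < a <= m).
Proof.
apply/mapP/idP => [[j]|H]; first by rewrite mem_iota => H ->; lia.
by exists a.-1; rewrite ?mem_iota; lia.
Qed.

Lemma ac_mem_Ob a : (a \in Ob) = (m < a <= m + N).
Proof.
apply/mapP/idP => [[j]|H]; first by rewrite mem_iota => H ->; lia.
by exists (a - m.+1); rewrite ?mem_iota; lia.
Qed.

Lemma ac_mem_hits a j : (a \in ac_hits sets N j) = (m < a <= m + N) && (a - m.+1 \in nth [::] sets j).
Proof.
apply/mapP/idP => [[o]|/andP[H1 H2]].
  rewrite mem_filter has_pred1 mem_iota => /andP[H1 H2] ->.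
  by rewrite subSS addKn H1 andbT; lia.
exists (a - m.+1); last by lia.
by rewrite mem_filter has_pred1 H2 mem_iota; lia.
Qed.

Lemma ac_perm1 : perm_eq ([::] ++ Cl ++ [:: 0] ++ Ob) (C ++ Ob).
Proof. by apply/permP => p; rewrite /= !count_cat /=; lia. Qed.

Lemma ac_perm2 : perm_eq ([::] ++ [:: 0] ++ Ob ++ Cl) (C ++ Ob).
Proof. by apply/permP => p; rewrite /= !count_cat /=; lia. Qed.

Lemma ac_perm3 j : j < m ->
  perm_eq ([::] ++ ac_hits sets N j ++ [:: j.+1] ++ ac_rest sets N j) (C ++ Ob).
Proof.
move=> Hj; apply/permP => p; rewrite /= /ac_rest !count_cat /= !count_cat /=.
rewrite [count p Ob](count_split _ _ (fun o => has (fun x => x == o) (nth [::] sets j))).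
rewrite [count p Cl](count_split _ _ (fun i => i == j)).
have -> : [seq x <- iota 0 m | x == j] = [:: j].
  by rewrite (filter_pred1_uniq (iota_uniq _ _)) // mem_iota.
rewrite /ac_hits /=; lia.
Qed.

Lemma ac_valid : valid_votes (C ++ Ob) (ac_votes sets N).
Proof.
rewrite /valid_votes /ac_votes !all_cat; apply/and3P; split.
- by apply/allP => v; apply: perm_vote_pair ac_perm1.
- by apply/allP => v; apply: perm_vote_pair ac_perm2.
- apply/allP => v /flattenP[_ /mapP[j Hj ->]]; apply: perm_vote_pair; apply: ac_perm3.
  by move: Hj; rewrite mem_iota.
Qed.

Definition ac_edge (a b : nat) : bool :=
  [|| (0 < a <= m) && (b == 0), (a == 0) && (m < b <= m + N)
    | [&& m < a <= m + N, 0 < b <= m & a - m.+1 \in nth [::] sets b.-1]].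

Lemma ac_WMG a b : a \in C ++ Ob -> b \in C ++ Ob ->
  WMG (ac_votes sets N) a b = (2 * (ac_edge a b)%:Z - 2 * (ac_edge b a)%:Z)%R.
Proof.
move=> Ha Hb; have Hu := ac_uniq.
have Hp X A B Y : perm_eq (X ++ A ++ B ++ Y) (C ++ Ob) ->
    WMG (vote_pair X A B Y) a b = edge A B a b.
  by move=> H; apply: WMG_pair; rewrite ?(perm_uniq H) ?(perm_mem H).
rewrite /ac_votes !WMG_cat (Hp _ _ _ _ ac_perm1) (Hp _ _ _ _ ac_perm2).
(* The hit edges are restricted to the first [n] sets, so that the contributions of the sets can be
   added up by induction. *)
pose h a b n := [&& m < a <= m + N, 0 < b <= n & a - m.+1 \in nth [::] sets b.-1].
have -> : WMG (flatten [seq vote_pair [::] (ac_hits sets N j) [:: j.+1] (ac_rest sets N j) | j <- iota 0 m]) a b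
    = (2 * (h a b m)%:Z - 2 * (h b a m)%:Z)%R.
  have : m <= m by [].
  elim: {1 3 4 5}m => [|n IH] Hn.
    by rewrite /h /= !(leqn0, andbF, lt0n) ?andNb ?andbN /= ?andbF WMG_nil; lia.
  rewrite -addn1 iotaD map_cat flatten_cat WMG_cat IH; last by lia.
  have -> : flatten [seq vote_pair [::] (ac_hits sets N j) [:: j.+1] (ac_rest sets N j)
      | j <- iota (0 + n) 1] = vote_pair [::] (ac_hits sets N n) [:: n.+1] (ac_rest sets N n) by [].
  rewrite Hp; last exact: ac_perm3.
  have Hh x y : (h x y n.+1 : nat) = h x y n + ((x \in ac_hits sets N n) && (y == n.+1)).
    rewrite /h ac_mem_hits; case: (m < x <= m + N); rewrite ?andFb ?andTb //.
    have [->|Hy] := eqVneq y n.+1; first by rewrite ltnn leqnn /= andbT.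
    have -> : (0 < y <= n.+1) = (0 < y <= n) by lia.
    by rewrite andbF addn0.
  rewrite addn1 !Hh /edge !inE; lia.
rewrite /edge /ac_edge /h !inE !ac_mem_Cl !ac_mem_Ob.
move: Ha Hb; rewrite !mem_cat !inE !ac_mem_Cl !ac_mem_Ob -!orbA.
move: (a - m.+1 \in _) (b - m.+1 \in _) => x y.
by case/or3P => [/eqP ->|Ha|Ha]; case/or3P => [/eqP ->|Hb|Hb]; case: x; case: y; lia.
Qed.

Lemma ac_edge_hit a d : m < a <= m + N -> 0 < d <= m ->
  ac_edge a d = (a - m.+1 \in nth [::] sets d.-1) /\ ac_edge d a = false.
Proof.
move=> Ha Hd; rewrite /ac_edge Ha Hd.
have -> : (d == 0) = false by lia.
have -> : (a == 0) = false by lia.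
have -> : (m < d) = false by lia.
by rewrite !andbF.
Qed.

Lemma ac_edge_leader a : m < a <= m + N -> ac_edge 0 a /\ ac_edge a 0 = false.
Proof.
move=> Ha; rewrite /ac_edge Ha; split=> //.
have -> : (0 < a <= m) = false by lia.
have -> : (a == 0) = false by lia.
by rewrite !andbF.
Qed.

Lemma ac_edge_back d : 0 < d <= m -> ac_edge d 0 /\ ac_edge 0 d = false.
Proof.
move=> Hd; rewrite /ac_edge Hd; split=> //.
have -> : (m < d) = false by lia.
by rewrite !andbF.
Qed.

Hypothesis sets_lt : all (all (fun o => o < N)) sets.

Lemma ac_hitting k : hitting sets k <-> exists msk : bitseq,
  size (mask msk Ob) <= k /\
  let CE := C ++ mask msk Ob in
  schulze_winner CE (map (filter (fun c => c \in CE)) (ac_votes sets N)) 0.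
Proof.
have sub (E : seq nat) (a : nat) : subseq E Ob -> a \in C ++ E -> a \in C ++ Ob.
  by move=> HE; rewrite !mem_cat => /orP[->|/(mem_subseq HE) ->] //; rewrite orbT.
have WE (E : seq nat) (a b : nat) : subseq E Ob -> a \in C ++ E -> b \in C ++ E ->
    WMG (map (filter (fun c => c \in C ++ E)) (ac_votes sets N)) a b =
    (2 * (ac_edge a b)%:Z - 2 * (ac_edge b a)%:Z)%R.
  by move=> HE Ha Hb; rewrite WMG_filter // ac_WMG //; apply: (sub E).
split=> [[Q [sQ HQ]]|[msk [Hs [_ Hw]]]].
- pose L := [seq o <- iota 0 N | o \in Q].
  have EL : mask [seq o \in Q | o <- iota 0 N] Ob = [seq (m + o).+1 | o <- L].
    by rewrite /ac_objects -map_mask /L filter_mask.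
  exists [seq o \in Q | o <- iota 0 N]; split.
    rewrite EL size_map; apply: leq_trans sQ; apply: uniq_leq_size.
      by rewrite filter_uniq ?iota_uniq.
    by move=> o; rewrite mem_filter => /andP[].
  have HE : subseq (mask [seq o \in Q | o <- iota 0 N] Ob) Ob by apply: mask_subseq.
  rewrite /=; split; first by rewrite !inE.
  have {}WE := fun a b : nat => WE _ a b HE.
  set E := mask _ _ in HE WE EL *; set V := map _ _ in WE *.
  suff main (d : nat) : d \in C ++ E -> d != 0 -> exists s : seq nat,
      is_path (C ++ E) 0 d s /\
      forall s', is_path (C ++ E) d 0 s' -> (strength V d s' <= strength V 0 s)%R.
    by move=> d; apply: main.
  move=> Hd Hd0.
  have H0 : 0 \in C ++ E by rewrite inE.
  (* No margin exceeds 2, so it suffices to find a path of strength 2 from 0 to [d]. *)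
  have Hback s' : is_path (C ++ E) d 0 s' -> (strength V d s' <= 2)%R.
    move=> /path_last/(_ Hd0)[x [s2 [-> -> Hx _]]]; apply: le_trans (strength_rcons _ _ _ _) _.
    by rewrite WE //; case: ac_edge; case: ac_edge.
  suff [s [Hp H2]] : exists s, is_path (C ++ E) 0 d s /\ (2 <= strength V 0 s)%R.
    by exists s; split=> // s' /Hback H; apply: le_trans H H2.
  have HEd (a : nat) : a \in E -> m < a <= m + N /\ a - m.+1 \in Q.
    rewrite EL => /mapP[o]; rewrite mem_filter mem_iota => /andP[HoQ Ho] ->.
    by rewrite subSS addKn; split=> //; lia.
  have Hone (a : nat) : a \in E -> (2 <= WMG V 0 a)%R.
    move=> Ha; have [Ha1 Ha2] := HEd _ Ha.
    by rewrite WE ?mem_cat ?Ha ?orbT //; have [-> ->] := ac_edge_leader Ha1.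
  have : d \in C ++ E by []; rewrite mem_cat => /orP[HdC|HdE]; last first.
    exists [:: d]; split; last exact: Hone.
    by apply: is_path1; rewrite 1?eq_sym // mem_cat HdE orbT.
  have Hdm : 0 < d <= m by move: HdC; rewrite inE (negbTE Hd0) ac_mem_Cl.
  have Hj0 : d.-1 < m by lia.
  have Hj : nth [::] sets d.-1 \in sets by apply: mem_nth.
  have /hasP[o Ho HoQ] := allP HQ _ Hj.
  have HoN := allP (allP sets_lt _ Hj) _ Ho.
  pose a := (m + o).+1.
  have Ha : a \in E by rewrite EL; apply/mapP; exists o => //; rewrite mem_filter mem_iota; apply/andP.
  exists [:: a; d]; split.
    have Had : a != d by rewrite /a; clear -Hdm; lia.
    by apply: (is_path2 (isT : 0 != a) _ Had); rewrite ?mem_cat ?Ha ?HdC ?orbT // eq_sym.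
  rewrite strength2 le_min Hone // WE ?mem_cat ?Ha ?HdC ?orbT //.
  have [Ha1 _] := HEd _ Ha; have [-> ->] := ac_edge_hit Ha1 Hdm.
  by rewrite /a subSS addKn Ho.
- have HE : subseq (mask msk Ob) Ob by apply: mask_subseq.
  set E := mask _ _ in HE Hs Hw; have {}WE := fun a b : nat => WE _ a b HE.
  exists [seq a - m.+1 | a <- E]; split; first by rewrite size_map.
  apply/(all_nthP [::]) => j Hj.
  have Hjm : j < m by [].
  have Hd : j.+1 \in C ++ E by rewrite mem_cat inE ac_mem_Cl; apply/orP; left; lia.
  have [s [Hp Hs']] := Hw _ Hd isT.
  (* The edge from a set candidate straight to 0 has weight 2, which obliges 0 to have a path of
     that strength to it. The last edge of this path can only come from an object that hits the
     set. *)
  have Hp0 : is_path (C ++ E) j.+1 0 [:: 0] by apply: is_path1; rewrite ?inE.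
  have {Hp0}Hs' := Hs' _ Hp0; rewrite strength1 WE ?inE // in Hs'.
  have [x [s2 [Es Ex Hx Hxd]]] := path_last Hp isT.
  have H2 := le_trans Hs' (_ : (strength _ 0 s <= _)%R).
  have {}H2 := H2 _ (eq_ind_r (fun s => (strength _ 0 s <= _)%R) (strength_rcons _ _ _ _) Es).
  rewrite -Ex WE // in H2.
  have Hxm : m < x <= m + N /\ x - m.+1 \in nth [::] sets j.
    have [E1 E2] := ac_edge_back (Hjm : 0 < j.+1 <= m); rewrite E1 E2 in H2.
    have : ac_edge x j.+1 by case: (ac_edge x j.+1) H2 => //; case: (ac_edge j.+1 x).
    rewrite /ac_edge eqn0Ngt ltn0Sn andbF /= => /orP[/andP[_ H]|/and3P[-> _ ->]] //.
    by clear -H Hjm; lia.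
  apply/hasP; exists (x - m.+1); first by case: Hxm.
  apply: map_f; move: Hx; rewrite mem_cat inE ac_mem_Cl => /orP[H|//].
  by case: Hxm => H1 _; clear -H H1; lia.
Qed.

End AddCandidates.

(** * Adding and deleting voters *)

(* Candidates: 0 is the distinguished candidate p, 1 is a candidate z that passes all
   strong paths back to p, 2 and 3 force the full budget to be spent on selection voters,
   and j + 4 stands for the j-th set. *)
Definition av_clauses m : seq nat := [seq j.+4 | j <- iota 0 m].

(** The margins are [2 * k.+1] from 1 to 0, [2 * k] from 0 to the sets, 2 from 0 to 2 and 3, and
    [4 * k + 2] from 2, 3 and the sets to 1. The last kind is split into two groups, and the
    remaining candidates are distributed so that no vote ranks 1, 2 and 3 all above 0; deletion
    relies on this. *)
Definition av_base m k : seq (seq nat) :=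
  let Cl := av_clauses m in
  times k.+1 (vote_pair [:: 2] [:: 1] [:: 0] (3 :: Cl)) ++
  (times k (vote_pair [:: 2] [:: 0] Cl [:: 3; 1]) ++
  (vote_pair [::] [:: 0] [:: 2; 3] (1 :: Cl) ++
  (times (k + k).+1 (vote_pair [::] (2 :: Cl) [:: 1] [:: 0; 3]) ++
   times (k + k).+1 (vote_pair [::] [:: 3] [:: 1] (0 :: 2 :: Cl))))).

Definition av_vote (sets : seq (seq nat)) o : seq nat :=
  [seq j.+4 | j <- [seq j <- iota 0 (size sets) | ~~ has (fun x => x == o) (nth [::] sets j)]] ++
  0 :: ([seq j.+4 | j <- [seq j <- iota 0 (size sets) | has (fun x => x == o) (nth [::] sets j)]] ++
  [:: 2; 3; 1]).

Definition av_extra (sets : seq (seq nat)) N := [seq av_vote sets o | o <- iota 0 N].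

(** A hitting set stays one when members that are not objects are dropped and others are added until
    it has exactly [k] members, for which [k <= N] leaves room. *)
Lemma hitting_exact sets N k : all (all (fun o => o < N)) sets -> k <= N -> hitting sets k ->
  exists P : pred nat, size (filter P (iota 0 N)) = k /\
    all (has (fun o => P o && (o < N))) sets.
Proof.
move=> Hlt HkN [Q [sQ /allP HQ]].
pose A := undup [seq o <- Q | o < N]; pose B := [seq o <- iota 0 N | o \notin Q].
(* [A] has at most [k] members and survives the cut; [B] supplies arbitrary further objects. *)
pose R := take k (A ++ B).
have uAB : uniq (A ++ B).
  rewrite cat_uniq undup_uniq filter_uniq ?iota_uniq // andbT; apply/hasPn => o.
  by rewrite mem_filter mem_undup mem_filter => /andP[/negbTE ->]; rewrite andbF.
have mAB o : (o \in A ++ B) = (o < N).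
  rewrite mem_cat mem_undup !mem_filter mem_iota.
  by case: (o \in Q); case: (o < N).
have sAB : size (A ++ B) = N.
  rewrite -[RHS](size_iota 0); apply/perm_size/uniq_perm; rewrite ?iota_uniq // => o.
  by rewrite mAB mem_iota.
have sR : size R = k by rewrite size_takel // sAB.
have uR : uniq R by apply: take_uniq.
have RN o : o \in R -> o < N by move=> /mem_take; rewrite mAB.
have AR o : o \in A -> o \in R.
  move=> Ho; rewrite /R take_cat; case: ltnP => HA; last by rewrite mem_cat Ho.
  have : size A <= k.
    by apply: leq_trans (size_undup _) (leq_trans _ sQ); rewrite size_filter count_size.
  by rewrite leqNgt HA.
exists (mem R); split.
  rewrite -sR; apply/perm_size/uniq_perm; rewrite ?filter_uniq ?iota_uniq // => o.
  rewrite mem_filter mem_iota; apply/andP/idP => [[]//|Ho]; split=> //; exact: RN.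
apply/allP => s Hs; have /hasP[o Ho HoQ] := HQ _ Hs; apply/hasP; exists o => //.
have HoN := allP (allP Hlt _ Hs) _ Ho; rewrite HoN andbT; apply: AR.
by rewrite mem_undup mem_filter; apply/andP.
Qed.

Lemma WMG_split (T : Type) (f : T -> seq nat) (P : pred T) s a b :
  WMG (map f s) a b = (WMG (map f (filter P s)) a b + WMG (map f (filter (fun x => ~~ P x) s)) a b)%R.
Proof.
elim: s => [|x s IH]; first by rewrite !WMG_nil.
by rewrite map_cons WMG_cons IH /=; case: (P x) => /=; rewrite !WMG_cons; lia.
Qed.

Section Voters.
Variables (sets : seq (seq nat)) (N k : nat).
Notation m := (size sets).
Notation Cl := (av_clauses m).
Notation C := (0 :: 1 :: 2 :: 3 :: Cl).
Notation base := (av_base m k).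

Lemma av_mem a : (a \in Cl) = (3 < a < m + 4).
Proof.
apply/mapP/idP => [[j]|H]; first by rewrite mem_iota => H ->; lia.
by exists (a - 4); rewrite ?mem_iota; lia.
Qed.

Lemma av_small : ((0 \in Cl) = false) * ((1 \in Cl) = false) * ((2 \in Cl) = false) * ((3 \in Cl) = false).
Proof. by split; [split; [split|]|]; rewrite av_mem. Qed.

Lemma av_uniq : uniq C.
Proof.
rewrite /= !inE !av_small //= map_inj_uniq ?iota_uniq //.
by move=> i j [].
Qed.

Definition target y := [|| y == 2, y == 3 | y \in Cl].

Lemma av_memC a : (a \in C) = [|| a == 0, a == 1 | target a].
Proof. by rewrite !inE. Qed.

Lemma av_perms : [/\ perm_eq ([:: 2] ++ [:: 1] ++ [:: 0] ++ 3 :: Cl) C,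
  perm_eq ([:: 2] ++ [:: 0] ++ Cl ++ [:: 3; 1]) C,
  perm_eq ([::] ++ [:: 0] ++ [:: 2; 3] ++ 1 :: Cl) C,
  perm_eq ([::] ++ (2 :: Cl) ++ [:: 1] ++ [:: 0; 3]) C
  & perm_eq ([::] ++ [:: 3] ++ [:: 1] ++ 0 :: 2 :: Cl) C].
Proof. by split; apply/permP => p; rewrite /= ?count_cat /=; lia. Qed.

Lemma av_base_valid : valid_votes C base.
Proof.
have [P1 P2 P3 P4 P5] := av_perms; apply/allP => v; rewrite /av_base.
rewrite mem_cat => /orP[/mem_times H|]; first exact: perm_vote_pair P1 H.
rewrite mem_cat => /orP[/mem_times H|]; first exact: perm_vote_pair P2 H.
rewrite mem_cat => /orP[H|]; first exact: perm_vote_pair P3 H.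
rewrite mem_cat => /orP[/mem_times H|/mem_times H]; first exact: perm_vote_pair P4 H.
exact: perm_vote_pair P5 H.
Qed.

Lemma av_base_WMG a b : a \in C -> b \in C -> WMG base a b =
  (k.+1%:Z * edge [:: 1] [:: 0] a b + k%:Z * edge [:: 0] Cl a b + edge [:: 0] [:: 2; 3] a b
   + (k + k).+1%:Z * edge (2 :: Cl) [:: 1] a b + (k + k).+1%:Z * edge [:: 3] [:: 1] a b)%R.
Proof.
move=> Ha Hb; have [P1 P2 P3 P4 P5] := av_perms; have Hu := av_uniq.
have Hp X A B Y : perm_eq (X ++ A ++ B ++ Y) C -> WMG (vote_pair X A B Y) a b = edge A B a b.
  by move=> H; apply: WMG_pair; rewrite ?(perm_uniq H) ?(perm_mem H).
rewrite /av_base WMG_cat WMG_times (Hp _ _ _ _ P1) WMG_cat WMG_times (Hp _ _ _ _ P2).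
rewrite WMG_cat (Hp _ _ _ _ P3) WMG_cat WMG_times (Hp _ _ _ _ P4) WMG_times (Hp _ _ _ _ P5).
by rewrite !addrA.
Qed.

Lemma target_cases y : target y ->
  [/\ y != 0, y != 1, y \in C & [\/ y = 2, y = 3 | [/\ y != 2, y != 3 & y \in Cl]]].
Proof.
move=> Hy; have HC : y \in C by rewrite av_memC Hy !orbT.
have Hn i : i < 4 -> y \in Cl -> y != i by move=> Hi; rewrite av_mem => Hl; lia.
case/or3P: Hy HC => [/eqP ->|/eqP ->|Hy] HC; split=> //.
- by constructor 1.
- by constructor 2.
- exact: Hn.
- exact: Hn.
- by constructor 3; split=> //; apply: Hn.
Qed.

Lemma base_10 : WMG base 1 0 = Posz (2 * k.+1).
Proof. by rewrite av_base_WMG ?inE // /edge !inE !av_small //=; lia. Qed.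

Lemma base_0t y : target y -> WMG base 0 y = if y \in Cl then Posz (2 * k) else Posz 2.
Proof.
case/target_cases => y0 y1 yC Hy; rewrite av_base_WMG ?inE // /edge !inE !av_small //=.
rewrite ?(negbTE y0) ?(negbTE y1) /=; case: Hy => [->|->|[/negbTE E1 /negbTE E2 E3]] /=;
  rewrite ?E1 ?E2 ?E3 ?av_small //=; lia.
Qed.

Lemma base_t1 y : target y -> WMG base y 1 = Posz (4 * k + 2).
Proof.
case/target_cases => y0 y1 yC Hy; rewrite av_base_WMG ?inE // /edge !inE !av_small //=.
rewrite ?(negbTE y0) ?(negbTE y1) /=; case: Hy => [->|->|[/negbTE E1 /negbTE E2 E3]] /=;
  rewrite ?E1 ?E2 ?E3 ?av_small //=; lia.
Qed.

Lemma base_tt x y : target x -> target y -> WMG base x y = 0%R.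
Proof.
case/target_cases => x0 x1 xC _; case/target_cases => y0 y1 yC _.
rewrite av_base_WMG // /edge !inE.
by rewrite (negbTE y0) (negbTE y1) (negbTE x0) (negbTE x1) /= !andbF; lia.
Qed.

(** [U] stands for [base] changed by at most [k] votes. The margins leave enough room that the edge
    from 1 remains the strongest into 0, that all edges from targets to 1 are at least as strong,
    and that edges into a target from anything but 0 are weaker. So the way back from a target
    through 1 has strength exactly [WMG U 1 0], and a path matching it must enter the target from 0.
    Candidate 1 itself is reached through 2. *)
Lemma av_winner U :
  (forall a b : nat, a \in C -> b \in C ->
     (WMG base a b - k%:Z <= WMG U a b <= WMG base a b + k%:Z)%R) ->
  schulze_winner C U 0 <-> forall y, target y -> (WMG U 1 0 <= WMG U 0 y)%R.
Proof.
move=> HU; set tau := WMG U 1 0.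
have C0 : 0 \in C by rewrite inE.
have C1 : 1 \in C by rewrite !inE.
have CT y : target y -> y \in C by case/target_cases.
have Htau : (k%:Z + 2 <= tau <= 3 * k%:Z + 2)%R by have := HU 1 0 C1 C0; rewrite base_10 -/tau; lia.
have Ha x y : x \in C -> target y -> x != y -> x != 0 -> (WMG U x y < tau)%R.
  move=> Hx Hy _ Hx0; have := HU x y Hx (CT y Hy).
  move: Hx; rewrite av_memC (negbTE Hx0) /= => /orP[/eqP ->|Hx].
    by rewrite WMG_anti base_t1 //; clear -Htau; lia.
  by rewrite base_tt //; clear -Htau; lia.
have Hb y : target y -> (tau <= WMG U y 1)%R.
  by move=> Hy; have := HU y 1 (CT y Hy) C1; rewrite base_t1 //; clear -Htau; lia.
have Hc x : x \in C -> x != 0 -> (WMG U x 0 <= tau)%R.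
  move=> Hx Hx0; have := HU x 0 Hx C0; move: Hx.
  rewrite av_memC (negbTE Hx0) /= => /orP[/eqP ->|Hx]; first by rewrite -/tau.
  by rewrite [WMG base _ _]WMG_anti base_0t //; case: ifP => _; clear -Htau; lia.
split=> [[_ Hw] y Hy|H].
  have [y0 y1 _ _] := target_cases Hy.
  have [s [Hp Hs]] := Hw y (CT y Hy) y0.
  have Hback : is_path C y 0 [:: 1; 0] by apply: is_path2; rewrite // CT.
  have := Hs _ Hback; rewrite strength2 min_r ?Hb // -/tau => {}Hs.
  have y0' : 0 != y by rewrite eq_sym.
  have [x [s2 [Es Ex Hx Hxy]]] := path_last Hp y0'.
  have := strength_rcons U 0 s2 y; rewrite -Es -Ex // => H2.
  have Hle := le_trans Hs H2.
  have [E|Hx0] := eqVneq x 0; first by rewrite E in Hle.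
  by have := Ha _ _ Hx Hy Hxy Hx0; rewrite ltNge Hle.
split=> //; suff main (d : nat) : d \in C -> d != 0 -> exists s,
   is_path C 0 d s /\ (tau <= strength U 0 s)%R.
  move=> d Hd Hd0; have [s [Hp Hs]] := main d Hd Hd0; exists s; split=> // s' Hp'.
  have [x [s2 [-> -> Hx Hx0]]] := path_last Hp' Hd0.
  by apply: le_trans (strength_rcons _ _ _ _) (le_trans (Hc _ Hx Hx0) Hs).
move=> Hd Hd0; move: (Hd); rewrite av_memC (negbTE Hd0) /= => /orP[/eqP E|Ht].
  rewrite E; exists [:: 2; 1]; split; first by apply: is_path2; rewrite // ?inE.
  by rewrite strength2 le_min H ?Hb.
exists [:: d]; split; last exact: H.
by apply: is_path1; rewrite // eq_sym.
Qed.

Notation W := (av_extra sets N).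

Definition hits (y o : nat) : bool := o \in nth [::] sets (y - 4).

Lemma av_vote_perm o : perm_eq (av_vote sets o) C.
Proof.
apply/permP => p; rewrite /av_vote /av_clauses.
rewrite [in RHS]/= (count_split _ _ (fun j => has (fun x => x == o) (nth [::] sets j))).
by rewrite count_cat /= count_cat /=; lia.
Qed.

Lemma av_extra_valid : valid_votes C W.
Proof. by apply/allP => _ /mapP[o _ ->]; apply: av_vote_perm. Qed.

Lemma av_extra_rev_valid : valid_votes C (map rev W).
Proof.
by apply/allP => _ /mapP[v /(allP av_extra_valid) H ->]; rewrite /= perm_rev.
Qed.

Lemma prefers_mid (s1 s2 : seq nat) (a b : nat) : a \notin s1 -> b != a ->
  prefers (s1 ++ a :: s2) b a = (b \in s1).
Proof.
move=> /negbTE Ha Hb; rewrite prefers_cat Ha; case: (b \in s1) => //.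
by rewrite /prefers /= eqxx ltn0.
Qed.

Lemma av_prefers o y : y \in 1 :: 2 :: 3 :: Cl ->
  prefers (av_vote sets o) y 0 = (y \in Cl) && ~~ hits y o.
Proof.
move=> Hy; rewrite prefers_mid; first last.
- by apply/eqP => E; move: Hy; rewrite E !inE av_small.
- by apply/negP => /mapP[].
apply/mapP/andP => [[j]|[H1 H2]].
  rewrite mem_filter has_pred1 mem_iota => /andP[H1 H2] ->; split.
    by apply: map_f; rewrite mem_iota.
  by rewrite /hits; have -> : j.+4 - 4 = j by lia.
exists (y - 4); last by move: H1; rewrite av_mem; lia.
by rewrite mem_filter has_pred1 H2 mem_iota; move: H1; rewrite av_mem; lia.
Qed.

Lemma av_sgn o y : y \in 1 :: 2 :: 3 :: Cl ->
  sgn (av_vote sets o) 0 y = if (y \in Cl) && ~~ hits y o then (- 1)%R else 1%R.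
Proof.
move=> Hy; have H0 : 0 != y by apply/eqP => E; move: Hy; rewrite -E !inE av_small.
have H1 : 0 \in av_vote sets o by rewrite (perm_mem (av_vote_perm o)) inE.
by rewrite sgnE ?H1 // prefersN 1?eq_sym ?H1 ?orbT // av_prefers //; case: (_ && _).
Qed.

Lemma av_WMG_votes L y : y \in 1 :: 2 :: 3 :: Cl -> WMG (map (av_vote sets) L) 0 y =
  (if y \in Cl then 2 * (count (hits y) L)%:Z - (size L)%:Z else (size L)%:Z)%R.
Proof.
move=> Hy; elim: L => [|o L IH]; first by rewrite WMG_nil /=; case: ifP.
rewrite map_cons WMG_cons IH av_sgn // [count _ _]/= [size (o :: L)]/=.
by case: (y \in Cl) => /=; case: (hits y o) => /=; lia.
Qed.

(** The edge from 1 to 0 has weight [2 * k + 2 - size L]. The edge from 0 to 2 or 3 has weight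
    [2 + size L], which suffices iff [k <= size L]; that to a set has [2 * k - size L] plus twice
    the number of hits, which suffices iff there is a hit. *)
Lemma av_winner_votes U L : size L <= k ->
  (forall a b : nat, a \in C -> b \in C ->
     WMG U a b = WMG base a b + WMG (map (av_vote sets) L) a b)%R ->
  schulze_winner C U 0 <-> size L = k /\ all (has (mem L)) sets.
Proof.
move=> HL HU; have C0 : 0 \in C by rewrite inE.
have C1 : 1 \in C by rewrite !inE.
rewrite av_winner; last first.
  move=> a b Ha Hb; rewrite HU //; have := WMG_bound (map (av_vote sets) L) a b.
  rewrite size_map; lia.
have Ht y : target y -> (WMG U 1 0 <= WMG U 0 y)%R =
    if y \in Cl then has (hits y) L else k <= size L.
  move=> Hy; have [y0 y1 yC Hc] := target_cases Hy.
  rewrite !HU // base_10 base_0t // [WMG _ 1 0]WMG_anti !av_WMG_votes ?inE ?av_small //=; last first.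
    by move: yC; rewrite !inE (negbTE y0).
  by rewrite has_count; case: ifP => _; lia.
have mCl j : j < m -> j.+4 \in Cl by move=> Hj; rewrite av_mem; lia.
split=> [H|[sL /allP aL] y Hy].
  split.
    by apply/eqP; rewrite eqn_leq HL; have := H 2 isT; rewrite Ht // av_small.
  apply/(all_nthP [::]) => j Hj; have Hy : target j.+4 by rewrite /target mCl.
  have := H _ Hy; rewrite Ht // mCl // => /hasP[o Ho]; rewrite /hits.
  have -> : j.+4 - 4 = j by lia.
  by move=> Hoj; apply/hasP; exists o.
rewrite Ht //; case: ifP => Hc; last by rewrite sL.
have Hj : y - 4 < m by move: Hc; rewrite av_mem; lia.
by have /hasP[o Ho HoL] := aL _ (mem_nth [::] Hj); apply/hasP; exists o.
Qed.

Hypothesis sets_lt : all (all (fun o => o < N)) sets.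

Lemma av_hitting : k <= N -> hitting sets k <-> exists msk : bitseq,
  size (mask msk W) <= k /\ schulze_winner C (base ++ mask msk W) 0.
Proof.
move=> HkN; split=> [H|[msk [Hs Hw]]].
  have [P [sP aP]] := hitting_exact sets_lt HkN H.
  exists (map P (iota 0 N)); rewrite /av_extra -map_mask -filter_mask; split.
    by rewrite size_map sP.
  apply/(av_winner_votes (L := filter P (iota 0 N))); first by rewrite sP.
    by move=> a b _ _; rewrite WMG_cat.
  split=> //; apply: sub_all aP => s /hasP[o Ho /andP[H1 H2]]; apply/hasP; exists o => //.
  by rewrite inE mem_filter H1 mem_iota.
move: Hs Hw; rewrite /av_extra -map_mask size_map => Hs Hw.
exists (mask msk (iota 0 N)); split=> //.
have [|_ //] := (av_winner_votes (L := mask msk (iota 0 N)) Hs _).1 Hw.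
by move=> a b _ _; rewrite WMG_cat.
Qed.

(* Deleting the reverse of a vote from these votes acts like adding the vote to [base]. *)
Notation all_votes := (base ++ W ++ map rev W).

Lemma WMG_rev V a b : valid_votes C V -> a \in C -> b \in C ->
  WMG (map rev V) a b = (- WMG V a b)%R.
Proof.
move=> /allP HV Ha Hb; elim: V HV => // v V IH HV.
have Hv := HV v (mem_head _ _).
rewrite map_cons !WMG_cons IH => [|u Hu]; last by rewrite HV // inE Hu orbT.
by rewrite sgn_rev ?(perm_uniq Hv) ?(perm_mem Hv) ?opprD //; apply: av_uniq.
Qed.

Lemma av_delete : hitting sets k -> k <= N -> exists msk : bitseq,
  size all_votes - size (mask msk all_votes) <= k /\ schulze_winner C (mask msk all_votes) 0.
Proof.
move=> H HkN; have [P [sP aP]] := hitting_exact sets_lt HkN H.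
(* Only the reverses of the chosen votes are deleted; each remaining reverse cancels against its
   original. *)
exists (nseq (size base) true ++ (nseq (size W) true ++ map (predC P) (iota 0 N))).
rewrite !mask_cat ?size_nseq // !mask_true // /av_extra -!map_mask -filter_mask.
have sN : size [seq o <- iota 0 N | predC P o] + k = N.
  by rewrite -[RHS](size_iota 0 N) -(count_predC P (iota 0 N)) -[in LHS]sP !size_filter addnC.
split; first by move: base => B; rewrite !size_cat !size_map size_iota !subnDl leq_subLR sN.
apply/(av_winner_votes (L := filter P (iota 0 N))); first by rewrite sP.
  move=> a b Ha Hb; move: base => B; rewrite !WMG_cat WMG_rev //; last first.
    by apply/allP => _ /mapP[o _ ->]; apply: av_vote_perm.
  have -> : WMG (map (av_vote sets) (iota 0 N)) a b =
    (WMG (map (av_vote sets) (filter P (iota 0 N))) a b +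
     WMG (map (av_vote sets) (filter (predC P) (iota 0 N))) a b)%R.
    exact: WMG_split.
  by rewrite addrK.
split=> //; apply: sub_all aP => s /hasP[o Ho /andP[H1 H2]]; apply/hasP; exists o => //.
by rewrite inE mem_filter H1 mem_iota.
Qed.

(** Shows that a vote ranking 1, 2 and 3 above 0 is none of [base]; the deleted votes will be
    recognized by this. *)
Lemma base_split v : v \in base -> exists s1 s2,
  [/\ v = s1 ++ 0 :: s2, 0 \notin s1 & ~~ [&& 1 \in s1, 2 \in s1 & 3 \in s1]].
Proof.
have fin s1 s2 (w : seq nat) : w = s1 ++ 0 :: s2 -> 0 \notin s1 ->
    ~~ [&& 1 \in s1, 2 \in s1 & 3 \in s1] -> exists s1 s2,
  [/\ w = s1 ++ 0 :: s2, 0 \notin s1 & ~~ [&& 1 \in s1, 2 \in s1 & 3 \in s1]].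
  by move=> H1 H2 H3; exists s1, s2.
have pair X A B Y w : w \in vote_pair X A B Y -> w = X ++ A ++ B ++ Y \/
    w = rev Y ++ rev A ++ rev B ++ rev X.
  by rewrite !inE => /orP[] /eqP ->; [left | right].
rewrite /av_base.
rewrite mem_cat => /orP[/mem_times/pair[] ->|].
- by apply: (fin [:: 2; 1]).
- apply: (fin (rev (3 :: Cl) ++ [:: 1]) [:: 2]); first by rewrite -catA.
    by rewrite mem_cat mem_rev !inE av_small.
  by rewrite !mem_cat !mem_rev !inE !av_small.
rewrite mem_cat => /orP[/mem_times/pair[] ->|].
- by apply: (fin [:: 2]).
- by apply: (fin [:: 1; 3]).
rewrite mem_cat => /orP[/pair[] ->|].
- by apply: (fin [::]).
- by apply: (fin (rev (1 :: Cl)) [:: 3; 2]); rewrite // !mem_rev !inE !av_small.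
rewrite mem_cat => /orP[] /mem_times/pair[] ->.
- apply: (fin (2 :: Cl ++ [:: 1]) [:: 3]); first by rewrite /= -catA.
    by rewrite inE mem_cat !inE av_small.
  by rewrite !inE !mem_cat !inE !av_small.
- by apply: (fin [:: 3]).
- by apply: (fin [:: 3; 1]).
- apply: (fin (rev (2 :: Cl)) [:: 3; 1]); first by rewrite [rev (0 :: _)]rev_cons -cats1 -catA.
    by rewrite mem_rev !inE av_small.
  by rewrite !mem_rev !inE !av_small.
Qed.

(** Yields unanimity: a margin as large as the number of votes leaves no room for a vote to the
    contrary. *)
Lemma WMG_sum_bound (r : seq (seq nat)) a b (v : seq nat) : v \in r -> (WMG r a b <= sgn v a b + (size r).-1%:Z)%R.
Proof.
elim: r => // u r IH; rewrite inE WMG_cons /= => /orP[/eqP <-|Hv].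
  by have := WMG_bound r a b; lia.
have : 0 < size r by case: (r) Hv.
by have := IH Hv; have := sgn_bound u a b; lia.
Qed.

(** Winning forces the deleted votes [r] to be exactly [k] in number and to rank 1, 2 and 3 above 0
    unanimously. Only reversed votes of objects do so, and the objects behind them hit all sets. *)
Lemma av_delete_hitting (msk : bitseq) :
  size all_votes - size (mask msk all_votes) <= k ->
  schulze_winner C (mask msk all_votes) 0 -> hitting sets k.
Proof.
move=> Hs Hw; have [r Hr] : exists r : seq (seq nat), perm_eq all_votes (mask msk all_votes ++ r).
  by have [r Hr] := perm_to_subseq (mask_subseq msk all_votes); exists r.
set U := mask msk all_votes in Hs Hw Hr; have C0 : 0 \in C by rewrite inE.
have sr : size r <= k by rewrite (perm_size Hr) size_cat addKn in Hs.
have HU (a b : nat) : a \in C -> b \in C -> (WMG U a b = WMG base a b - WMG r a b)%R.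
  move=> Ha Hb; have : WMG all_votes a b = WMG (U ++ r) a b by rewrite /WMG !(permP Hr).
  by rewrite !WMG_cat WMG_rev ?av_extra_valid //; lia.
have HUb (a b : nat) : a \in C -> b \in C ->
    (WMG base a b - k%:Z <= WMG U a b <= WMG base a b + k%:Z)%R.
  by move=> Ha Hb; rewrite HU //; have := WMG_bound r a b; move: sr; clear; lia.
have {}Hw := (av_winner HUb).1 Hw.
have {}Hw (y : nat) : target y ->
    (Posz (2 * k.+1) <= WMG r 1 0 + WMG r y 0 + (if y \in Cl then Posz (2 * k) else Posz 2))%R.
  move=> Hy; have [y0 y1 yC _] := target_cases Hy; have := Hw y Hy.
  rewrite !HU ?inE // ?base_10 ?base_0t // [WMG r 0 y]WMG_anti.
  by case: (y \in Cl) => H; clear -H; lia.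
have Hup (y : nat) := WMG_bound r y 0.
(* For 2 and 3 the inequality says that two margins among at most [k] deleted votes add up to at
   least [2 * k], so each of them equals [k]. *)
have Hall (y : nat) : y \in [:: 1; 2; 3] -> WMG r y 0 = Posz k.
  have := Hw 2 isT; have := Hw 3 isT; rewrite !av_small.
  have := Hup 1; have := Hup 2; have := Hup 3; clear -sr.
  by move=> H1 H2 H3 H4 H5; rewrite !inE => /or3P[] /eqP ->; lia.
have rP (v : seq nat) : v \in r -> v \in map rev W.
  move=> Hv; have : v \in all_votes by rewrite (perm_mem Hr) mem_cat Hv orbT.
  have Hp (y : nat) : y \in [:: 1; 2; 3] -> prefers v y 0.
    move=> Hy; have := WMG_sum_bound y 0 Hv; rewrite Hall //.
    have : 0 < size r by case: (r) Hv.
    rewrite /sgn; case: (prefers v y 0) => //; case: (prefers v 0 y); lia.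
  rewrite mem_cat => /orP[/base_split[s1 [s2 [E H0]]]|].
    by rewrite -!(prefers_mid s2 H0) // -E !Hp.
  rewrite mem_cat => /orP[|//].
  case/mapP => o _ E; have := Hp 2 isT; rewrite E av_prefers ?av_small //.
have kpos : 0 < size sets -> 0 < k.
  move=> Hm; have := Hw 4; rewrite /target av_mem.
  have -> : 3 < 4 < m + 4 by lia.
  by rewrite !orbT => /(_ isT); have := Hup 4; have := Hup 1; lia.
(* Distinct objects may cast equal votes, but then they hit the same sets, so the first such object
   will do. *)
pose ob (v : seq nat) := index v (map rev W).
exists (map ob r); split; first by rewrite size_map.
apply/(all_nthP [::]) => j Hj.
have Hjm : j < m by exact: Hj.
have HjC : j.+4 \in Cl by rewrite av_mem; lia.
have := Hw j.+4; rewrite /target HjC => /(_ isT) Hj4.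
(* If every deleted vote ranked the set below 0, its margin would cancel the margin [k] of candidate
   1, while a sum of at least 2 is required. *)
have : has (fun v => prefers v j.+4 0) r.
  apply/negPn/negP => /hasPn Hn.
  have : WMG r j.+4 0 = (- (size r)%:Z)%R.
    have Hr' (v : seq nat) : v \in r -> sgn v j.+4 0 = (-1)%R.
      move=> Hv; rewrite sgnE //; first by rewrite (negbTE (Hn _ Hv)).
      have /mapP[u Hu ->] := rP _ Hv.
      by rewrite mem_rev (perm_mem (allP av_extra_valid _ Hu)) !inE HjC !orbT.
    elim: (r) Hr' => // v s IH Hr'; rewrite WMG_cons IH => [|u Hu]; last by rewrite Hr' // inE Hu orbT.
    by rewrite Hr' ?mem_head //=; lia.
  have := kpos (leq_ltn_trans (leq0n _) Hj); have := Hall 1 isT; have := Hup 1; clear -Hj4 sr; lia.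
case/hasP => v Hv Hp; have Hv' := rP _ Hv.
have Ho : ob v < N by rewrite -[N](size_iota 0) -(size_map (av_vote sets)) -(size_map rev) index_mem.
have Ev : rev (av_vote sets (ob v)) = v.
  have := nth_index [::] Hv'; rewrite -/(ob v) (nth_map [::]) ?size_map ?size_iota //.
  by rewrite (nth_map 0) ?size_iota // nth_iota.
apply/hasP; exists (ob v); last exact: map_f.
move: Hp; rewrite -{1}Ev prefers_rev; last 3 first.
- by rewrite (perm_uniq (av_vote_perm _)) av_uniq.
- by rewrite (perm_mem (av_vote_perm _)) !inE HjC !orbT.
- by rewrite (perm_mem (av_vote_perm _)).
rewrite prefersN //; last first.
  by rewrite (perm_mem (av_vote_perm _)) !inE HjC !orbT.
rewrite av_prefers ?HjC /= ?negbK; last by rewrite !inE HjC !orbT.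
by rewrite /hits; have -> : j.+4 - 4 = j by lia.
Qed.

End Voters.

(** * The reductions are computable in polynomial time *)

(** The induction on [D] takes place outside the programs: [D] is a constant depending on [d], so it
    may enter the degree of the polynomial. *)
Lemma good_tuples_id (A : Type) (eA : encodable A) D : good (fun s : seq A => tuples D s).
Proof.
elim: D => [|D IH]; first exact: good_const.
have H : @good (seq A * A) _ _ _ (fun p => tuples D p.1) by apply: good_comp IH _; good_tac.
by rewrite /=; good_tac.
Qed.

Section Good.
Context {E : Type} {eE : encodable E}.

Lemma good_addn (f g : E -> nat) : good f -> good g -> good (fun e => f e + g e).
Proof.
move=> Hf Hg; apply: good_ext (_ : good (fun e => size (nseq (f e) false ++ nseq (g e) false))) _.
  by good_tac.
by move=> e; rewrite size_cat !size_nseq.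
Qed.

Lemma good_nth (A : Type) (eA : encodable A) (x0 : A) (l : E -> seq A) (i : E -> nat) :
  good l -> good i -> good (fun e => nth x0 (l e) (i e)).
Proof.
move=> Hl Hi; apply: good_ext (_ : good (fun e =>
    head x0 (foldl (fun s (_ : bool) => behead s) (l e) (nseq (i e) false)))) _.
  apply: good_head; eapply (good_foldl_add (Q := fun=> 0)) => //; try by good_tac.
    by poly_tac.
  by move=> e [|y s] x; rewrite /behead ?len_cons; lia.
by move=> e; elim: (i e) (l e) => [|n IH] [|y s] //=; rewrite IH ?nth_nil.
Qed.

Lemma good_tuples (A : Type) (eA : encodable A) D (l : E -> seq A) :
  good l -> good (fun e => tuples D (l e)).
Proof. by move=> Hl; apply: good_comp (good_tuples_id _ _) Hl. Qed.

Lemma good_slots D (k : E -> nat) : good k -> good (fun e => slots D (k e)).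
Proof. by move=> Hk; apply: good_tuples; good_tac. Qed.

Lemma good_objects D (n k : E -> nat) : good n -> good k -> good (fun e => objects D (n e) (k e)).
Proof. by move=> Hn Hk; apply: good_tuples; good_tac. Qed.

Lemma good_compat (o o' : E -> seq item) : good o -> good o' -> good (fun e => compat (o e) (o' e)).
Proof. by move=> Ho Ho'; rewrite /compat; good_tac. Qed.

Lemma good_sat_lit (k : E -> nat) (o : E -> seq item) (l : E -> bool * nat) :
  good k -> good o -> good l -> good (fun e => sat_lit (k e) (o e) (l e)).
Proof. by move=> Hk Ho Hl; rewrite /sat_lit; good_tac. Qed.
End Good.

Ltac good_user ::=
  lazymatch goal with
  | |- good (fun e => (@?w1 e) - (@?w2 e)) => apply: good_subn
  | |- good (fun e => (@?w1 e) + (@?w2 e)) => apply: good_addn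
  | |- good (fun e => (@?w1 e) <= (@?w2 e)) => apply: good_leq
  | |- good (fun e => iota 0 (@?w1 e)) => apply: good_iota
  | |- good (fun e => nth (@?w1 e) (@?w2 e) (@?w3 e)) => apply: good_nth
  | |- good (fun e => undup (@?w1 e)) => apply: good_undup
  | |- good (fun e => index (@?w1 e) (@?w2 e)) => apply: good_index
  | |- good (fun e => ubin (@?w1 e)) => apply: good_ubin
  | |- good (fun e => slots (@?w1 e) (@?w2 e)) => apply: good_slots
  | |- good (fun e => objects (@?w1 e) (@?w2 e) (@?w3 e)) => apply: good_objects
  | |- good (fun e => compat (@?w1 e) (@?w2 e)) => apply: good_compat
  | |- good (fun e => sat_lit (@?w1 e) (@?w2 e) (@?w3 e)) => apply: good_sat_lit
  | |- good (@flatten _) => exact: (good_flatten good_id)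
  | |- good (@size _) => exact: (good_size good_id)
  | |- good (@map _ _ ?h) => apply: (good_map (h := fun=> h) (l := fun e => e))
  | H : good ?f |- good (fun e => ?f (@?w1 e)) => apply: (good_comp H)
  end.

Lemma good_hit_sets D : good (fun p : nat * nat * ixcnf => hit_sets D p.1.1 p.1.2 p.2).
Proof. by rewrite /hit_sets /object_sets /slot; good_tac. Qed.

Lemma good_cnf_vars : good cnf_vars.
Proof. by rewrite /cnf_vars; good_tac. Qed.

Lemma good_cnf_index : good cnf_index.
Proof. by rewrite /cnf_index; have H := good_cnf_vars; good_tac. Qed.

Lemma good_ebits : good ebits.
Proof. by rewrite /ebits; good_tac. Qed.

Lemma good_elist : good elist.
Proof. by rewrite /elist; good_tac. Qed.

Lemma good_valid d : good (valid d).
Proof.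
have H1 := good_ebits; have H2 := good_elist; have H3 := good_parse.
rewrite /valid /wf_input /einput /eform /eclause /eterm /elit; good_tac.
Qed.

Lemma good_ac_votes : good (fun p : seq (seq nat) * nat => ac_votes p.1 p.2).
Proof.
by rewrite /ac_votes /vote_pair /ac_rest /ac_hits /ac_objects /ac_clauses; good_tac.
Qed.

Lemma good_times E (eE : encodable E) (n : E -> nat) (V : E -> seq (seq nat)) :
  good n -> good V -> good (fun e => times (n e) (V e)).
Proof. by move=> Hn HV; rewrite /times; good_tac. Qed.

Lemma good_vote_pair E (eE : encodable E) (X A B Y : E -> seq nat) :
  good X -> good A -> good B -> good Y -> good (fun e => vote_pair (X e) (A e) (B e) (Y e)).
Proof. by move=> HX HA HB HY; rewrite /vote_pair; good_tac. Qed.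

Lemma good_av_base : good (fun p : nat * nat => av_base p.1 p.2).
Proof.
rewrite /av_base /av_clauses.
by repeat first [good_step | apply: good_times | apply: good_vote_pair].
Qed.

Lemma good_av_extra : good (fun p : seq (seq nat) * nat => av_extra p.1 p.2).
Proof. by rewrite /av_extra /av_vote; good_tac. Qed.

Lemma enc_nats l : enc (nats l) = elist [seq ebits (ubin n) | n <- l].
Proof. by rewrite /nats enc_CList -map_comp; congr elist; apply: eq_map => n; exact: enc_CNat. Qed.

Lemma enc_votes V : enc (votes_code V) = elist [seq elist [seq ebits (ubin n) | n <- v] | v <- V].
Proof. by rewrite /votes_code enc_CList -map_comp; congr elist; apply: eq_map => v; exact: enc_nats. Qed.

Lemma good_enc_nats E (eE : encodable E) (l : E -> seq nat) : good l -> good (fun e => enc (nats (l e))).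
Proof.
move=> Hl; have H1 := good_ebits; have H2 := good_elist.
by apply: good_ext (_ : good (fun e => elist [seq ebits (ubin n) | n <- l e])) _; [good_tac | move=> e; rewrite enc_nats].
Qed.

Lemma good_enc_votes E (eE : encodable E) (l : E -> seq (seq nat)) : good l -> good (fun e => enc (votes_code (l e))).
Proof.
move=> Hl; have H1 := good_ebits; have H2 := good_elist.
by apply: good_ext (_ : good (fun e => elist [seq elist [seq ebits (ubin n) | n <- v] | v <- l e])) _;
  [good_tac | move=> e; rewrite enc_votes].
Qed.

Lemma good_enc_nat E (eE : encodable E) (n : E -> nat) : good n -> good (fun e => enc (CNat (n e))).
Proof.
move=> Hn; have H1 := good_ebits.
by apply: good_ext (_ : good (fun e => ebits (ubin (n e)))) _; [good_tac | move=> e; rewrite enc_CNat].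
Qed.

Ltac good_out := repeat first [good_step | apply: good_enc_nats | apply: good_enc_votes | apply: good_enc_nat].

Definition out_AC (p : seq (seq nat) * nat * nat) : seq bool :=
  let: (sets, N, k) := p in
  enc (CList [:: nats (0 :: ac_clauses (size sets)); nats (ac_objects (size sets) N);
                 votes_code (ac_votes sets N); CNat 0; CNat k]).

Definition av_candidates m : seq nat := 0 :: 1 :: 2 :: 3 :: av_clauses m.

Definition out_AV (p : seq (seq nat) * nat * nat) : seq bool :=
  let: (sets, N, k) := p in
  enc (CList [:: nats (av_candidates (size sets)); votes_code (av_base (size sets) k);
                 votes_code (av_extra sets N); CNat 0; CNat k]).

Definition out_DV (p : seq (seq nat) * nat * nat) : seq bool :=
  let: (sets, N, k) := p in
  enc (CList [:: nats (av_candidates (size sets));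
    votes_code (av_base (size sets) k ++ av_extra sets N ++ map rev (av_extra sets N)); CNat 0; CNat k]).

Lemma good_out_AC : good out_AC.
Proof.
have H1 := good_elist; have H2 := good_ac_votes.
apply: good_ext (_ : good (fun p : seq (seq nat) * nat * nat => elist
  [:: enc (nats (0 :: ac_clauses (size p.1.1))); enc (nats (ac_objects (size p.1.1) p.1.2));
      enc (votes_code (ac_votes p.1.1 p.1.2)); enc (CNat 0); enc (CNat p.2)])) _; last by case=> [[]].
have H3 : good (fun p : seq (seq nat) * nat * nat => ac_votes p.1.1 p.1.2) by apply: (good_comp H2); good_tac.
by rewrite /ac_clauses /ac_objects; good_out.
Qed.

Lemma good_out_AV : good out_AV.
Proof.
have H1 := good_elist.
apply: good_ext (_ : good (fun p : seq (seq nat) * nat * nat => elist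
  [:: enc (nats (av_candidates (size p.1.1))); enc (votes_code (av_base (size p.1.1) p.2));
      enc (votes_code (av_extra p.1.1 p.1.2)); enc (CNat 0); enc (CNat p.2)])) _; last by case=> [[]].
have H2 : good (fun p : seq (seq nat) * nat * nat => av_base (size p.1.1) p.2).
  by apply: (good_comp good_av_base (f := fun p : seq (seq nat) * nat * nat => (size p.1.1, p.2))); good_tac.
have H3 : good (fun p : seq (seq nat) * nat * nat => av_extra p.1.1 p.1.2).
  by apply: (good_comp good_av_extra); good_tac.
by rewrite /av_candidates /av_clauses; good_out.
Qed.

Lemma good_out_DV : good out_DV.
Proof.
have H1 := good_elist.
apply: good_ext (_ : good (fun p : seq (seq nat) * nat * nat => elist
  [:: enc (nats (av_candidates (size p.1.1)));
      enc (votes_code (av_base (size p.1.1) p.2 ++ av_extra p.1.1 p.1.2 ++ map rev (av_extra p.1.1 p.1.2)));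
      enc (CNat 0); enc (CNat p.2)])) _; last by case=> [[]].
have H2 : good (fun p : seq (seq nat) * nat * nat => av_base (size p.1.1) p.2).
  by apply: (good_comp good_av_base (f := fun p : seq (seq nat) * nat * nat => (size p.1.1, p.2))); good_tac.
have H3 : good (fun p : seq (seq nat) * nat * nat => av_extra p.1.1 p.1.2).
  by apply: (good_comp good_av_extra); good_tac.
by rewrite /av_candidates /av_clauses; good_out.
Qed.

(* Searching for the weight among 0, ..., n converts it to unary in polynomial time, and a
   larger weight is unsatisfiable. A literal needs two items of an object, hence d.*2. *)
Definition reduction (d : nat) (out : seq (seq nat) * nat * nat -> seq bool) (x : seq bool) : seq bool :=
  if valid d x then
    let F := (parse_input x).1 in let n := size (cnf_vars F) in
    let ks := [seq j <- iota 0 n.+1 | ubin j == (parse_input x).2] in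
    if nilp ks then [::] else
    let k := head 0 ks in
    out (hit_sets d.*2 n k (cnf_index F), size (objects d.*2 n k), size (slots d.*2 k))
  else [::].

Lemma good_reduction d out : good out -> good (reduction d out).
Proof.
move=> H; have H1 := good_parse; have H2 := good_cnf_vars; have H3 := good_cnf_index.
have H4 := good_valid d; rewrite /reduction.
have H5 := good_hit_sets d.*2.
good_tac; apply: (good_comp H5 (f := fun e => (_, _, _))); good_tac.
Qed.

(** * Correctness of the assembled reductions *)

Lemma nats_inj : injective nats.
Proof. by move=> s t [] /inj_map -> // m n []. Qed.

Lemma votes_code_inj : injective votes_code.
Proof. by move=> s t [] /inj_map -> // m n /nats_inj. Qed.

Lemma enc_list_inj l l' : enc (CList l) = enc (CList l') -> forall i, nth (CNat 0) l i = nth (CNat 0) l' i.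
Proof. by move=> /enc_inj[->]. Qed.

Lemma lang_AC sets N k : all (all (fun o => o < N)) sets ->
  hitting sets k <-> lang CCAC (out_AC (sets, N, k)).
Proof.
move=> Hlt; rewrite (ac_hitting Hlt); split=> [H|[C [D [V [p [k' [E _]]]]]]].
  eexists _, _, _, 0, k; split; [reflexivity | | exact: H].
  by rewrite ac_uniq mem_head andbT /=; apply: ac_valid.
have Ei := enc_list_inj E.
have [/nats_inj <- /nats_inj <- /votes_code_inj <-] := And3 (Ei 0) (Ei 1) (Ei 2).
by have [[<-] [<-]] := conj (Ei 3) (Ei 4).
Qed.

Lemma lang_AV sets N k : all (all (fun o => o < N)) sets -> k <= N ->
  hitting sets k <-> lang CCAV (out_AV (sets, N, k)).
Proof.
move=> Hlt HkN; rewrite (av_hitting Hlt HkN); split=> [H|[C [V [W [p [k' [E _]]]]]]].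
  eexists _, _, _, 0, k; split; [reflexivity | | exact: H].
  by rewrite av_uniq mem_head andbT av_base_valid av_extra_valid.
have Ei := enc_list_inj E.
have [/nats_inj <- /votes_code_inj <- /votes_code_inj <-] := And3 (Ei 0) (Ei 1) (Ei 2).
by have [[<-] [<-]] := conj (Ei 3) (Ei 4).
Qed.

Lemma lang_DV sets N k : all (all (fun o => o < N)) sets -> k <= N ->
  hitting sets k <-> lang CCDV (out_DV (sets, N, k)).
Proof.
move=> Hlt HkN; split=> [H|[C [V [p [k' [E _]]]]]].
  eexists _, _, 0, k; split; [reflexivity | | exact: av_delete Hlt H HkN].
  rewrite av_uniq mem_head andbT andTb /valid_votes all_cat.
  apply/andP; split; first exact: av_base_valid.
  by rewrite all_cat; apply/andP; split; [apply: av_extra_valid | apply: av_extra_rev_valid].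
have Ei := enc_list_inj E.
have [/nats_inj <- /votes_code_inj <- [<-] [<-]] := And4 (Ei 0) (Ei 1) (Ei 2) (Ei 3).
by case=> msk [H1 H2]; apply: av_delete_hitting H1 H2.
Qed.

(** The empty word, which encodes nothing, is the answer of [reduction] to malformed inputs and to
    weights that are too large. *)
Lemma not_lang_nil : [/\ ~ lang CCAV [::], ~ lang CCDV [::] & ~ lang CCAC [::]].
Proof.
by split; [move=> [C [V [W [p [k [E _ _]]]]]] | move=> [C [V [p [k [E _ _]]]]] | move=> [C [D [V [p [k [E _ _]]]]]]];
  rewrite enc_CList in E.
Qed.

Lemma size_slots D k : size (slots D k) = k.+2 ^ D.
Proof.
have H s : size (tuples D s) = size s ^ D :> nat; last by rewrite /slots H size_iota.
elim: D s => // D IH s; rewrite [tuples _ _]/= expnS -(IH s).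
elim: (X in size (flatten [seq _ | _ <- X]) = size X * _) => //= x t IHt.
by rewrite size_cat size_map IHt.
Qed.

Lemma reduction_correct P out d : 0 < d -> ~ lang P [::] ->
  (forall sets N k, all (all (fun o => o < N)) sets -> k <= N ->
     hitting sets k <-> lang P (out (sets, N, k))) ->
  forall x, lang (WSat (Gamma 2 d)) x <-> lang P (reduction d out x).
Proof.
move=> Hd Hnil Hout x; rewrite lang_WSat /reduction; case: ifP => Hx; last by split=> // -[].
set y := parse_input x; set n := size _; set ks := [seq j <- _ | _].
have Hy : wf_input d y by case/andP: Hx.
have Hl := wf_last Hy; have [_ Hk] := andP Hy.
have Hks j : (j \in ks) = (j == (bval y.2).-1) && (j < n.+1).
  rewrite mem_filter mem_iota; congr (_ && _); apply/eqP/eqP => [<-|->]; last by rewrite ubin_val.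
  by have [_ ->] := ubin_spec j.
rewrite (sat_wsat _ Hl) -/n; case: ifP => Hn.
  split=> // -[_ /wsat_le Hle]; have := Hks (bval y.2).-1.
  by rewrite eqxx ltnS Hle; case: (ks) Hn.
have -> : head 0 ks = (bval y.2).-1.
  by case: (ks) Hn Hks => // j s _ /(_ j); rewrite mem_head => /esym/andP[/eqP ->].
rewrite -Hout; [|exact: hit_sets_lt|exact: slots_le_objects].
rewrite -wsat_hitting ?double_gt0 //; first by split=> // -[].
  rewrite /cnf_index all_map; apply: sub_all (proj1 (andP Hy)) => c /=; rewrite all_map.
  by apply: sub_all => t /and3P[_ Ht _] /=; rewrite size_map leq_double.
apply/allP => _ /mapP[c Hc ->]; apply/allP => _ /mapP[t Ht ->]; apply/allP => _ /mapP[l Hlt ->] /=.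
rewrite index_mem mem_undup; apply: map_f; apply/flattenP; exists t => //.
by apply/flattenP; exists c.
Qed.

Lemma reduction_param out d x :
  (forall p, param_last (out p) = p.2) ->
  param_last (reduction d out x) <= (param_last x).+2 ^ d.*2.
Proof.
move=> Hout; rewrite /reduction; case: ifP => Hx; last by rewrite param_last_nil.
set ks := [seq j <- _ | _]; have : all (fun j => ubin j == (parse_input x).2) ks by apply: filter_all.
case: (ks) => [_|j s /andP[/eqP E _]]; first by rewrite param_last_nil.
by rewrite Hout [_.2]/= size_slots (param_valid Hx) -E; have [_ ->] := ubin_spec j.
Qed.

(** * Composition of parameterized reductions *)

Lemma ltn_pow2_bits s : bval s < 2 ^ size s.
Proof. by elim: s => //= b s IH; rewrite expnS; case: b; lia. Qed.

Lemma ltn_pow2_bin n : n < 2 ^ size (bin n).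
Proof. by case: n => // n; have [_ H] := bin_succ n; have := ltn_pow2_bits (bin n.+1); rewrite H. Qed.

Lemma bin_pow2 n : bin (2 ^ n) = nseq n false ++ [:: true].
Proof.
have Hv : bval (nseq n false ++ [:: true]) = 2 ^ n by elim: n => //= n ->; rewrite expnS.
have := expn_gt0 2 n; case: (2 ^ n) Hv => // k Hv _; have [H1 H2] := bin_succ k.
by apply: bval_inj; rewrite ?H2 // last_cat.
Qed.

(** Only an upper bound on powers of [f n] is wanted, computed from its binary numeral. Arithmetic
    on numerals is avoided: a power of two is a row of zeros followed by a single one, and the
    length of the numeral of [f n] gives the length of the row. *)
Lemma computable_pow c f : computable f -> computable (fun n => 2 ^ (c * (size (bin (f n))).+1)).
Proof.
pose g (s : seq bool) := nseq (c * (size s).+1) false ++ [:: true].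
have Hg : good g.
  apply: (good_ext (f := fun s => iter c (fun u => false :: nseq (size s) false ++ u) [:: true])).
    by elim: c {g} => [|c IH] /=; good_tac.
  move=> s; rewrite /g; elim: c {g} => // c IH.
  by rewrite iterS IH mulSn nseqD -catA.
move=> [M HM]; have [N [P [_ _ HN]]] := machine_comp M Hg.
exists N => n; have [t /HN[n' _ H]] := HM n.
by exists n'; rewrite bin_pow2.
Qed.

Lemma poly_eval_le cs n : poly_eval cs n <= sumn cs * n.+1 ^ size cs.
Proof.
rewrite /poly_eval sumnE (big_nth 0) big_mkord big_distrl /=; apply: leq_sum => i _.
rewrite leq_mul2l; apply/orP; right; apply: leq_trans (_ : n.+1 ^ i <= _); first exact: leq_exp.
by apply: leq_pexp2l => //; apply: ltnW.
Qed.

(** The binomial theorem supplies the list of coefficients that the definition of an fpt-reduction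
    asks for. *)
Lemma poly_eval_power c e n : poly_eval (mkseq (fun i => c * 'C(e, i)) e.+1) n = c * n.+1 ^ e.
Proof.
rewrite /poly_eval size_mkseq -[n.+1]add1n expnDn big_distrr /=; apply: eq_bigr => i _.
by rewrite nth_mkseq // exp1n mul1n mulnA.
Qed.

(** The image under the given reduction may be as long as its running time, so the second stage
    takes a polynomial of [f k] times a polynomial. This has to be separated again into a computable
    function of the parameter and a polynomial of the input length. *)
Lemma W2_hardI P S : param P = param_last ->
  (forall d, 0 < d -> [/\ good (S d), forall x, lang (WSat (Gamma 2 d)) x <-> lang P (S d x)
     & forall x, param_last (S d x) <= (param_last x).+2 ^ d.*2]) -> W2_hard P.
Proof.
move=> EP HS P' [d [Hd [R [HR [f [cs [M [Hf HM]]]] [g [Hg Hgk]]]]]].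
have [Sg Sl Sk] := HS d Hd; exists (fun x => S d (R x)).
have [N [B [[c [e HB]] mB HN]]] := machine_comp M Sg.
split; first by move=> x; rewrite HR.
  exists (fun n => 2 ^ (e * (size (bin (f n))).+1)).
  exists (mkseq (fun i => c * (sumn cs).+2 ^ e * 'C((size cs).+1 * e, i)) ((size cs).+1 * e).+1), N.
  split=> [|x]; first exact: computable_pow.
  have [t [Ht Hx]] := HM x; have [n Hn Hnx] := HN _ _ _ Hx; exists n; split=> //.
  rewrite poly_eval_power; set k := param P' x in Ht *; set m := size x in Ht Hn *.
  apply: leq_trans Hn (leq_trans (HB _) _).
  (* A product, unlike a sum, keeps the two factors apart when it is raised to the power [e]. *)
  have H1 : (m + t).+1 <= (f k).+1 * ((sumn cs).+2 * m.+1 ^ (size cs).+1).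
    have := poly_eval_le cs m; set q := poly_eval cs m in Ht *; rewrite expnS.
    have : 0 < m.+1 ^ size cs by rewrite expn_gt0.
    move: (m.+1 ^ size cs) (sumn cs) (f k) Ht => z u v Ht Hz Hq.
    have : v * q <= v * (u * z) by rewrite leq_mul2l Hq orbT.
    have : m.+1 <= m.+1 * z by rewrite leq_pmulr.
    by nia.
  have H2 : (f k).+1 <= 2 ^ (size (bin (f k))).+1.
    by rewrite expnS; have := ltn_pow2_bin (f k); lia.
  have := leq_exp e H1; rewrite !expnMn -expnM => H3.
  have := leq_exp e H2; rewrite -expnM [_.+1 * e]mulnC => H4.
  apply: leq_trans (_ : c * ((f k).+1 ^ e * ((sumn cs).+2 ^ e * m.+1 ^ ((size cs).+1 * e))) <= _).
    by rewrite leq_mul2l H3 orbT.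
  by rewrite mulnCA !mulnA !leq_mul2r H4 !orbT.
(* The intermediate parameter is at most [g n], hence below [2 ^ s] for the length [s] of the
   numeral; adding 2 keeps it within [2 ^ s.+1], which is then raised to the power [d.*2]. *)
exists (fun n => 2 ^ (d.*2 * (size (bin (g n))).+1)); split; first exact: computable_pow.
move=> x; rewrite EP; apply: leq_trans (Sk _) _.
rewrite mulnC expnM; apply: leq_exp; rewrite expnS.
by have := Hgk x; have := ltn_pow2_bin (g (param P' x)); rewrite /=; lia.
Qed.

Theorem theorem11 : W2_hard CCAV /\ W2_hard CCDV /\ W2_hard CCAC.
Proof.
have [N1 N2 N3] := not_lang_nil; split; [|split].
- apply: (W2_hardI (S := fun d => reduction d out_AV)) => // d Hd; split.
  + by apply: good_reduction; apply: good_out_AV.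
  + by apply: reduction_correct => // sets N k; apply: lang_AV.
  + move=> x; apply: reduction_param => -[[sets N] k]; exact: (param_last_enc [:: _; _; _; _]).
- apply: (W2_hardI (S := fun d => reduction d out_DV)) => // d Hd; split.
  + by apply: good_reduction; apply: good_out_DV.
  + by apply: reduction_correct => // sets N k; apply: lang_DV.
  + move=> x; apply: reduction_param => -[[sets N] k]; exact: (param_last_enc [:: _; _; _]).
- apply: (W2_hardI (S := fun d => reduction d out_AC)) => // d Hd; split.
  + by apply: good_reduction; apply: good_out_AC.
  + by apply: reduction_correct => // sets N k Hlt _; apply: lang_AC.
  + move=> x; apply: reduction_param => -[[sets N] k]; exact: (param_last_enc [:: _; _; _; _]).
Qed.
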